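(* There exist constants $\mathcal{C}_{\tau,\sigma,\theta}$, $\Xi^{(i,x)}_{\tau,\sigma,\theta}$, $\Xi^{(i,y)}_{\tau,\sigma,\theta}$ ($i=1,2,3$), depending only on the algorithm parameters $(\tau,\sigma,\theta)$ (together with the associated $\rho,\alpha$) and on the problem parameters $(\mu_x,\mu_y,L_{xx},L_{yy},L_{xy},L_{yx})$, such that the following holds, where $\Xi^{(i)}_{\tau,\sigma,\theta} := \Xi^{(i,x)}_{\tau,\sigma,\theta}\,\delta_x^2+\Xi^{(i,y)}_{\tau,\sigma,\theta}\,\delta_y^2$. (a) Suppose the problem assumption and the noise assumption of the context hold, and let $\tau,\sigma>0$, $\theta\ge 0$ satisfy the matrix inequality (MI) of the context for some $\rho\in(0,1)$ and $\alpha\in[0,\sigma^{-1})$. Let $(x_n,y_n)_{n\ge 1}$ be the SAPD iterates initialized at an arbitrary $(x_0,y_0)\in\mathrm{dom} f\times\mathrm{dom} g$. Then for all $n\in\mathbb{N}$ and $p\in[0,1)$, $$\mathbb{P}\left[\mathcal{D}_{n+1}+\mathcal{D}_n\le q_{p,n+1}\right]\ge p,$$ where $$q_{p,n+1}:=\left(\frac{1+\rho}{2}\right)^n\left(\mathcal{C}_{\tau,\sigma,\theta}\,\mathcal{D}_{\tau,\sigma}+\Xi^{(1)}_{\tau,\sigma,\theta}\right)+\Xi^{(2)}_{\tau,\sigma,\theta}+\Xi^{(3)}_{\tau,\sigma,\theta}\log\left(\frac{1}{1-p}\right).$$ (b) Under the Chambolle-Pock parameterization $\tau=\frac{1-\theta}{\theta\mu_x}$,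 $\sigma=\frac{1-\theta}{\theta\mu_y}$ (with $\rho=\theta$ and $\alpha=\frac{1}{2\sigma}-\sqrt{\theta}L_{yy}$, which satisfies (MI) for all $\theta<1$ close enough to $1$), one has $\mathcal{C}_{\tau,\sigma,\theta}=\Theta(1)$, $\Xi^{(i,x)}_{\tau,\sigma,\theta}=\Theta(1)$ and $\Xi^{(i,y)}_{\tau,\sigma,\theta}=\Theta(1)$ for $i=1,2,3$ as $\theta\to1$, which implies that, with $z_n=(x_n,y_n)$, $z^\star=(x^\star,y^\star)$ and $\delta^2=\max(\delta_x^2,\delta_y^2)$, $$\limsup_{n\to\infty}Q_p\left(\|z_n-z^\star\|^2\right)=\mathcal{O}\left((1-\theta)\,\delta^2\left(1+\log\left(\frac{1}{1-p}\right)\right)\right)\qquad\text{as }\theta\to 1.$$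
   Context: Problem assumption. $\mathcal{X},\mathcal{Y}$ are finite-dimensional Euclidean spaces. Consider $\min_{x\in\mathcal{X}}\max_{y\in\mathcal{Y}}\mathcal{L}(x,y):=f(x)+\Phi(x,y)-g(y)$, where $f:\mathcal{X}\to\mathbb{R}\cup\{+\infty\}$ and $g:\mathcal{Y}\to\mathbb{R}\cup\{+\infty\}$ are closed and strongly convex with moduli $\mu_x,\mu_y>0$ respectively, $\Phi:\mathcal{X}\times\mathcal{Y}\to\mathbb{R}$ is continuously differentiable on an open set containing $\mathrm{dom} f\times\mathrm{dom} g$, $\Phi(\cdot,y)$ is convex on $\mathrm{dom} f$ for all $y\in\mathrm{dom} g$, $\Phi(x,\cdot)$ is concave on $\mathrm{dom} g$ for all $x\in\mathrm{dom} f$, and there are $L_{xx},L_{yy}\ge0$, $L_{xy},L_{yx}>0$ such that for all $(x,y),(\bar x,\bar y)\in\mathrm{dom} f\times\mathrm{dom} g$, $\|\nabla_x\Phi(x,y)-\nabla_x\Phi(\bar x,\bar y)\|\le L_{xx}\|x-\bar x\|+L_{xy}\|y-\bar y\|$ and $\|\nabla_y\Phi(x,y)-\nabla_y\Phi(\bar x,\bar y)\|\le L_{yx}\|x-\bar x\|+L_{yy}\|y-\bar y\|$. The problem then has a unique saddle point $(x^\star,y^\star)$: $\mathcal{L}(x^\star,y)\le\mathcal{L}(x^\star,y^\star)\le\mathcal{L}(x,y^\star)$ for all $(x,y)$. SAPD algorithm. For a proper closed convex $\varphi$, $\mathrm{prox}_\varphi(x)=\arg\min_u\{\varphi(u)+\frac12\|u-x\|^2\}$.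 Given $\tau,\sigma>0$, $\theta\ge0$, $(x_0,y_0)$, set $\tilde q_0=0$, $x_{-1}=x_0$, $y_{-1}=y_0$, and for $k\ge0$: $\tilde s_k=\tilde\nabla_y\Phi(x_k,y_k,\omega_k^y)+\theta\tilde q_k$; $y_{k+1}=\mathrm{prox}_{\sigma g}(y_k+\sigma\tilde s_k)$; $x_{k+1}=\mathrm{prox}_{\tau f}(x_k-\tau\tilde\nabla_x\Phi(x_k,y_{k+1},\omega_k^x))$; $\tilde q_{k+1}=\tilde\nabla_y\Phi(x_{k+1},y_{k+1},\omega_{k+1}^y)-\tilde\nabla_y\Phi(x_k,y_k,\omega_k^y)$. Here $\tilde\nabla_x\Phi,\tilde\nabla_y\Phi$ are stochastic estimates of the partial gradients and the random variables are revealed in the order $\omega_0^y,\omega_0^x,\omega_1^y,\omega_1^x,\dots$; $\mathcal{F}_k^y$ (resp. $\mathcal{F}_k^x$) is the sigma-algebra generated by all of them up to and including $\omega_k^y$ (resp. $\omega_k^x$), and $\mathcal{F}_{-1}^x$ is trivial. Noise assumption. With $\Delta_k^y=\tilde\nabla_y\Phi(x_k,y_k,\omega_k^y)-\nabla_y\Phi(x_k,y_k)$ and $\Delta_k^x=\tilde\nabla_x\Phi(x_k,y_{k+1},\omega_k^x)-\nabla_x\Phi(x_k,y_{k+1})$, there are $\delta_x,\delta_y>0$ such that for all $k\ge0$, $t\ge0$: $\mathbb{E}[\Delta_k^y|\mathcal{F}_{k-1}^x]=0$, $\mathbb{E}[\Delta_k^x|\mathcal{F}_k^y]=0$, $\mathbb{P}[\|\Delta_k^y\|\ge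 t|\mathcal{F}_{k-1}^x]\le2e^{-t^2/(2\delta_y^2)}$, $\mathbb{P}[\|\Delta_k^x\|\ge t|\mathcal{F}_k^y]\le2e^{-t^2/(2\delta_x^2)}$. Matrix inequality (MI) for $(\tau,\sigma,\theta,\rho,\alpha)$: $$\begin{pmatrix}\frac1\tau+\mu_x-\frac1{\rho\tau}&0&0&0&0\\0&\frac1\sigma+\mu_y-\frac1{\rho\sigma}&(\frac\theta\rho-1)L_{yx}&(\frac\theta\rho-1)L_{yy}&0\\0&(\frac\theta\rho-1)L_{yx}&\frac1\tau-L_{xx}&0&-\frac\theta\rho L_{yx}\\0&(\frac\theta\rho-1)L_{yy}&0&\frac1\sigma-\alpha&-\frac\theta\rho L_{yy}\\0&0&-\frac\theta\rho L_{yx}&-\frac\theta\rho L_{yy}&\frac\alpha\rho\end{pmatrix}\succeq0.$$ Notation. $\mathcal{D}_n=\frac1{2\tau}\|x_n-x^\star\|^2+\frac{1-\alpha\sigma}{2\sigma}\|y_n-y^\star\|^2$; $\mathcal{D}_{\tau,\sigma}=\frac1{2\tau}\|x_0-x^\star\|^2+\frac1{2\sigma}\|y_0-y^\star\|^2$; $Q_p(U)=\inf\{t\in\mathbb{R}:\mathbb{P}[U\le t]\ge p\}$; $h=\Theta(1)$ means $h=\mathcal{O}(1)$ and $1=\mathcal{O}(h)$. *)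

(* Defs.v *)
From HB Require Import structures.
From mathcomp Require Import all_boot all_order all_algebra.
From mathcomp Require Import all_classical all_reals all_analysis.

Set Implicit Arguments.
Unset Strict Implicit.
Unset Printing Implicit Defensive.

Import Order.TTheory GRing.Theory Num.Theory.
Import numFieldNormedType.Exports.

Local Open Scope classical_set_scope.
Local Open Scope ring_scope.

(* The norm that the library puts on ['rV[R]_n] is the sup norm. It is used
   below only through its topology and differentiability; all quantitative
   statements use [enorm]. *)
Definition enorm (R : realType) (n : nat) (x : 'rV[R]_n) : R :=
  Num.sqrt (\sum_(i < n) x 0 i ^+ 2).

Section convex_analysis.
Context {R : realType} {n : nat}.
Implicit Types (phi : 'rV[R]_n -> \bar R).

Definition edom phi : set 'rV[R]_n := [set x | (phi x < +oo)%E].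

Definition closed_fun phi : Prop :=
  closed [set p : 'rV[R]_n * R^o | (phi p.1 <= (p.2)%:E)%E].

(* Since [0 * +oo = 0] in [\bar R], the cases [t = 0] and [t = 1] are trivial
   even when [x] or [y] is outside the domain. *)
Definition strongly_convex (mu : R) phi : Prop :=
  forall (t : R) (x y : 'rV[R]_n), 0 <= t <= 1 ->
    (phi (t *: x + (1 - t) *: y)%R +
       (mu / 2 * (t * (1 - t)) * enorm (x - y) ^+ 2)%R%:E
     <= t%:E * phi x + (1 - t)%R%:E * phi y)%E.

Definition argmin phi : set 'rV[R]_n :=
  [set u | forall v, (phi u <= phi v)%E].

(* For a proper closed convex [phi] the minimizer exists and is unique; the
   default value [0] is irrelevant in that case. *)
Definition prox phi (x : 'rV[R]_n) : 'rV[R]_n :=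
  xget 0 (argmin (fun u => (phi u + (2^-1 * enorm (u - x) ^+ 2)%R%:E)%E)).

End convex_analysis.

Definition gradx (R : realType) (m n : nat) (Phi : 'rV[R]_m * 'rV[R]_n -> R^o)
    (p : 'rV[R]_m * 'rV[R]_n) : 'rV[R]_m :=
  \row_(i < m) 'D_(delta_mx 0 i) (fun x => Phi (x, p.2)) p.1.

Definition grady (R : realType) (m n : nat) (Phi : 'rV[R]_m * 'rV[R]_n -> R^o)
    (p : 'rV[R]_m * 'rV[R]_n) : 'rV[R]_n :=
  \row_(j < n) 'D_(delta_mx 0 j) (fun y => Phi (p.1, y)) p.2.

Definition C1_on (R : realType) (m n : nat)
    (U : set ('rV[R]_m * 'rV[R]_n)) (Phi : 'rV[R]_m * 'rV[R]_n -> R^o) : Prop :=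
  forall p, U p -> [/\ differentiable Phi p,
    {for p, continuous (gradx Phi)} & {for p, continuous (grady Phi)}].

Record problem_params (R : realType) := ProblemParams {
  mux : R; muy : R; Lxx : R; Lyy : R; Lxy : R; Lyx : R }.

Definition valid_problem_params (R : realType) (pp : problem_params R) : Prop :=
  [/\ 0 < mux pp /\ 0 < muy pp, 0 <= Lxx pp, 0 <= Lyy pp, 0 < Lxy pp
    & 0 < Lyx pp].

Record problem (R : realType) (m n : nat) := Problem {
  pf : 'rV[R]_m -> \bar R;
  pg : 'rV[R]_n -> \bar R;
  pPhi : 'rV[R]_m * 'rV[R]_n -> R^o }.

Record problem_assumption (R : realType) (m n : nat) (pp : problem_params R)
    (pb : problem R m n) : Prop := ProblemAssumption {
  pf_Nninfty : forall x, pf pb x != -oo%E;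
  pg_Nninfty : forall y, pg pb y != -oo%E;
  pf_closed : closed_fun (pf pb);
  pg_closed : closed_fun (pg pb);
  pf_sconvex : strongly_convex (mux pp) (pf pb);
  pg_sconvex : strongly_convex (muy pp) (pg pb);
  pPhi_C1 : exists U : set ('rV[R]_m * 'rV[R]_n),
    [/\ open U, edom (pf pb) `*` edom (pg pb) `<=` U & C1_on U (pPhi pb)];
  pPhi_convex : forall y, edom (pg pb) y ->
    convex_function (edom (pf pb)) (fun x => pPhi pb (x, y));
  pPhi_concave : forall x, edom (pf pb) x ->
    convex_function (edom (pg pb)) (fun y => - pPhi pb (x, y));
  gradx_Lipschitz : forall x y x' y',
    edom (pf pb) x -> edom (pg pb) y -> edom (pf pb) x' -> edom (pg pb) y' ->
    enorm (gradx (pPhi pb) (x, y) - gradx (pPhi pb) (x', y'))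
      <= Lxx pp * enorm (x - x') + Lxy pp * enorm (y - y');
  grady_Lipschitz : forall x y x' y',
    edom (pf pb) x -> edom (pg pb) y -> edom (pf pb) x' -> edom (pg pb) y' ->
    enorm (grady (pPhi pb) (x, y) - grady (pPhi pb) (x', y'))
      <= Lyx pp * enorm (x - x') + Lyy pp * enorm (y - y') }.

(* The convention [+oo - +oo = -oo] only matters when [x] and [y] are both
   outside the domains. With it, a saddle point in the sense below necessarily
   lies in [edom (pf pb) `*` edom (pg pb)] when [pf pb] and [pg pb] are
   proper. *)
Definition lagrangian (R : realType) (m n : nat) (pb : problem R m n)
    (x : 'rV[R]_m) (y : 'rV[R]_n) : \bar R :=
  (pf pb x + (pPhi pb (x, y))%:E - pg pb y)%E.

Definition saddle_point (R : realType) (m n : nat) (pb : problem R m n)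
    (xs : 'rV[R]_m) (ys : 'rV[R]_n) : Prop :=
  forall x y, (lagrangian pb xs y <= lagrangian pb xs ys)%E /\
              (lagrangian pb xs ys <= lagrangian pb x ys)%E.

Record algo_params (R : realType) := AlgoParams {
  tau : R; sigma : R; theta : R; rho : R; alpha : R }.

Definition psd (R : realType) (k : nat) (M : 'M[R]_k) : Prop :=
  forall v : 'rV[R]_k, 0 <= (v *m M *m v^T) 0 0.

Definition MI_matrix (R : realType) (a : algo_params R) (pp : problem_params R) :
    'M[R]_5 :=
  let: AlgoParams t s th r al := a in
  let cx := (th / r - 1) * Lyx pp in
  let cy := (th / r - 1) * Lyy pp in
  let ex := - (th / r) * Lyx pp in
  let ey := - (th / r) * Lyy pp in
  \matrix_(i < 5, j < 5) nth 0 (nth [::]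
    [:: [:: t^-1 + mux pp - (r * t)^-1; 0; 0; 0; 0];
        [:: 0; s^-1 + muy pp - (r * s)^-1; cx; cy; 0];
        [:: 0; cx; t^-1 - Lxx pp; 0; ex];
        [:: 0; cy; 0; s^-1 - al; ey];
        [:: 0; 0; ex; ey; al / r]] i) j.

Definition admissible (R : realType) (a : algo_params R)
    (pp : problem_params R) : Prop :=
  [/\ 0 < tau a /\ 0 < sigma a, 0 <= theta a, 0 < rho a < 1,
      0 <= alpha a < (sigma a)^-1 & psd (MI_matrix a pp)].

Definition chambolle_pock (R : realType) (pp : problem_params R) (th : R) :
    algo_params R :=
  let s := (1 - th) / (th * muy pp) in
  {| tau := (1 - th) / (th * mux pp);
     sigma := s;
     theta := th;
     rho := th;
     alpha := (2 * s)^-1 - Num.sqrt th * Lyy pp |}.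

Section conditional.
Context {d : measure_display} {T : measurableType d} {R : realType}.
Variable (P : probability T R).

(* [F] stands for a sub-sigma-algebra of the measurable sets of [T]. *)
Definition measurable_wrt (F : set (set T)) (X : T -> R) : Prop :=
  forall B : set R, measurable B -> F (X @^-1` B).

(* [Z] is a version of the conditional expectation of [X] given [F]. *)
Definition is_condexp (F : set (set T)) (X Z : T -> R) : Prop :=
  [/\ P.-integrable setT (EFin \o X), P.-integrable setT (EFin \o Z),
      measurable_wrt F Z
    & forall A, F A ->
        (\int[P]_(w in A) (X w)%:E = \int[P]_(w in A) (Z w)%:E)%E].

Definition condexp_eq0 (F : set (set T)) (k : nat) (X : T -> 'rV[R]_k) : Prop :=
  forall i : 'I_k, is_condexp F (fun w => X w 0 i) (cst 0).

Definition condprob_le (F : set (set T)) (A : set T) (c : R) : Prop :=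
  exists Z : T -> R, is_condexp F \1_A Z /\ {ae P, forall w, Z w <= c}.

Definition quantile (U : T -> R) (p : R) : \bar R :=
  ereal_inf [set t%:E | t in [set t : R | (p%:E <= P [set w | (U w <= t)%R])%E]].

End conditional.

Record stoch_oracle (R : realType) (m n : nat)
    (d dx dy : measure_display) (T : measurableType d) (P : probability T R)
    (Wx : measurableType dx) (Wy : measurableType dy) := StochOracle {
  estx : 'rV[R]_m -> 'rV[R]_n -> Wx -> 'rV[R]_m;
  esty : 'rV[R]_m -> 'rV[R]_n -> Wy -> 'rV[R]_n;
  omx : nat -> {RV P >-> Wx};
  omy : nat -> {RV P >-> Wy} }.

Section sapd.
Context {R : realType} {m n : nat} {d dx dy : measure_display}.
Context {T : measurableType d} {P : probability T R}.
Context {Wx : measurableType dx} {Wy : measurableType dy}.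
Variables (pb : problem R m n) (o : stoch_oracle m n P Wx Wy).

(* The sigma-algebra generated by the first [i] variables [omy] and the first
   [j] variables [omx]. In the order of revelation, [history k k] is what is
   known just before [omy k] (so [history 0 0] is trivial) and [history k.+1 k]
   is what is known just after [omy k]. *)
Definition history (i j : nat) : set (set T) :=
  <<s (\bigcup_(l in `I_i) preimage_set_system setT (omy o l) measurable) `|`
      (\bigcup_(l in `I_j) preimage_set_system setT (omx o l) measurable) >>.

Variables (a : algo_params R) (x0 : 'rV[R]_m) (y0 : 'rV[R]_n).

(* The triple of the primal iterate, the dual iterate and the momentum
   difference (the latter initialized at [0]). *)
Fixpoint sapd (k : nat) (w : T) : 'rV[R]_m * 'rV[R]_n * 'rV[R]_n :=
  if k isn't k'.+1 then (x0, y0, 0) else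
  let: (x, y, q) := sapd k' w in
  let s := esty o x y (omy o k' w) + theta a *: q in
  let y' := prox (fun u => ((sigma a)%:E * pg pb u)%E) (y + sigma a *: s) in
  let x' := prox (fun u => ((tau a)%:E * pf pb u)%E)
                 (x - tau a *: estx o x y' (omx o k' w)) in
  (x', y', esty o x' y' (omy o k w) - esty o x y (omy o k' w)).

Definition sapd_x (k : nat) (w : T) : 'rV[R]_m := (sapd k w).1.1.
Definition sapd_y (k : nat) (w : T) : 'rV[R]_n := (sapd k w).1.2.

Definition sapd_gy (k : nat) (w : T) : 'rV[R]_n :=
  esty o (sapd_x k w) (sapd_y k w) (omy o k w).
Definition sapd_gx (k : nat) (w : T) : 'rV[R]_m :=
  estx o (sapd_x k w) (sapd_y k.+1 w) (omx o k w).

Definition noise_y (k : nat) (w : T) : 'rV[R]_n :=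
  sapd_gy k w - grady (pPhi pb) (sapd_x k w, sapd_y k w).
Definition noise_x (k : nat) (w : T) : 'rV[R]_m :=
  sapd_gx k w - gradx (pPhi pb) (sapd_x k w, sapd_y k.+1 w).

(* The measurability implicit in calling the gradient estimates random
   vectors that are functions of the variables revealed so far. It holds in
   particular when [estx o] and [esty o] are jointly measurable. *)
Definition estimates_adapted : Prop :=
  (forall k (j : 'I_n),
     measurable_wrt (history k.+1 k) (fun w => sapd_gy k w 0 j)) /\
  (forall k (i : 'I_m),
     measurable_wrt (history k.+1 k.+1) (fun w => sapd_gx k w 0 i)).

Record noise_assumption (deltax deltay : R) : Prop := NoiseAssumption {
  deltax_gt0 : 0 < deltax;
  deltay_gt0 : 0 < deltay;
  noise_adapted : estimates_adapted;
  noise_y_unbiased : forall k, condexp_eq0 P (history k k) (noise_y k);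
  noise_x_unbiased : forall k, condexp_eq0 P (history k.+1 k) (noise_x k);
  noise_y_tail : forall k (t : R), 0 <= t ->
    condprob_le P (history k k) [set w | t <= enorm (noise_y k w)]
      (2 * expR (- t ^+ 2 / (2 * deltay ^+ 2)));
  noise_x_tail : forall k (t : R), 0 <= t ->
    condprob_le P (history k.+1 k) [set w | t <= enorm (noise_x k w)]
      (2 * expR (- t ^+ 2 / (2 * deltax ^+ 2))) }.

Variables (xs : 'rV[R]_m) (ys : 'rV[R]_n).

Definition sapd_D (k : nat) (w : T) : R :=
  (2 * tau a)^-1 * enorm (sapd_x k w - xs) ^+ 2 +
  (1 - alpha a * sigma a) / (2 * sigma a) * enorm (sapd_y k w - ys) ^+ 2.

Definition sapd_D_init : R :=
  (2 * tau a)^-1 * enorm (x0 - xs) ^+ 2 +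
  (2 * sigma a)^-1 * enorm (y0 - ys) ^+ 2.

Definition sapd_sqdist (k : nat) (w : T) : R :=
  enorm (row_mx (sapd_x k w) (sapd_y k w) - row_mx xs ys) ^+ 2.

End sapd.

(* Main.v *)
Require Import Defs.
From HB Require Import structures.
From mathcomp Require Import all_boot all_order all_algebra.
From mathcomp Require Import all_classical all_reals all_analysis.
From mathcomp Require Import measurable_realfun.
From mathcomp Require Import ring lra.

(** The proof is a Lyapunov argument for exponential moments.

    Without noise, one iteration contracts an energy [energy] that consists of
    the squared distances to the saddle point, the squares of the last increments
    and the inner product of the last dual gradient increment with the dual
    error. Convexity, the descent lemma and the optimality conditions of the two
    proximal steps bound the new energy, and the matrix inequality says that what
    remains is at most [rho] times the old one ([energy_ge], [energy_step]).

    With noise, the error terms of [energy_step] pair the noise with the new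
    iterates, which depend on it. Each new iterate is therefore compared with the
    one that an exact gradient would have produced: that one is known before the
    noise is drawn, and since proximal maps are nonexpansive the difference is of
    the order of the step size times the noise. The dual noise acts a second time
    one iteration later, through the momentum; for this reason the noise-free
    iterates are followed for two dual steps, and the energy is corrected by an
    inner product and by the squares of the last two noises. The result is a
    quantity U, [noisy_energy], that bounds the distances and satisfies
    [noisy_energy_step]: U_(k+1) is at most rho U_k, plus the inner products of
    the noises with two vectors known in advance, plus a multiple of the squared
    noises; and the squared lengths of the two vectors are at most a multiple of
    U_k ([drift_le]).

    A centred noise with subgaussian tails has conditional exponential moments of
    the expected form ([subgaussian_mgf]). Conditional expectations are handled
    as inequalities between integrals over the events of a sub-sigma-algebra,
    which persist under nonnegative weights measurable for it
    ([le_integral_weight]). The linear noise terms thus contribute to the exponent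
    a multiple of the squared length of the drifts, hence of U_k itself, and for
    small exponents l this costs half of the gap between rho and 1
    ([exponential_moment_step]): the moment of U_(k+1) at l is controlled by the
    moment of U_k at l (1 + rho) / 2. Iteration gives [energy_moment], and
    Markov's inequality the bound on the quantiles ([sapd_tail]).

    All constants are explicit. In the Chambolle-Pock regime the first two
    diagonal entries of the matrix and the couplings of the second row vanish, and
    the rest is diagonally dominant for [th] close to 1
    ([chambolle_pock_admissible]). The constants of the noise terms carry a factor
    [stepsize], which is of the order of [1 - th] and compensates the division by
    [1 - rho a]; everything else is bounded. As the squared distance is at most a
    multiple of [stepsize] times the quantity of the first part, its quantiles are
    of the order of [1 - th] once the transient has decayed ([limsup_quantile]). *)

Import Order.TTheory GRing.Theory Num.Theory.
Import numFieldNormedType.Exports.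

Local Open Scope classical_set_scope.
Local Open Scope ring_scope.

Set Implicit Arguments.
Unset Strict Implicit.
Unset Printing Implicit Defensive.

(** * Euclidean inner product and norm *)

Lemma ler_eq (R : numDomainType) (x y : R) : x = y -> x <= y.
Proof. by move=> ->. Qed.

Section euclidean_structure.
Context {R : realType} {n : nat}.
Implicit Types u v w : 'rV[R]_n.

Definition dot u v : R := \sum_(i < n) u 0 i * v 0 i.

Lemma dotC u v : dot u v = dot v u.
Proof. by apply: eq_bigr => i _; rewrite mulrC. Qed.

Lemma dotDl u v w : dot (u + v) w = dot u w + dot v w.
Proof. by rewrite /dot -big_split; apply: eq_bigr => i _; rewrite mxE mulrDl. Qed.

Lemma dotZl (c : R) u v : dot (c *: u) v = c * dot u v.
Proof. by rewrite /dot mulr_sumr; apply: eq_bigr => i _; rewrite mxE mulrA. Qed.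

Lemma dotNl u v : dot (- u) v = - dot u v.
Proof. by rewrite -scaleN1r dotZl mulN1r. Qed.

Lemma dotDr u v w : dot w (u + v) = dot w u + dot w v.
Proof. by rewrite !(dotC w) dotDl. Qed.

Lemma dotZr (c : R) u v : dot v (c *: u) = c * dot v u.
Proof. by rewrite !(dotC v) dotZl. Qed.

Lemma dotNr u v : dot v (- u) = - dot v u.
Proof. by rewrite !(dotC v) dotNl. Qed.

Lemma dot0l u : dot 0 u = 0.
Proof. by rewrite /dot big1 // => i _; rewrite mxE mul0r. Qed.

Definition dotE := (dotDl, dotDr, dotNl, dotNr, dotZl, dotZr).

Lemma enorm_ge0 u : 0 <= enorm u.
Proof. exact: sqrtr_ge0. Qed.

Lemma enorm_sqr u : enorm u ^+ 2 = dot u u.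
Proof.
rewrite /enorm sqr_sqrtr; last by apply: sumr_ge0 => i _; exact: sqr_ge0.
by apply: eq_bigr => i _; rewrite expr2.
Qed.

Lemma dot_ge0 u : 0 <= dot u u.
Proof. by rewrite -enorm_sqr sqr_ge0. Qed.

Lemma enorm0 : enorm (0 : 'rV[R]_n) = 0.
Proof. by apply/eqP; rewrite -sqrf_eq0 enorm_sqr dot0l. Qed.

Lemma enorm_coord u i : `|u 0 i| <= enorm u.
Proof.
rewrite -(@ler_pXn2r _ 2) ?nnegrE ?enorm_ge0 // enorm_sqr real_normK ?num_real //.
rewrite /dot (bigD1 i) //= -expr2 lerDl.
by apply: sumr_ge0 => j _; rewrite -expr2 sqr_ge0.
Qed.

Lemma enorm_eq0 u : enorm u = 0 -> u = 0.
Proof.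
move=> u0; apply/rowP => i; rewrite mxE; apply/eqP; rewrite -normr_le0 -u0.
exact: enorm_coord.
Qed.

Lemma enormN u : enorm (- u) = enorm u.
Proof.
by apply/eqP; rewrite -(@eqrXn2 _ 2) ?enorm_ge0 // !enorm_sqr dotNl dotNr opprK.
Qed.

Lemma enormZ (c : R) u : enorm (c *: u) = `|c| * enorm u.
Proof.
apply/eqP; rewrite -(@eqrXn2 _ 2) ?mulr_ge0 ?enorm_ge0 // exprMn !enorm_sqr.
by rewrite dotZl dotZr real_normK ?num_real // expr2 mulrA.
Qed.

Lemma cauchy_schwarz u v : dot u v <= enorm u * enorm v.
Proof.
have [u0|u0] := eqVneq (enorm u) 0.
  by rewrite u0 (enorm_eq0 u0) dot0l mul0r.
have [v0|v0] := eqVneq (enorm v) 0.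
  by rewrite v0 (enorm_eq0 v0) dotC dot0l mulr0.
have up : 0 < enorm u by rewrite lt_def u0 enorm_ge0.
have vp : 0 < enorm v by rewrite lt_def v0 enorm_ge0.
have := dot_ge0 (enorm v *: u - enorm u *: v).
rewrite !dotE -!enorm_sqr (dotC v u).
set a := enorm u; set b := enorm v; set c := dot u v => h.
have ab : 0 < a * b by exact: mulr_gt0.
have {}h : 0 <= 2 * (a * b) * (a * b - c) by lra.
by move: h; rewrite pmulr_rge0 ?subr_ge0 // mulr_gt0.
Qed.

Lemma cauchy_schwarz_norm u v : `|dot u v| <= enorm u * enorm v.
Proof.
by rewrite ler_norml cauchy_schwarz andbT lerNl -dotNl -(enormN u) cauchy_schwarz.
Qed.

Lemma enormD u v : enorm (u + v) <= enorm u + enorm v.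
Proof.
rewrite -(@ler_pXn2r _ 2) ?nnegrE ?addr_ge0 ?enorm_ge0 //.
rewrite enorm_sqr !dotE -!enorm_sqr (dotC v u).
by have := cauchy_schwarz u v; nra.
Qed.

Lemma enormB u v : enorm (u - v) <= enorm u + enorm v.
Proof. by rewrite -(enormN v) enormD. Qed.

Lemma enorm_distC u v : enorm (u - v) = enorm (v - u).
Proof. by rewrite -enormN opprB. Qed.

Lemma enorm_distD w u v : enorm (u - v) <= enorm (u - w) + enorm (w - v).
Proof. by rewrite -{1}(subrK w u) -addrA enormD. Qed.

Lemma enorm_le_norm u : enorm u <= n%:R * `|u|.
Proof.
have ue i : `|u 0 i| <= `|u|.
  rewrite [leRHS]mx_normrE.
  by apply: (le_bigmax _ (fun ij => `|u ij.1 ij.2|) (0, i)).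
rewrite -(@ler_pXn2r _ 2) ?nnegrE ?mulr_ge0 ?enorm_ge0 // enorm_sqr.
apply: (@le_trans _ _ (\sum_(i < n) `|u| ^+ 2)).
  apply: ler_sum => i _; rewrite -expr2 -real_normK ?num_real //.
  by rewrite ler_pXn2r ?nnegrE.
rewrite sumr_const card_ord exprMn -[leLHS]mulr_natl; apply: ler_wpM2r.
  exact: sqr_ge0.
by case: (n) => [|k]; rewrite ?expr0n // expr2 ler_peMr ?ler1n // ler0n.
Qed.

Lemma norm_le_enorm u : `|u| <= enorm u.
Proof.
rewrite [leLHS]mx_normrE; apply: bigmax_le; first exact: enorm_ge0.
by move=> [i j] _ /=; rewrite (ord1 i) enorm_coord.
Qed.

End euclidean_structure.

(** * Proximal points of strongly convex functions *)

(** The topology of row vectors is that of the sup norm, to which the Euclidean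
    norm is equivalent up to a factor depending on the dimension. *)
Lemma continuous_enorm_lipschitz {R : realType} {n : nat} {W : normedModType R}
    (f : 'rV[R]_n -> W) (L : R) :
  (forall u v, `|f u - f v| <= L * enorm (u - v)) -> continuous f.
Proof.
move=> fL u; apply/(@cvgrPdist_lt _ _ _ _ (nbhs_filter u)) => e e0.
have d0 : 0 < `|L| * n%:R + 1 by rewrite ltr_wpDl // mulr_ge0.
have near_u : \forall v \near u, `|u - v| < e / (`|L| * n%:R + 1).
  have := nbhsx_ballx u _ (divr_gt0 e0 d0).
  by rewrite -ball_normE.
near=> v; apply: (le_lt_trans (fL _ _)).
have uv : `|u - v| < e / (`|L| * n%:R + 1) by near: v.
rewrite ltr_pdivlMr // in uv; apply: le_lt_trans uv.
rewrite mulrDr mulr1 -[leLHS]addr0 lerD //.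
apply: (@le_trans _ _ (`|L| * (n%:R * `|u - v|))); last lra.
apply: (@le_trans _ _ (`|L| * enorm (u - v))).
  by rewrite ler_wpM2r ?enorm_ge0 // ler_norm.
by rewrite ler_wpM2l // enorm_le_norm.
Unshelve. all: by end_near. Qed.

Lemma continuous_enorm {R : realType} {n : nat} :
  continuous (@enorm R n).
Proof.
apply: (@continuous_enorm_lipschitz R n R _ 1) => u v.
rewrite mul1r ler_norml; have := enormD (u - v) v; have := enormD (v - u) u.
by rewrite !subrK (enorm_distC v u); lra.
Qed.

Section strongly_convex_functions.
Context {R : realType} {n : nat}.
Variables (phi : 'rV[R]_n -> \bar R) (mu : R) (x0 : 'rV[R]_n).
Hypotheses (phiN : forall x, phi x != -oo%E) (phi_closed : closed_fun phi)
  (mu0 : 0 < mu) (phi_sc : strongly_convex mu phi) (x0_dom : edom phi x0).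

Let F x := fine (phi x).

Lemma edom_fineK x : edom phi x -> phi x = (F x)%:E.
Proof.
by move=> xd; rewrite /F fineK // fin_numE phiN /=; move: xd; rewrite /edom /= ltey.
Qed.

Lemma edom_le x (c : R) : (phi x <= c%:E)%E -> edom phi x /\ F x <= c.
Proof.
move=> h; have xd : edom phi x by exact: le_lt_trans h (ltry _).
by split=> //; rewrite -lee_fin -edom_fineK.
Qed.

Lemma strongly_convex_fine t x y : 0 <= t <= 1 -> edom phi x -> edom phi y ->
  edom phi (t *: x + (1 - t) *: y) /\
  F (t *: x + (1 - t) *: y) + mu / 2 * (t * (1 - t)) * enorm (x - y) ^+ 2
    <= t * F x + (1 - t) * F y.
Proof.
move=> t01 xd yd; have := phi_sc x y t01.
rewrite (edom_fineK xd) (edom_fineK yd) -!EFinM -EFinD.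
by rewrite -leeBrDr // -EFinB => /edom_le[zd h]; split=> //; rewrite -lerBrDr.
Qed.

Lemma closed_fun_lim (u : nat -> 'rV[R]_n) (a : nat -> R^o) v (b : R^o) :
  u @ \oo --> v -> a @ \oo --> b ->
  (forall k, edom phi (u k) /\ F (u k) <= a k) -> edom phi v /\ F v <= b.
Proof.
move=> uv ab h.
have : (phi v <= b%:E)%E; last exact: edom_le.
have := @closed_cvg _ _ \oo _ (fun k => (u k, a k)) _ phi_closed _ (v, b).
apply; last exact: cvg_pair uv ab.
by apply: nearW => k; have [? ?] := h k; rewrite /= edom_fineK // lee_fin.
Qed.

(** Closedness gives a bound near [x0]: values below [F x0 - 1] along a sequence
    tending to [x0] would pass to the limit. A point farther away is joined to
    [x0] by a segment that enters this neighbourhood, and strong convexity along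
    the segment turns the local bound into a quadratic one. *)
Lemma strongly_convex_bounded_below : exists B, forall x, edom phi x -> B <= F x.
Proof.
have [r r0 hr] : exists2 r, 0 < r &
    forall x, edom phi x -> enorm (x - x0) <= r -> F x0 - 1 <= F x.
  apply: contrapT => /forall2NP h.
  have {}h (k : nat) : exists x, [/\ edom phi x, enorm (x - x0) <= k.+1%:R^-1
      & F x < F x0 - 1].
    have [/negP|/existsNP[x]] := h k.+1%:R^-1; first by rewrite invr_gt0 ltr0n.
    by move=> /not_implyP[xd] /not_implyP[xr /negP]; rewrite -ltNge; exists x.
  have [u hu] := choice h.
  have ux : u @ \oo --> x0.
    apply/cvgrPdist_le => e e0; near=> k.
    rewrite distrC (le_trans (norm_le_enorm _)) //.
    have ke : k.+1%:R^-1 < e.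
      by near: k; exact: (near_infty_natSinv_lt (PosNum e0)).
    by have [_ /le_trans + _] := hu k; apply; exact: ltW.
  have [] := @closed_fun_lim u (fun=> F x0 - 1) x0 (F x0 - 1) ux.
  - exact: cvg_cst.
  - by move=> k; have [? _ /ltW] := hu k.
  - by move=> _; lra.
(* Outside the ball [F x - F x0] is at least [mu / 2 * D ^+ 2 - c * D] in the
   distance [D] to [x0], whose minimum is [- c ^+ 2 / (2 * mu)]. *)
pose c := r^-1 + mu * r / 2.
exists (F x0 - 1 - c ^+ 2 / (2 * mu)) => x xd.
have [xr|xr] := leP (enorm (x - x0)) r.
  have := hr x xd xr; suff : 0 <= c ^+ 2 / (2 * mu) by lra.
  by rewrite divr_ge0 ?sqr_ge0 // mulr_ge0 // ltW.
set D := enorm (x - x0) in xr.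
have D0 : 0 < D by exact: lt_trans xr.
pose t := r / D.
have t01 : 0 <= t <= 1 by rewrite divr_ge0 ?ler_pdivrMr ?mul1r ?ltW.
have [zd] := strongly_convex_fine t01 xd x0_dom.
have /(hr _ zd) : enorm (t *: x + (1 - t) *: x0 - x0) <= r.
  have -> : t *: x + (1 - t) *: x0 - x0 = t *: (x - x0).
    by rewrite scalerBl scale1r scalerBr [x0 - _]addrC addrA addrK.
  by rewrite enormZ (ger0_norm (andP t01).1) -/D divfK // gt_eqF.
rewrite -/D => h1 h2.
have h3 : - 1 + mu / 2 * (t * (1 - t)) * D ^+ 2 <= t * (F x - F x0) by lra.
have Dr : D = r / t by rewrite /t invf_div mulrCA divff ?mulr1 ?gt_eqF.
have t0 : 0 < t by exact: divr_gt0.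
have h4 : (- 1 + mu / 2 * (t * (1 - t)) * D ^+ 2) / t <= F x - F x0.
  by rewrite ler_pdivrMr // [leRHS]mulrC.
have e4 : (- 1 + mu / 2 * (t * (1 - t)) * D ^+ 2) / t = mu / 2 * D ^+ 2 - c * D.
  by rewrite Dr /c; field; rewrite !gt_eqF.
have : - (c ^+ 2 / (2 * mu)) <= mu / 2 * D ^+ 2 - c * D.
  rewrite -subr_ge0.
  have -> : mu / 2 * D ^+ 2 - c * D - - (c ^+ 2 / (2 * mu)) =
            mu / 2 * (D - c / mu) ^+ 2 by field; rewrite gt_eqF.
  by rewrite mulr_ge0 ?sqr_ge0 // divr_ge0 // ltW.
by lra.
Unshelve. all: by end_near. Qed.

Let H (s : R) z u := s * F u + 2^-1 * enorm (u - z) ^+ 2.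

Let H_convex s z t u v : 0 < s -> 0 <= t <= 1 -> edom phi u -> edom phi v ->
  edom phi (t *: u + (1 - t) *: v) /\
  H s z (t *: u + (1 - t) *: v)
      + (s * mu + 1) / 2 * (t * (1 - t)) * enorm (u - v) ^+ 2
    <= t * H s z u + (1 - t) * H s z v.
Proof.
move=> s0 t01 ud vd; have [wd h] := strongly_convex_fine t01 ud vd; split=> //; rewrite /H.
have -> : t *: u + (1 - t) *: v - z = t *: (u - z) + (1 - t) *: (v - z).
  by rewrite !scalerBr addrACA -opprD -scalerDl addrCA subrr addr0 scale1r.
move: h; have -> : u - v = (u - z) - (v - z) by rewrite opprB addrA subrK.
rewrite -(ler_pM2l s0); move: (F _) => f.
by move: (u - z) (v - z) => p q; rewrite !enorm_sqr !dotE (dotC q p); lra.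
Qed.

(** Strong convexity at midpoints makes a minimizing sequence Cauchy, and
    closedness of [phi] carries the bound to its limit. *)
Let H_argmin s z : 0 < s ->
  exists2 u, edom phi u & forall v, edom phi v -> H s z u <= H s z v.
Proof.
move=> s0; have [B hB] := strongly_convex_bounded_below.
pose E : set R := [set H s z u | u in edom phi].
have hE : has_inf E.
  split; first by exists (H s z x0), x0.
  exists (s * B) => _ [u ud <-]; rewrite /H -[leLHS]addr0 lerD //.
    by rewrite ler_pM2l // hB.
  by rewrite mulr_ge0 ?sqr_ge0.
have infE v : edom phi v -> inf E <= H s z v.
  by move=> vd; apply: ge_inf; [exact: hE.2 | exists v].
have h (k : nat) : exists u, edom phi u /\ H s z u <= inf E + k.+1%:R^-1.
  have [|_ [u ud <-] /ltW] := @inf_adherent _ E k.+1%:R^-1 _ hE.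
    by rewrite invr_gt0.
  by exists u.
have [u hu] := choice h.
have u_dist j k : enorm (u j - u k) ^+ 2 <= 4 * (j.+1%:R^-1 + k.+1%:R^-1).
  have h01 : 0 <= (2^-1 : R) <= 1 by lra.
  have [jd hj] := hu j; have [kd hk] := hu k.
  have [md] := H_convex z s0 h01 jd kd.
  have := infE _ md; have := sqr_ge0 (enorm (u j - u k)).
  have : 0 <= s * mu by rewrite mulr_ge0 // ltW.
  move: (H s z (u j)) (H s z (u k)) (H s z _) (inf E) hj hk (enorm _ ^+ 2) (s * mu).
  by move: (j.+1%:R^-1) (k.+1%:R^-1) => a b c d e f ca db g sm; nra.
have [v uv] : exists v : 'rV[R]_n, u @ \oo --> v.
  suff /cauchy_cvgP : cauchy (u @ \oo) by move=> /cvg_ex.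
  apply: cauchy_exP => e e0.
  have e20 : 0 < e ^+ 2 / 8 by rewrite divr_gt0 // exprn_gt0.
  have [N _ hN] := near_infty_natSinv_lt (PosNum e20).
  exists (u N); exists N => // k Nk /=.
  rewrite -ball_normE /ball_ /=; apply: le_lt_trans (norm_le_enorm _) _.
  rewrite -(@ltr_pXn2r _ 2) ?nnegrE ?enorm_ge0 ?(ltW e0) //.
  apply: le_lt_trans (u_dist _ _) _.
  have := hN N (leqnn N); have := hN k Nk; rewrite /=.
  by move: (N.+1%:R^-1) (k.+1%:R^-1) (e ^+ 2) => a b c; lra.
pose a (k : nat) : R^o := (inf E + k.+1%:R^-1 - 2^-1 * enorm (u k - z) ^+ 2) / s.
have av : a @ \oo --> ((inf E + 0 - 2^-1 * enorm (v - z) ^+ 2) / s : R^o).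
  apply: cvgMl; apply: cvgB.
    by apply: cvgD; [exact: cvg_cst | exact: cvg_harmonic].
  apply: cvgMr; rewrite expr2; under eq_fun do rewrite expr2.
  have uz : enorm (u k - z) @[k --> \oo] --> enorm (v - z).
    have uz : (fun k => u k - z : 'rV[R]_n) @ \oo --> (v - z : 'rV[R]_n).
      by apply: cvgB => //; exact: cvg_cst.
    exact: continuous_cvg (@continuous_enorm R n (v - z)) uz.
  exact: cvgM.
have hd k : edom phi (u k) /\ F (u k) <= a k.
  by have [ud] := hu k; split=> //; rewrite ler_pdivlMr // mulrC lerBrDr.
have [vd] := closed_fun_lim uv av hd.
rewrite ler_pdivlMr // mulrC lerBrDr addr0 => hv.
by exists v => // w wd; exact: le_trans hv (infE _ wd).
Qed.

(** The variational characterization of the proximal point, in which strong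
    convexity contributes the quadratic term. Every use of [prox] below goes
    through this inequality. *)
Definition prox_point (s : R) z u := edom phi u /\
  forall y, edom phi y ->
    F u + s^-1 * dot (z - u) (y - u) + mu / 2 * enorm (y - u) ^+ 2 <= F y.

Lemma prox_pointP s z : 0 < s ->
  prox_point s z (prox (fun u => (s%:E * phi u)%E) z).
Proof.
move=> s0; have [u0 u0d hu0] := H_argmin z s0.
pose h u := (s%:E * phi u + (2^-1 * enorm (u - z) ^+ 2)%R%:E)%E.
have hE u : edom phi u -> h u = (H s z u)%:E.
  by move=> ud; rewrite /h edom_fineK // -EFinM -EFinD.
have u0min : argmin h u0.
  move=> v; have [vd|] := pselect (edom phi v).
    by rewrite hE // hE // lee_fin; exact: hu0.
  rewrite /edom /= ltNge => /negP; rewrite negbK leye_eq /h => /eqP ->.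
  by rewrite gt0_muley ?lte_fin // addye ?leey.
have : argmin h (prox (fun u => (s%:E * phi u)%E) z).
  by rewrite /prox; exact: (xgetPex 0 (ex_intro _ u0 u0min)).
move: (prox _ z) => u umin.
have ud : edom phi u.
  rewrite /edom /= ltNge; apply/negP; rewrite leye_eq => /eqP uoo.
  by have := umin u0; rewrite (hE u0) // {1}/h uoo gt0_muley ?lte_fin // addye.
split=> // y yd.
have key t : 0 < t < 1 ->
    H s z u + (1 - t) * ((s * mu + 1) / 2 * enorm (y - u) ^+ 2) <= H s z y.
  move=> /andP[t0 t1]; have t01 : 0 <= t <= 1 by rewrite !ltW.
  have [wd] := H_convex z s0 t01 yd ud.
  have := umin (t *: y + (1 - t) *: u); rewrite hE // hE // lee_fin => h1 h2.
  rewrite -(ler_pM2l t0); move: h1 h2; move: (H s z _) (H s z u) (H s z y) => p q r.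
  by lra.
(* The limit of [key] as [t] tends to zero: a violation by [d] is already
   contradicted at the value of [t] below. *)
have : H s z u + (s * mu + 1) / 2 * enorm (y - u) ^+ 2 <= H s z y.
  rewrite leNgt; apply/negP.
  move: key; set b := _ / 2 * _; set p := H s z u; set q := H s z y => key hpq.
  have b0 : 0 <= b.
    by rewrite mulr_ge0 ?sqr_ge0 // divr_ge0 // addr_ge0 // mulr_ge0 // ltW.
  pose d := p + b - q; have d0 : 0 < d by rewrite subr_gt0.
  have bd : 0 < 2 * (b + d) by lra.
  have := key (d / (2 * (b + d))); rewrite divr_gt0 //= ltr_pdivrMr //.
  have -> : d < 1 * (2 * (b + d)) by lra.
  move=> /(_ isT); suff : d / (2 * (b + d)) * b < d by rewrite /d; lra.
  by rewrite mulrAC ltr_pdivrMr // ltr_pM2l //; lra.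
rewrite /H; have -> : y - z = (y - u) - (z - u) by rewrite opprB addrA subrK.
rewrite -(enormN (u - z)) opprB => hH.
rewrite -(ler_pM2l s0) !mulrDr (mulrA s s^-1) divff ?gt_eqF //.
move: hH; move: (y - u) (z - u) (F u) (F y) => a b p q.
by rewrite mul1r !enorm_sqr !dotE (dotC a b); lra.
Qed.

(** The sum of the two variational inequalities is the firm nonexpansiveness of
    the proximal map. *)
Lemma prox_point_nonexpansive s z z' u u' : 0 < s ->
  prox_point s z u -> prox_point s z' u' -> enorm (u - u') <= enorm (z - z').
Proof.
move=> s0 [ud hu] [ud' hu'].
have := hu _ ud'; have := hu' _ ud.
have e1 : u' - u = - (u - u') by rewrite opprB.
rewrite e1 enormN dotNr => h1 h2.
have h3 : s^-1 * dot (z' - u') (u - u') - s^-1 * dot (z - u) (u - u') <= 0.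
  have : 0 <= mu / 2 * enorm (u - u') ^+ 2.
    by rewrite mulr_ge0 ?sqr_ge0 // divr_ge0 // ltW.
  by move: h1 h2; move: (F u) (F u') => p q; lra.
move: h3; rewrite -mulrBr pmulr_rle0 ?invr_gt0 // -dotNl -dotDl.
have -> : z' - u' - (z - u) = (u - u') - (z - z').
  by rewrite !opprB addrACA [RHS]addrACA (addrC u).
rewrite dotDl dotNl -enorm_sqr => h.
have := cauchy_schwarz (z - z') (u - u').
have := enorm_ge0 (u - u'); have := enorm_ge0 (z - z').
move: h; set p := enorm (u - u'); set q := enorm (z - z') => h q0 p0 cs.
have [//|qp] := leP p q; nra.
Qed.

Lemma prox_nonexpansive s z z' : 0 < s ->
  let p := prox (fun u => (s%:E * phi u)%E) in
  enorm (p z - p z') <= enorm (z - z').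
Proof.
by move=> s0 /=; apply: (prox_point_nonexpansive s0); exact: prox_pointP.
Qed.

Lemma continuous_prox s : 0 < s ->
  continuous (prox (fun u => (s%:E * phi u)%E)).
Proof.
move=> s0; apply: (@continuous_enorm_lipschitz _ _ _ _ 1) => u v; rewrite mul1r.
exact: le_trans (norm_le_enorm _) (prox_nonexpansive _ _ s0).
Qed.

End strongly_convex_functions.

(** * Gradients and one-dimensional restrictions *)

Section gradient.
Context {R : realType} {n : nat}.
Implicit Types (f : 'rV[R]_n -> R^o) (x v : 'rV[R]_n).

Definition grad f x : 'rV[R]_n := \row_i 'D_(delta_mx 0 i) f x.

Lemma derive_grad f x v : differentiable f x -> 'D_v f x = dot (grad f x) v.
Proof.
move=> fx; rewrite deriveE // {1}(row_sum_delta v) linear_sum /dot.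
by apply: eq_bigr => i _; rewrite mxE deriveE // linearZ mulrC.
Qed.

Lemma is_derive_line f x v (t : R) : differentiable f (x + t *: v) ->
  is_derive t 1 (fun s : R => f (x + s *: v)) (dot (grad f (x + t *: v)) v).
Proof.
move=> fx; rewrite -derive_grad //.
have eqf : (fun h : R => h^-1 *: (((fun s : R => f (x + s *: v)) \o shift t)
                (h *: (1 : R^o)) - f (x + t *: v))) =
           (fun h : R => h^-1 *: ((f \o shift (x + t *: v)) (h *: v)
                - f (x + t *: v))).
  apply/funext => h /=; congr (_ *: (f _ - _)).
  by rewrite [h *: 1]mulr1 scalerDl addrCA.
have dv : derivable f (x + t *: v) v by exact: diff_derivable.
by split; rewrite /derivable /derive eqf.
Qed.

(** One-sided difference quotients in direction [v] suffice to bound the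
    derivative; this is how an inequality along the segments of the domain,
    which need not be open, gives information on the gradient. *)
Lemma grad_le f x v (b c : R) : differentiable f x ->
  (forall t, 0 < t <= 1 -> f (x + t *: v) <= f x + t * (c + t * b)) ->
  dot (grad f x) v <= c.
Proof.
move=> fx h; rewrite -derive_grad //.
have dv : derivable f x v by exact: diff_derivable.
have fl : (fun h : R => h^-1 *: ((f \o shift x) (h *: v) - f x)) @ 0^'+
    --> 'D_v f x.
  exact: cvg_dnbhs_at_right dv.
have gl : (fun t : R => c + t * b) @ 0^'+ --> c + 0 * b.
  apply: cvg_at_right_filter; apply: cvgD; first exact: cvg_cst.
  by apply: cvgM; [exact: cvg_id | exact: cvg_cst].
rewrite mul0r addr0 in gl; apply: ler_cvg_to fl gl _.
near=> t; have t0 : 0 < t by near: t; exact: nbhs_right_gt.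
have t1 : t <= 1 by near: t; exact: nbhs_right_le.
rewrite /= -[_ *: _]/(_ * _) -(ler_pM2l t0) mulrA divff ?gt_eqF // mul1r.
by rewrite lerBlDl /= addrC h ?t0.
Unshelve. all: by end_near. Qed.

Lemma convex_grad_le f x y : differentiable f x ->
  (forall t, 0 <= t <= 1 -> f (x + t *: (y - x)) <= (1 - t) * f x + t * f y) ->
  f x + dot (grad f x) (y - x) <= f y.
Proof.
move=> fx h; rewrite -lerBrDl.
apply: (@grad_le _ _ _ 0) => // t /andP[t0 t1].
by have := h t; rewrite ltW // t1 => /(_ isT); lra.
Qed.

(** The hypotheses only concern one segment, because the gradients of the coupling
    are Lipschitz on the domains and not on the whole space. *)
Lemma descent_lemma f x v (L : R) :
  (forall t, 0 <= t <= 1 -> differentiable f (x + t *: v) /\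
     enorm (grad f (x + t *: v) - grad f x) <= L * enorm (t *: v)) ->
  f (x + v) <= f x + dot (grad f x) v + L / 2 * enorm v ^+ 2.
Proof.
move=> h; pose c := dot (grad f x) v; pose e := L / 2 * enorm v ^+ 2.
pose g (t : R) : R := f (x + t *: v) - c * t - e * t ^+ 2.
have dg (t : R) : 0 <= t <= 1 ->
    is_derive t 1 g (dot (grad f (x + t *: v)) v - c - e * (2 * t)).
  move=> t01; have df := is_derive_line (h t t01).1.
  have d1 : is_derive t 1 (fun t : R => c * t) c.
    have := @is_deriveZ R R R id c t 1 1 (is_derive_id t 1).
    by rewrite [c *: 1]mulr1.
  have d2 : is_derive t 1 (fun t : R => e * t ^+ 2) (e * (2 * t)).
    have H := @is_deriveM R R id id t 1 1 1 (is_derive_id t 1) (is_derive_id t 1).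
    have {}H := @is_deriveZ R R R _ e t 1 _ H.
    have -> : (fun t : R => e * t ^+ 2) = e *: (id * id : R -> R).
      by apply/funext => s; rewrite expr2.
    by apply: is_derive_eq; rewrite -![_ *: _]/(_ * _) !mulr1 mulr2n mulrDl mul1r.
  exact: is_deriveB.
have := @ler0_derive1_nincr _ g 0 1.
have in01 (t : R) : t \in `]0, 1[ -> 0 <= t <= 1.
  by rewrite in_itv /= => /andP[? ?]; rewrite !ltW.
move=> /(_ _ _ _ 0 1 (lexx _) ler01 (lexx _)).
rewrite /g scale1r scale0r addr0 !mulr0 !mulr1 expr0n /= expr1n mulr0 mulr1 !subr0.
rewrite /c /e => hh; suff : f (x + v) - dot (grad f x) v - L / 2 * enorm v ^+ 2 <= f x.
  by lra.
apply: hh.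
- by move=> t /in01 /dg [].
- move=> t /in01 t01; rewrite derive1E; have [_ ->] := dg t t01.
  have [_ hl] := h t t01; rewrite /c -dotNl -dotDl subr_le0.
  apply: le_trans (cauchy_schwarz _ _) _; rewrite /e.
  have := ler_wpM2r (enorm_ge0 v) hl.
  rewrite enormZ (ger0_norm (andP t01).1) => /le_trans; apply.
  by apply: ler_eq; field.
- apply: derivable_within_continuous => t; rewrite in_itv /= => /dg [].
  by [].
Unshelve. all: by [].
Qed.

End gradient.

(** * The coupling function and the saddle point *)

Lemma convex_function_segment (R : realType) (n : nat) (D : set 'rV[R]_n)
    (h : 'rV[R]_n -> R^o) x y (t : R) :
  convex_function D h -> D x -> D y -> 0 <= t <= 1 ->
  h (x + t *: (y - x)) <= (1 - t) * h x + t * h y.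
Proof.
move=> hD xD yD /andP[t0 t1].
have := hD (Itv01 t0 t1) y x; rewrite !inE => /(_ yD xD).
rewrite convRE /= [leRHS]addrC; congr (h _ <= _).
by rewrite /conv /= scalerBl scale1r scalerBr addrCA.
Qed.

Section saddle_point_problem.
Context {R : realType} {m n : nat}.
Variables (pp : problem_params R) (pb : problem R m n).
Variables (xs : 'rV[R]_m) (ys : 'rV[R]_n) (x0 : 'rV[R]_m) (y0 : 'rV[R]_n).
Hypothesis Hpb : problem_assumption pp pb.
Hypotheses (saddle : saddle_point pb xs ys).
Hypotheses (x0_dom : edom (pf pb) x0) (y0_dom : edom (pg pb) y0).

Let f x := fine (pf pb x).
Let g y := fine (pg pb y).
Let Phi := pPhi pb.

Lemma differentiable_Phi x y : edom (pf pb) x -> edom (pg pb) y ->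
  differentiable Phi (x, y).
Proof.
move=> xd yd; have [U [_ DU C1]] := pPhi_C1 Hpb.
by have [] := C1 _ (DU (x, y) (conj xd yd)).
Qed.

Lemma differentiable_Phix x y : edom (pf pb) x -> edom (pg pb) y ->
  differentiable (fun x' => Phi (x', y)) x.
Proof.
move=> xd yd; apply: (@differentiable_comp _ _ _ _ (fun x' => (x', y)) Phi).
  by apply: differentiable_pair.
exact: differentiable_Phi.
Qed.

Lemma differentiable_Phiy x y : edom (pf pb) x -> edom (pg pb) y ->
  differentiable (fun y' => Phi (x, y')) y.
Proof.
move=> xd yd; apply: (@differentiable_comp _ _ _ _ (fun y' => (x, y')) Phi).
  by apply: differentiable_pair.
exact: differentiable_Phi.
Qed.

Lemma Phi_convex_grad x x' y :
    edom (pf pb) x -> edom (pf pb) x' -> edom (pg pb) y ->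
  Phi (x, y) + dot (gradx Phi (x, y)) (x' - x) <= Phi (x', y).
Proof.
move=> xd xd' yd.
apply: (@convex_grad_le _ _ (fun x => Phi (x, y))).
  exact: differentiable_Phix.
move=> t t01; apply: (convex_function_segment (pPhi_convex Hpb yd)) => //.
Qed.

Lemma Phi_concave_grad x y y' :
    edom (pf pb) x -> edom (pg pb) y -> edom (pg pb) y' ->
  Phi (x, y') <= Phi (x, y) + dot (grady Phi (x, y)) (y' - y).
Proof.
move=> xd yd yd'.
have dPhi := differentiable_Phiy xd yd.
have := @convex_grad_le _ _ (fun y => - Phi (x, y)) y y' (differentiableN dPhi).
have -> : grad (fun y => - Phi (x, y)) y = - grady Phi (x, y).
  apply/rowP => j; rewrite !mxE; apply: deriveN.
  exact: diff_derivable.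
rewrite dotNl => h; rewrite -lerN2 opprD; apply: h => t t01.
exact: (convex_function_segment (pPhi_concave Hpb xd)).
Qed.

Lemma Phi_descent x x' y :
    edom (pf pb) x -> edom (pf pb) x' -> edom (pg pb) y ->
  Phi (x', y) <= Phi (x, y) + dot (gradx Phi (x, y)) (x' - x)
                 + Lxx pp / 2 * enorm (x' - x) ^+ 2.
Proof.
move=> xd xd' yd; have {1}-> : x' = x + (x' - x) by rewrite addrC subrK.
apply: (@descent_lemma _ _ (fun x => Phi (x, y))) => t t01.
have td : edom (pf pb) (x + t *: (x' - x)).
  have [] := strongly_convex_fine (pf_Nninfty Hpb) (pf_sconvex Hpb) t01 xd' xd.
  by rewrite scalerBl scale1r scalerBr addrCA.
split; first exact: differentiable_Phix.
have := gradx_Lipschitz Hpb td yd xd yd.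
by rewrite subrr enorm0 mulr0 addr0 [x + _]addrC addrK.
Qed.

(** Comparison with [(xs, y0)] and [(x0, ys)], where one of the two functions is
    known to be finite, excludes infinite values at the saddle point. *)
Lemma saddle_point_edom : edom (pf pb) xs /\ edom (pg pb) ys.
Proof.
have := saddle x0 y0; rewrite /lagrangian -/Phi.
have := pf_Nninfty Hpb xs; have := pg_Nninfty Hpb ys.
rewrite /edom /= (edom_fineK (pf_Nninfty Hpb) x0_dom).
rewrite (edom_fineK (pg_Nninfty Hpb) y0_dom).
by case: (pf pb xs) => [a| |] //; case: (pg pb ys) => [b| |] // _ _ [];
  rewrite ?ltry //= ?lee_fin.
Qed.

Let xs_dom := saddle_point_edom.1.
Let ys_dom := saddle_point_edom.2.

Lemma saddle_point_fine x y : edom (pf pb) x -> edom (pg pb) y ->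
  Phi (xs, y) - g y <= Phi (xs, ys) - g ys /\
  f xs + Phi (xs, ys) <= f x + Phi (x, ys).
Proof.
move=> xd yd; have := saddle x y; rewrite /lagrangian -/Phi.
have := edom_fineK (pf_Nninfty Hpb) xs_dom; rewrite -/(f xs) => ->.
have := edom_fineK (pg_Nninfty Hpb) ys_dom; rewrite -/(g ys) => ->.
have := edom_fineK (pf_Nninfty Hpb) xd; rewrite -/(f x) => ->.
have := edom_fineK (pg_Nninfty Hpb) yd; rewrite -/(g y) => ->.
by rewrite !lee_fin; lra.
Qed.

(** First-order optimality at the saddle point: both components are fixed by
    the exact proximal gradient steps, so the noise-free iterates can be compared
    with them through nonexpansiveness. *)
Lemma saddle_prox_x (t : R) : 0 < t ->
  prox_point (pf pb) (mux pp) t (xs - t *: gradx Phi (xs, ys)) xs.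
Proof.
move=> t0; split=> // x xd.
have -> : xs - t *: gradx Phi (xs, ys) - xs = - (t *: gradx Phi (xs, ys)).
  by rewrite addrAC subrr add0r.
rewrite dotNl dotZl mulrN mulrA mulVf ?gt_eqF // mul1r.
suff : dot (grad (fun x => - Phi (x, ys)) xs) (x - xs) <=
    f x - f xs - mux pp / 2 * enorm (x - xs) ^+ 2.
  have -> : grad (fun x => - Phi (x, ys)) xs = - gradx Phi (xs, ys).
    apply/rowP => j; rewrite !mxE; apply: deriveN.
    by apply: diff_derivable; exact: differentiable_Phix.
  by rewrite dotNl -/(f x) -/(f xs); lra.
apply: (@grad_le _ _ _ _ _ (mux pp / 2 * enorm (x - xs) ^+ 2)).
  by apply: differentiableN; exact: differentiable_Phix.
move=> t1 /andP[t10 t11]; have t01 : 0 <= t1 <= 1 by rewrite ltW.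
have [zd] := strongly_convex_fine (pf_Nninfty Hpb) (pf_sconvex Hpb) t01 xd xs_dom.
have [_] := saddle_point_fine zd ys_dom; rewrite -/(f _) -/(f _) -/(f _).
have -> : t1 *: x + (1 - t1) *: xs = xs + t1 *: (x - xs).
  by rewrite scalerBl scale1r scalerBr addrCA.
move: (f _) (f x) (f xs) (Phi _) (Phi _) (mux pp / 2) (enorm _ ^+ 2) => *; lra.
Qed.

Lemma saddle_prox_y (s : R) : 0 < s ->
  prox_point (pg pb) (muy pp) s (ys + s *: grady Phi (xs, ys)) ys.
Proof.
move=> s0; split=> // y yd.
have -> : ys + s *: grady Phi (xs, ys) - ys = s *: grady Phi (xs, ys).
  by rewrite addrAC subrr add0r.
rewrite dotZl mulrA mulVf ?gt_eqF // mul1r.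
suff : dot (grad (fun y => Phi (xs, y)) ys) (y - ys) <=
    g y - g ys - muy pp / 2 * enorm (y - ys) ^+ 2.
  by rewrite -/(g y) -/(g ys) -[grad _ _]/(grady Phi (xs, ys)); lra.
apply: (@grad_le _ _ _ _ _ (muy pp / 2 * enorm (y - ys) ^+ 2)).
  exact: differentiable_Phiy.
move=> t1 /andP[t10 t11]; have t01 : 0 <= t1 <= 1 by rewrite ltW.
have [zd] := strongly_convex_fine (pg_Nninfty Hpb) (pg_sconvex Hpb) t01 yd ys_dom.
have [+ _] := saddle_point_fine xs_dom zd; rewrite -/(g _) -/(g _) -/(g _).
have -> : t1 *: y + (1 - t1) *: ys = ys + t1 *: (y - ys).
  by rewrite scalerBl scale1r scalerBr addrCA.
move: (g _) (g y) (g ys) (Phi _) (Phi _) (muy pp / 2) (enorm _ ^+ 2) => *; lra.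
Qed.

End saddle_point_problem.

(** * Energy decrease of one iteration *)

(** The quadratic form of the matrix inequality in coordinates, the form in which
    it is both used and verified. *)
Lemma psd_MI_matrixP (R : realType) (a : algo_params R) (pp : problem_params R) :
  let t := tau a in let s := sigma a in let th := theta a in
  let r := rho a in let al := alpha a in
  psd (MI_matrix a pp) <-> forall v1 v2 v3 v4 v5 : R,
  0 <= (t^-1 + mux pp - (r * t)^-1) * v1 ^+ 2
     + (s^-1 + muy pp - (r * s)^-1) * v2 ^+ 2
     + 2 * (th / r - 1) * (Lyx pp * v3 + Lyy pp * v4) * v2
     + (t^-1 - Lxx pp) * v3 ^+ 2 + (s^-1 - al) * v4 ^+ 2
     - 2 * (th / r) * (Lyx pp * v3 + Lyy pp * v4) * v5 + al / r * v5 ^+ 2.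
Proof.
case: a => t s th r al /=; split => [+ v1 v2 v3 v4 v5|h v].
  move=> /(_ (\row_(i < 5) nth 0 [:: v1; v2; v3; v4; v5] i)).
  rewrite !mxE !(big_ord_recl, big_ord0) !mxE !(big_ord_recl, big_ord0) !mxE /=.
  move=> h; apply: le_trans h _; apply: ler_eq.
  by move: (r^-1) (t^-1) (s^-1) ((r * t)^-1) ((r * s)^-1) => *; ring.
have := h (v 0 ord0) (v 0 (lift ord0 ord0)) (v 0 (lift ord0 (lift ord0 ord0)))
  (v 0 (lift ord0 (lift ord0 (lift ord0 ord0))))
  (v 0 (lift ord0 (lift ord0 (lift ord0 (lift ord0 ord0))))).
rewrite !mxE !(big_ord_recl, big_ord0) !mxE !(big_ord_recl, big_ord0) !mxE /=.
move=> {}h; apply: le_trans h _; apply: ler_eq.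
move: (r^-1) (t^-1) (s^-1) ((r * t)^-1) ((r * s)^-1) => *.
by move: (v 0 _) (v 0 _) (v 0 _) (v 0 _) (v 0 _) => *; ring.
Qed.

Section energy.
Context {R : realType} {m n : nat}.
Variables (a : algo_params R) (pp : problem_params R).
Hypothesis a_adm : admissible a pp.
Implicit Types (ex dx : 'rV[R]_m) (ey dy q d : 'rV[R]_n).

Let t0 : 0 < tau a. Proof. by case: a_adm => -[]. Qed.
Let s0 : 0 < sigma a. Proof. by case: a_adm => -[]. Qed.
Let r0 : 0 < rho a. Proof. by case: a_adm => _ _ /andP[]. Qed.
Let r1 : rho a < 1. Proof. by case: a_adm => _ _ /andP[]. Qed.
Let al0 : 0 <= alpha a. Proof. by case: a_adm => _ _ _ /andP[]. Qed.
Let al1 : alpha a < (sigma a)^-1. Proof. by case: a_adm => _ _ _ /andP[]. Qed.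
Let th0 : 0 <= theta a. Proof. by case: a_adm. Qed.

(** The Lyapunov function of the noise-free method, as a function of the
    errors [ex], [ey], of the last increments [dx], [dy] and of the gradient
    increment [q]. *)
Definition energy ex ey dx dy q : R :=
  ((tau a)^-1 + mux pp) / 2 * enorm ex ^+ 2
  + ((sigma a)^-1 + muy pp) / 2 * enorm ey ^+ 2
  + ((tau a)^-1 - Lxx pp) / 2 * enorm dx ^+ 2
  + ((sigma a)^-1 - alpha a) / 2 * enorm dy ^+ 2 + dot q ey.

Definition gradient_increment dx dy q : Prop :=
  enorm q <= Lyx pp * enorm dx + Lyy pp * enorm dy.

(** This is all that the matrix inequality is used for. The vector [d] is
    free: taking for it the next dual increment gives the descent of the energy,
    and two other choices bound the distance to the saddle point and the
    momentum by the energy. *)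
Lemma energy_ge ex ey dx dy q d : gradient_increment dx dy q ->
  (2 * tau a)^-1 * enorm ex ^+ 2 + (2 * sigma a)^-1 * enorm ey ^+ 2
  + theta a * (dot q d + dot q ey) - alpha a / 2 * enorm d ^+ 2
  <= rho a * energy ex ey dx dy q.
Proof.
rewrite /gradient_increment /energy.
have [_ _ _ _ hM] := a_adm.
set X := enorm ex; set Y := enorm ey; set DX := enorm dx; set DY := enorm dy.
set B := _ + _ => qB; set Z := enorm d.
have Y0 : 0 <= Y by exact: enorm_ge0.
have Z0 : 0 <= Z by exact: enorm_ge0.
have h1 : dot q d <= B * Z.
  by apply: le_trans (cauchy_schwarz _ _) _; rewrite ler_wpM2r.
have h2 : `|dot q ey| <= B * Y.
  by apply: le_trans (cauchy_schwarz_norm _ _) _; rewrite ler_wpM2r.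
(* The matrix couples the increments with [Y] through the worst sign of
   [dot q ey]; the two signs of the second coordinate cover both cases. *)
have hQ := (psd_MI_matrixP a pp).1 hM.
have := hQ X Y DX DY Z; have := hQ X (- Y) DX DY Z; clear hQ.
move: (t0) (s0) (r0) (th0) h1 h2 => /=; rewrite -/B {qB}.
move: (tau a) (sigma a) (theta a) (rho a) (alpha a) => t s th r al.
move: B (dot q d) (dot q ey) (mux pp) (muy pp) (Lxx pp).
move=> b p e mx my lx t0' s0' r0' th0' + + M1 M2.
rewrite ler_norml => h1 /andP[h2 h3].
have thr0 : 0 <= th / r by rewrite divr_ge0 // ltW.
have hz : th / r * p <= th / r * (b * Z) by rewrite ler_wpM2l.
have Q0 : 0 <= (t^-1 + mx - (r * t)^-1) * X ^+ 2 + (s^-1 + my - (r * s)^-1) * Y ^+ 2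
   + 2 * (1 - th / r) * e + (t^-1 - lx) * DX ^+ 2 + (s^-1 - al) * DY ^+ 2
   - 2 * (th / r) * p + al / r * Z ^+ 2.
  move: hz M1 M2; rewrite sqrrN; move: (th / r) thr0 => c c0.
  move: ((t^-1 + mx - (r * t)^-1) * X ^+ 2 + (s^-1 + my - (r * s)^-1) * Y ^+ 2).
  move: ((t^-1 - lx) * DX ^+ 2) ((s^-1 - al) * DY ^+ 2) (al / r * Z ^+ 2).
  move=> u v w k; have [c1|c1] := leP c 1.
    have : (1 - c) * (- (b * Y)) <= (1 - c) * e by rewrite ler_wpM2l ?subr_ge0.
    by lra.
  have : (c - 1) * e <= (c - 1) * (b * Y) by rewrite ler_wpM2l // subr_ge0 ltW.
  by lra.
rewrite -subr_ge0.
have posE E F : 0 <= E -> r * E / 2 = F -> 0 <= F.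
  by move=> E0 <-; rewrite divr_ge0 // mulr_ge0 // ltW.
by apply: (posE _ _ Q0); field; rewrite !gt_eqF.
Qed.

Lemma energy_ge_dist ex ey dx dy q : gradient_increment dx dy q ->
  (2 * tau a)^-1 * enorm ex ^+ 2
  + (1 - alpha a * sigma a) / (2 * sigma a) * enorm ey ^+ 2
  <= rho a * energy ex ey dx dy q.
Proof.
move=> /(energy_ge ex ey (- ey)); rewrite enormN dotNr addNr mulr0 addr0.
apply: le_trans; apply: ler_eq.
by field; rewrite !gt_eqF.
Qed.

Let als : 0 < 1 - alpha a * sigma a.
Proof. by rewrite subr_gt0 -ltr_pdivlMr // div1r. Qed.

Lemma energy_ge0 ex ey dx dy q : gradient_increment dx dy q ->
  0 <= energy ex ey dx dy q.
Proof.
move=> /(energy_ge_dist ex ey) h; rewrite -(pmulr_rge0 _ r0).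
apply: le_trans h; apply: addr_ge0; apply: mulr_ge0; rewrite ?sqr_ge0 //.
  by rewrite invr_ge0 mulr_ge0 // ltW.
by rewrite divr_ge0 ?mulr_ge0 // ltW.
Qed.

Definition stepsize : R := tau a + sigma a.
(** The inverse of the discount that [alpha] puts on the dual distance. *)
Definition dual_gap : R := (1 - alpha a * sigma a)^-1.

Lemma stepsize_gt0 : 0 < stepsize. Proof. exact: addr_gt0. Qed.

Lemma dual_gap_ge1 : 1 <= dual_gap.
Proof.
by rewrite /dual_gap invf_ge1 // lerBlDr lerDl mulr_ge0 // ltW.
Qed.

(** Bounding in terms of the square root of step size times energy keeps the
    step sizes out of the denominators, so that the factors stay bounded when the
    step sizes tend to zero. The bound on [q] comes from [energy_ge] with a
    multiple of [q] in [d], which makes the inner product quadratic in [q]. *)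
Lemma energy_controls ex ey dx dy q (S : R) : gradient_increment dx dy q ->
  0 <= S -> S ^+ 2 = stepsize * energy ex ey dx dy q ->
  [/\ enorm ex <= 2 * S, enorm ey <= 2 * dual_gap * S
    & sigma a * theta a * enorm q <= 4 * dual_gap * S].
Proof.
move=> hq S0 hS; have E0 := energy_ge0 ex ey hq.
have h1 := energy_ge_dist ex ey hq.
have := energy_ge ex ey ((sigma a * theta a / 2) *: q - ey) hq.
rewrite dotDr dotNr dotZr subrK -enorm_sqr.
set E := energy _ _ _ _ _ in E0 hS h1 *; set X := enorm ex in h1 *.
set Y := enorm ey in h1 *; set Q := enorm q.
set D := enorm (_ - _) => h2.
have hD : D ^+ 2 <= 2 * ((sigma a * theta a / 2 * Q) ^+ 2 + Y ^+ 2).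
  have : D <= sigma a * theta a / 2 * Q + Y.
    apply: le_trans (enormB _ _) _; rewrite enormZ ger0_norm //.
    by rewrite divr_ge0 // mulr_ge0 // ltW.
  move: (_ * Q) => z; have : 0 <= D by exact: enorm_ge0.
  have := sqr_ge0 (z - Y); nra.
have rE : rho a * E <= E by rewrite -[leRHS]mul1r ler_wpM2r // ltW.
have k1 := dual_gap_ge1; have k0 : 0 < dual_gap by exact: lt_le_trans k1.
have hX : X ^+ 2 <= 2 * tau a * E.
  have : (2 * tau a)^-1 * X ^+ 2 <= E.
    apply: le_trans rE; apply: le_trans h1; rewrite lerDl.
    by apply: mulr_ge0; rewrite ?sqr_ge0 // divr_ge0 ?mulr_ge0 // ltW.
  by rewrite mulrC ler_pdivrMr ?mulr_gt0 // mulrC.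
have hY : Y ^+ 2 <= 2 * sigma a * dual_gap * E.
  have : (1 - alpha a * sigma a) / (2 * sigma a) * Y ^+ 2 <= E.
    apply: le_trans rE; apply: le_trans h1; rewrite lerDr.
    by apply: mulr_ge0; rewrite ?sqr_ge0 // invr_ge0 mulr_ge0 // ltW.
  rewrite mulrAC ler_pdivrMr ?mulr_gt0 // mulrC -ler_pdivlMr // /dual_gap => h.
  by apply: le_trans h _; apply: ler_eq; ring.
have hQ : (sigma a * theta a * Q) ^+ 2 <= 8 * sigma a * dual_gap * E.
  have hal : alpha a / 2 * D ^+ 2 <= (sigma a)^-1 * ((sigma a * theta a / 2 * Q) ^+ 2 + Y ^+ 2).
    apply: (@le_trans _ _ ((sigma a)^-1 / 2 * D ^+ 2)).
      by rewrite ler_wpM2r ?sqr_ge0 // ler_wpM2r // ltW.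
    rewrite -mulrA ler_wpM2l ?invr_ge0 ?(ltW s0) //.
    by move: hD; move: (D ^+ 2) (_ + _) => *; lra.
  have hs : (sigma a)^-1 * Y ^+ 2 <= 2 * dual_gap * E.
    by rewrite mulrC ler_pdivrMr // ; apply: le_trans hY _; apply: ler_eq; ring.
  have hX0 : 0 <= (2 * tau a)^-1 * X ^+ 2.
    by rewrite mulr_ge0 ?sqr_ge0 // invr_ge0 mulr_ge0 // ltW.
  have h3 : theta a * (sigma a * theta a / 2 * Q ^+ 2) <=
     E + (sigma a)^-1 * (sigma a * theta a / 2 * Q) ^+ 2 + dual_gap * E.
    have e1 : (2 * sigma a)^-1 * Y ^+ 2 = (sigma a)^-1 * Y ^+ 2 / 2.
      by field; rewrite gt_eqF.
    by move: h2 hal; rewrite e1; lra.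
  have h4 : (sigma a * theta a * Q) ^+ 2 / (4 * sigma a) <= (1 + dual_gap) * E.
    have -> : (sigma a * theta a * Q) ^+ 2 / (4 * sigma a) =
       theta a * (sigma a * theta a / 2 * Q ^+ 2)
       - (sigma a)^-1 * (sigma a * theta a / 2 * Q) ^+ 2.
      by field; rewrite gt_eqF.
    by lra.
  move: h4; rewrite ler_pdivrMr ?mulr_gt0 // => /le_trans; apply.
  have : (1 + dual_gap) * E <= 2 * dual_gap * E by rewrite ler_wpM2r //; lra.
  have s40 : 0 <= 4 * sigma a by rewrite mulr_ge0 // ltW.
  by move=> /(ler_wpM2r s40) /le_trans; apply; apply: ler_eq; ring.
have tE : 0 <= tau a * E by rewrite mulr_ge0 // ltW.
have sE : 0 <= sigma a * E by rewrite mulr_ge0 // ltW.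
have kS : 0 <= dual_gap * S by rewrite mulr_ge0 // ltW.
have kk : dual_gap * (sigma a * E) <= dual_gap ^+ 2 * (sigma a * E).
  by rewrite ler_wpM2r // expr2 ler_peMr // ltW.
have kt : 0 <= dual_gap ^+ 2 * (tau a * E) by rewrite mulr_ge0 ?sqr_ge0.
have ks : 0 <= dual_gap * (sigma a * E) by rewrite mulr_ge0 // ltW.
have bound x c : 0 <= x -> 0 <= c -> x ^+ 2 <= c ^+ 2 * S ^+ 2 -> x <= c * S.
  move=> x0 c0; rewrite -exprMn ler_pXn2r // nnegrE //; exact: mulr_ge0.
split; apply: bound; rewrite ?enorm_ge0 ?mulr_ge0 ?enorm_ge0 ?(ltW s0) ?(ltW k0) //;
  rewrite hS /stepsize -/X -/Y -/Q.
- apply: le_trans hX _. by lra.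
- by apply: le_trans hY _; rewrite exprMn; lra.
- by apply: le_trans hQ _; rewrite exprMn; lra.
Qed.

End energy.

Section one_step.
Context {R : realType} {m n : nat}.
Variables (a : algo_params R) (pp : problem_params R) (pb : problem R m n).
Variables (xs : 'rV[R]_m) (ys : 'rV[R]_n) (x0 : 'rV[R]_m) (y0 : 'rV[R]_n).
Hypothesis a_adm : admissible a pp.
Hypotheses (Hpb : problem_assumption pp pb) (saddle : saddle_point pb xs ys).
Hypotheses (x0_dom : edom (pf pb) x0) (y0_dom : edom (pg pb) y0).

Let t0 : 0 < tau a. Proof. by case: a_adm => -[]. Qed.
Let s0 : 0 < sigma a. Proof. by case: a_adm => -[]. Qed.

(** Contraction of the energy along one inexact iteration; the errors enter only
    through their inner products with the new error vectors. *)
Lemma energy_step x y dx dy q x' y' (ny : 'rV[R]_n) (nx : 'rV[R]_m) :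
  edom (pf pb) x -> edom (pg pb) y -> gradient_increment pp dx dy q ->
  prox_point (pg pb) (muy pp) (sigma a)
    (y + sigma a *: (grady (pPhi pb) (x, y) + theta a *: q + ny)) y' ->
  prox_point (pf pb) (mux pp) (tau a)
    (x - tau a *: (gradx (pPhi pb) (x, y') + nx)) x' ->
  energy a pp (x' - xs) (y' - ys) (x' - x) (y' - y)
    (grady (pPhi pb) (x', y') - grady (pPhi pb) (x, y))
  <= rho a * energy a pp (x - xs) (y - ys) dx dy q
     + dot ny (y' - ys) - dot nx (x' - xs).
Proof.
move=> xd yd hq [yd' hy] [xd' hx].
have [xsd ysd] := saddle_point_edom Hpb saddle x0_dom y0_dom.
have := energy_ge a_adm (x - xs) (y - ys) (y' - y) hq.
have := Phi_descent Hpb xd xd' yd'; have := Phi_convex_grad Hpb xd xsd yd'.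
have := Phi_concave_grad Hpb xd' yd' ysd.
have [h1 _] := saddle_point_fine Hpb saddle x0_dom y0_dom xsd yd'.
have [_ h2] := saddle_point_fine Hpb saddle x0_dom y0_dom xd' ysd.
move: h1 h2 (hy _ ysd) (hx _ xsd).
set F := fun x => fine (pf pb x); set G := fun y => fine (pg pb y).
rewrite -/(F x') -/(F xs) -/(G y') -/(G ys).
move: (F x') (F xs) (G y') (G ys) => fx' fxs gv' gvs.
have sub (V : zmodType) (u v w : V) : u - w - (v - w) = u - v.
  by rewrite opprB addrA subrK.
set gx := gradx _ _; set gy := grady _ (x, y); set gy' := grady _ (x', y').
move: (pPhi pb _) (pPhi pb _) (pPhi pb _) (pPhi pb _) => p1 p2 p3 p4.
have -> : y + sigma a *: (gy + theta a *: q + ny) - y' =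
    sigma a *: (gy + theta a *: q + ny) + ((y - ys) - (y' - ys)).
  by rewrite sub addrAC addrC.
have -> : x - tau a *: (gx + nx) - x' =
    - (tau a *: (gx + nx)) + ((x - xs) - (x' - xs)).
  by rewrite sub addrAC addrC.
have -> : ys - y' = - (y' - ys) by rewrite opprB.
have -> : xs - x' = - (x' - xs) by rewrite opprB.
have -> : xs - x = - (x - xs) by rewrite opprB.
have -> : y' - y = (y' - ys) - (y - ys) by rewrite sub.
have -> : x' - x = (x' - xs) - (x - xs) by rewrite sub.
rewrite /energy.
move: (x' - xs) (x - xs) (y' - ys) (y - ys) => ex' ex ey' ey.
move: (rho a * _) => E.
have scaleK k (c : R) (A B C : 'rV[R]_k) : 0 < c ->
    c^-1 * dot (c *: A + B) C = dot A C + c^-1 * dot B C.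
  by move=> c0; rewrite dotDl dotZl mulrDr mulrA mulVf ?mul1r // gt_eqF.
rewrite -(scalerN (tau a)) !scaleK //.
rewrite !enorm_sqr !dotE (dotC ey' ey) (dotC ex' ex).
by rewrite [(2 * tau a)^-1]invfM [(2 * sigma a)^-1]invfM; lra.
Qed.

End one_step.

(** * Noise-free steps and explicit constants *)

Section constants.
Context {R : realType}.
Variables (a : algo_params R) (pp : problem_params R).
Let th := theta a.
Let kap := dual_gap a.

(** All the constants are built with nonnegative coefficients from [theta a],
    [(rho a)^-1], [dual_gap a], [lipschitz_step] and [stepsize a]; nonnegativity,
    and boundedness when the step sizes tend to zero, then hold by closure. *)
Definition lipschitz_step : R :=
  stepsize a * (Lxx pp + Lyy pp + Lxy pp + Lyx pp).
Let l := lipschitz_step.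

Definition yhat_cst : R := 6 * kap + 2 * l * kap.
Definition xhat_cst : R := 2 + l * (2 + yhat_cst).
Definition yhat2_cst : R :=
  yhat_cst + (1 + th) * l * (yhat_cst + xhat_cst) + th * l * (2 + 2 * kap).
Definition drift_cst : R := (1 + th) * yhat_cst + th / rho a * yhat2_cst.

Definition xhat_err : R := 1 + l * (1 + th).
Definition yhat2_err : R :=
  (1 + th) + (1 + th) * l * ((1 + th) + xhat_err).
Definition step_err : R :=
  (1 + th) ^+ 2 + th * ((1 + th) + yhat2_err) + xhat_err.
Definition delay_err : R :=
  (th / rho a * yhat_cst) ^+ 2 / 2 + th / rho a * yhat2_err.

Definition memory2 : R := 6 * step_err / rho a + 4 * delay_err.
Definition memory1 : R := (memory2 + 6 * step_err) / rho a.

Definition noise_cst : R := stepsize a * (memory1 + 6 * step_err).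
Definition variance_cst : R :=
  2 * stepsize a * (drift_cst ^+ 2 + xhat_cst ^+ 2).

Hypotheses (pp_valid : valid_problem_params pp) (a_adm : admissible a pp).

Lemma constants_ge0 :
  [/\ [/\ 0 <= th, 0 < rho a, 0 <= l & 1 <= kap],
      [/\ 0 <= yhat_cst, 0 <= xhat_cst, 0 <= yhat2_cst & 0 <= drift_cst],
      [/\ 0 <= xhat_err, 0 <= yhat2_err, 0 <= step_err & 0 <= delay_err]
    & 0 <= memory2 /\ 0 <= memory1].
Proof.
have [[t0 s0] th0 /andP[r0 r1] al01 _] := a_adm.
have [_ L1 L2 L3 L4] := pp_valid.
have k1 : 1 <= kap by exact: dual_gap_ge1 a_adm.
have k0 : 0 <= kap by exact: le_trans k1.
have l0 : 0 <= l by rewrite mulr_ge0 ?addr_ge0 // ltW.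
have A x y : 0 <= x -> 0 <= y -> 0 <= x + y :> R by exact: addr_ge0.
have M x y : 0 <= x -> 0 <= y -> 0 <= x * y :> R by exact: mulr_ge0.
have n2 : 0 <= 2 :> R by []. have n6 : 0 <= 6 :> R by []. have n4 : 0 <= 4 :> R by [].
have ri : 0 <= (rho a)^-1 by rewrite invr_ge0 ltW.
have c1 : 0 <= yhat_cst by rewrite /yhat_cst; auto.
have c2 : 0 <= xhat_cst by rewrite /xhat_cst; auto.
have d1 : 0 <= 1 + th by auto.
have c3 : 0 <= yhat2_cst by rewrite /yhat2_cst; auto 7.
have d2 : 0 <= xhat_err by rewrite /xhat_err; auto 7.
have d3 : 0 <= yhat2_err by rewrite /yhat2_err; auto 8.
have d4 : 0 <= step_err by rewrite /step_err expr2; auto 8.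
have d5 : 0 <= delay_err by rewrite /delay_err; apply: A; [rewrite divr_ge0 // sqr_ge0 | auto 7].
have m2 : 0 <= memory2 by rewrite /memory2; auto 7.
have m1 : 0 <= memory1 by rewrite /memory1; auto 7.
have d0 : 0 <= drift_cst by rewrite /drift_cst; auto 7.
by split; split.
Qed.

End constants.

Section noise_free_steps.
Context {R : realType} {m n : nat}.
Variables (a : algo_params R) (pp : problem_params R) (pb : problem R m n).
Variables (xs : 'rV[R]_m) (ys : 'rV[R]_n) (x0 : 'rV[R]_m) (y0 : 'rV[R]_n).
Hypotheses (pp_valid : valid_problem_params pp) (a_adm : admissible a pp).
Hypotheses (Hpb : problem_assumption pp pb) (saddle : saddle_point pb xs ys).
Hypotheses (x0_dom : edom (pf pb) x0) (y0_dom : edom (pg pb) y0).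

Let t0 : 0 < tau a. Proof. by case: a_adm => -[]. Qed.
Let s0 : 0 < sigma a. Proof. by case: a_adm => -[]. Qed.
Let th0 : 0 <= theta a. Proof. by case: a_adm. Qed.
Let mux0 : 0 < mux pp. Proof. by case: pp_valid => -[]. Qed.
Let muy0 : 0 < muy pp. Proof. by case: pp_valid => -[]. Qed.
Let l := lipschitz_step a pp.
Let eta := stepsize a.

Let G := grady (pPhi pb).

Definition proxg (z : 'rV[R]_n) := prox (fun u => ((sigma a)%:E * pg pb u)%E) z.
Definition proxf (z : 'rV[R]_m) := prox (fun u => ((tau a)%:E * pf pb u)%E) z.

(** What exact gradients would give from [(x, y)] with momentum [q]: the dual
    step, the primal step after it, and the dual step of the following iteration.
    The noise of the current iteration does not enter. *)
Definition yhat (x : 'rV[R]_m) y (q : 'rV[R]_n) : 'rV[R]_n :=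
  proxg (y + sigma a *: (grady (pPhi pb) (x, y) + theta a *: q)).
Definition xhat x y q : 'rV[R]_m :=
  proxf (x - tau a *: gradx (pPhi pb) (x, yhat x y q)).
Definition yhat2 x y q : 'rV[R]_n :=
  yhat (xhat x y q) (yhat x y q)
    (grady (pPhi pb) (xhat x y q, yhat x y q) - grady (pPhi pb) (x, y)).

Lemma proxgP z : prox_point (pg pb) (muy pp) (sigma a) z (proxg z).
Proof.
exact: prox_pointP (pg_Nninfty Hpb) (pg_closed Hpb) muy0 (pg_sconvex Hpb)
  y0_dom _ _ s0.
Qed.

Lemma proxfP z : prox_point (pf pb) (mux pp) (tau a) z (proxf z).
Proof.
exact: prox_pointP (pf_Nninfty Hpb) (pf_closed Hpb) mux0 (pf_sconvex Hpb)
  x0_dom _ _ t0.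
Qed.

Lemma proxg_dom z : edom (pg pb) (proxg z). Proof. exact: (proxgP z).1. Qed.
Lemma proxf_dom z : edom (pf pb) (proxf z). Proof. exact: (proxfP z).1. Qed.

Lemma proxg_nonexpansive z z' : enorm (proxg z - proxg z') <= enorm (z - z').
Proof. exact: prox_point_nonexpansive muy0 _ _ _ _ _ s0 (proxgP z) (proxgP z'). Qed.

Lemma proxf_nonexpansive z z' : enorm (proxf z - proxf z') <= enorm (z - z').
Proof. exact: prox_point_nonexpansive mux0 _ _ _ _ _ t0 (proxfP z) (proxfP z'). Qed.

Let sigma_lip : sigma a * (Lyx pp + Lyy pp) <= l.
Proof.
have [_ L1 L2 L3 L4] := pp_valid; rewrite /l /lipschitz_step /stepsize.
by move: t0 s0 => t0' s0'; apply: ler_pM; lra.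
Qed.

Let tau_lip : tau a * (Lxx pp + Lxy pp) <= l.
Proof.
have [_ L1 L2 L3 L4] := pp_valid; rewrite /l /lipschitz_step /stepsize.
by move: t0 s0 => t0' s0'; apply: ler_pM; lra.
Qed.

Let weigh (c L1 L2 u v w : R) : 0 <= c -> 0 <= L1 -> 0 <= L2 -> 0 <= w ->
  c * (L1 + L2) <= l -> u <= w -> v <= w -> c * (L1 * u + L2 * v) <= l * w.
Proof.
move=> c0 L10 L20 w0 hl uw vw.
apply: (@le_trans _ _ (c * (L1 + L2) * w)); last by rewrite ler_wpM2r.
rewrite -mulrA ler_wpM2l // mulrDl; apply: lerD; exact: ler_wpM2l.
Qed.

Let sub_addl (V : zmodType) (u v w z : V) : u + v - (w + z) = (u - w) + (v - z).
Proof. by rewrite opprD addrACA. Qed.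

(** The saddle point is a fixed point of the exact steps and the proximal maps
    are nonexpansive, so each noise-free step is as close to the saddle point as
    the data it is computed from. *)
Lemma noise_free_controls x y q S : edom (pf pb) x -> edom (pg pb) y -> 0 <= S ->
  enorm (x - xs) <= 2 * S -> enorm (y - ys) <= 2 * dual_gap a * S ->
  sigma a * theta a * enorm q <= 4 * dual_gap a * S ->
  [/\ enorm (yhat x y q - ys) <= yhat_cst a pp * S,
      enorm (xhat x y q - xs) <= xhat_cst a pp * S
    & enorm (yhat2 x y q - ys) <= yhat2_cst a pp * S].
Proof.
move=> xd yd S0 hx hy hq.
have [[_ _ l0 k1] [c10 c20 _ _] _ _] := constants_ge0 pp_valid a_adm.
rewrite -/l in l0; have k0 := le_trans ler01 k1.
have [_ L1 L2 L3 L4] := pp_valid.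
have [xsd ysd] := saddle_point_edom Hpb saddle x0_dom y0_dom.
have sy := saddle_prox_y Hpb saddle x0_dom y0_dom s0.
have sx := saddle_prox_x Hpb saddle x0_dom y0_dom t0.
have s0' := ltW s0; have t0' := ltW t0; have L4' := ltW L4; have L3' := ltW L3.
have kS : S <= dual_gap a * S by rewrite ler_peMl.
have g0 : sigma a * enorm (G (x, y) - G (xs, ys)) <= l * (2 * dual_gap a * S).
  apply: le_trans (ler_wpM2l s0' (grady_Lipschitz Hpb xd yd xsd ysd)) _.
  by apply: weigh => //; rewrite -?mulrA ?mulr_ge0 //; lra.
have h1 : enorm (yhat x y q - ys) <= yhat_cst a pp * S.
  apply: le_trans (prox_point_nonexpansive muy0 s0 (proxgP _) sy) _.
  rewrite -/G sub_addl -scalerBr (addrAC (G _)) scalerDr scalerA.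
  apply: le_trans (enormD _ _) _; apply: le_trans (lerD (lexx _) (enormD _ _)) _.
  rewrite !enormZ (ger0_norm s0') ger0_norm ?mulr_ge0 //.
  by rewrite /yhat_cst -/l; lra.
have yhd : edom (pg pb) (yhat x y q) by exact: proxg_dom.
have xhd : edom (pf pb) (xhat x y q) by exact: proxf_dom.
have h2 : enorm (xhat x y q - xs) <= xhat_cst a pp * S.
  apply: le_trans (prox_point_nonexpansive mux0 t0 (proxfP _) sx) _.
  rewrite sub_addl -opprD -scalerBr.
  apply: le_trans (enormB _ _) _; rewrite enormZ (ger0_norm t0').
  have := ler_wpM2l t0' (gradx_Lipschitz Hpb xd yhd xsd ysd).
  have : tau a * (Lxx pp * enorm (x - xs) + Lxy pp * enorm (yhat x y q - ys))
      <= l * ((2 + yhat_cst a pp) * S).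
    apply: weigh => //; first by rewrite mulr_ge0 // addr_ge0.
      by apply: le_trans hx _; rewrite ler_wpM2r // lerDl.
    by apply: le_trans h1 _; rewrite ler_wpM2r // lerDr.
  by rewrite /xhat_cst -/l; lra.
split=> //; apply: le_trans (prox_point_nonexpansive muy0 s0 (proxgP _) sy) _.
rewrite -/G sub_addl -scalerBr.
set g1 := G (xhat _ _ _, _); set g := G (x, y); set gs := G (xs, ys).
have -> : g1 + theta a *: (g1 - g) - gs =
    (1 + theta a) *: (g1 - gs) - theta a *: (g - gs).
  rewrite [LHS]addrAC scalerDl scale1r -[RHS]addrA -[X in _ = _ + X]scalerBr.
  by congr (_ + _ *: _); rewrite opprB addrA subrK.
apply: le_trans (enormD _ _) _.
rewrite enormZ (ger0_norm s0').
have := ler_wpM2l s0' (enormB ((1 + theta a) *: (g1 - gs)) (theta a *: (g - gs))).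
rewrite !enormZ (ger0_norm th0) ger0_norm ?addr_ge0 //.
have h3 : sigma a * enorm (g1 - gs) <= l * ((yhat_cst a pp + xhat_cst a pp) * S).
  apply: le_trans (ler_wpM2l s0' (grady_Lipschitz Hpb xhd yhd xsd ysd)) _.
  apply: weigh => //; first by rewrite mulr_ge0 // addr_ge0.
    by apply: le_trans h2 _; rewrite ler_wpM2r // lerDr.
  by apply: le_trans h1 _; rewrite ler_wpM2r // lerDl.
have h4 : sigma a * enorm (g - gs) <= l * ((2 + 2 * dual_gap a) * S).
  apply: le_trans g0 _; rewrite ler_wpM2l // ler_wpM2r // lerDr //.
have h3' := ler_wpM2l (addr_ge0 ler01 th0) h3; have h4' := ler_wpM2l th0 h4.
move=> H; apply: le_trans (lerD h1 H) _.
have -> u v : sigma a * ((1 + theta a) * u + theta a * v) =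
  (1 + theta a) * (sigma a * u) + theta a * (sigma a * v) by ring.
apply: le_trans (lerD (lexx _) (lerD h3' h4')) _.
by apply: ler_eq; rewrite /yhat2_cst -/l; ring.
Qed.

(** By nonexpansiveness the noise displaces each step by at most the step size
    times its norm, plus what the displacement of the previous step changes in
    the gradient. *)
Lemma perturbed_steps x y q (ny : 'rV[R]_n) (nx : 'rV[R]_m) y' x' :
  edom (pf pb) x -> edom (pg pb) y ->
  y' = proxg (y + sigma a *: (G (x, y) + theta a *: q + ny)) ->
  x' = proxf (x - tau a *: (gradx (pPhi pb) (x, y') + nx)) ->
  [/\ enorm (y' - yhat x y q) <= sigma a * enorm ny,
      enorm (x' - xhat x y q) <=
        tau a * (enorm nx + Lxy pp * enorm (y' - yhat x y q))
    & enorm (yhat x' y' (G (x', y') - G (x, y)) - yhat2 x y q)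
       <= enorm (y' - yhat x y q) + sigma a * (1 + theta a) *
         (Lyx pp * enorm (x' - xhat x y q) + Lyy pp * enorm (y' - yhat x y q))].
Proof.
move=> xd yd ey ex; have s0' := ltW s0; have t0' := ltW t0.
have yd' : edom (pg pb) y' by rewrite ey; exact: proxg_dom.
have xd' : edom (pf pb) x' by rewrite ex; exact: proxf_dom.
have yhd : edom (pg pb) (yhat x y q) by exact: proxg_dom.
have xhd : edom (pf pb) (xhat x y q) by exact: proxf_dom.
split.
- rewrite ey; apply: le_trans (proxg_nonexpansive _ _) _.
  rewrite -/G sub_addl subrr add0r -scalerBr addrAC subrr add0r.
  by rewrite enormZ ger0_norm.
- rewrite {1}ex; apply: le_trans (proxf_nonexpansive _ _) _.
  rewrite sub_addl subrr add0r -opprD enormN -scalerBr enormZ ger0_norm //.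
  rewrite ler_wpM2l // addrAC addrC; apply: le_trans (enormD _ _) _.
  rewrite lerD2l.
  have := gradx_Lipschitz Hpb xd yd' xd yhd.
  by rewrite subrr enorm0 mulr0 add0r.
apply: le_trans (proxg_nonexpansive _ _) _.
rewrite -/G sub_addl; apply: le_trans (enormD _ _) _; rewrite lerD2l -scalerBr.
set g1 := G (x', y'); set g2 := G (xhat _ _ _, _); set g := G (x, y).
have -> : g1 + theta a *: (g1 - g) - (g2 + theta a *: (g2 - g)) =
    (1 + theta a) *: (g1 - g2).
  rewrite sub_addl -scalerBr opprB addrA subrK.
  by rewrite scalerDl scale1r.
rewrite scalerA enormZ ger0_norm ?mulr_ge0 ?addr_ge0 //.
rewrite ler_wpM2l ?mulr_ge0 ?addr_ge0 //.
exact (grady_Lipschitz Hpb xd' yd' xhd yhd).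
Qed.

End noise_free_steps.

(** * Energy along a noisy path *)

Section noisy_path.
Context {R : realType} {m n : nat}.
Variables (a : algo_params R) (pp : problem_params R) (pb : problem R m n).
Variables (xs : 'rV[R]_m) (ys : 'rV[R]_n).
Variables (x : nat -> 'rV[R]_m) (y : nat -> 'rV[R]_n).
Variables (dy : nat -> 'rV[R]_n) (dx : nat -> 'rV[R]_m).

Definition prev {V : Type} (d : V) (u : nat -> V) k := if k is j.+1 then u j else d.

Definition dual_grad k := grady (pPhi pb) (x k, y k).
Definition momentum k := dual_grad k - dual_grad k.-1.
(** The momentum is zero in the first iteration; later the current noise enters
    through the gradient and through the momentum. *)
Definition momentum_weight k : R := if k is 0 then 1 else 1 + theta a.
Definition dual_noise k : 'rV[R]_n :=
  momentum_weight k *: dy k - theta a *: prev 0 dy k.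
Definition noise_sq k : R := enorm (dy k) ^+ 2 + enorm (dx k) ^+ 2.

Definition yfree k := yhat a pb (x k) (y k) (momentum k).
Definition xfree k := xhat a pb (x k) (y k) (momentum k).
Definition yfree2 k := yhat2 a pb (x k) (y k) (momentum k).

Definition path_energy k : R :=
  energy a pp (x k - xs) (y k - ys) (x k - x k.-1) (y k - y k.-1) (momentum k).

(** The inner product anticipates the second action of the previous dual noise;
    the squares of the last two noises pay for the replacement of the iterates by
    their noise-free counterparts. *)
Definition noisy_energy k : R :=
  path_energy k - theta a / rho a * dot (prev 0 dy k) (prev (yfree 0) yfree2 k - ys)
  + stepsize a * (memory1 a pp * prev 0 noise_sq k
                  + memory2 a pp * prev 0 (prev 0 noise_sq) k).

Definition dual_drift k : 'rV[R]_n :=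
  momentum_weight k *: (yfree k - ys) - (theta a / rho a) *: (yfree2 k - ys).
Definition primal_drift k : 'rV[R]_m := - (xfree k - xs).

Hypotheses (pp_valid : valid_problem_params pp) (a_adm : admissible a pp).
Hypotheses (Hpb : problem_assumption pp pb) (saddle : saddle_point pb xs ys).
Hypotheses (x0_dom : edom (pf pb) (x 0)) (y0_dom : edom (pg pb) (y 0)).
Hypothesis y_step : forall k, y k.+1 =
  proxg a pb (y k + sigma a *: (dual_grad k + theta a *: momentum k + dual_noise k)).
Hypothesis x_step : forall k, x k.+1 =
  proxf a pb (x k - tau a *: (gradx (pPhi pb) (x k, y k.+1) + dx k)).

Let t0 : 0 < tau a. Proof. by case: a_adm => -[]. Qed.
Let s0 : 0 < sigma a. Proof. by case: a_adm => -[]. Qed.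
Let th0 : 0 <= theta a. Proof. by case: a_adm. Qed.
Let r0 : 0 < rho a. Proof. by case: a_adm => _ _ /andP[]. Qed.
Let r1 : rho a < 1. Proof. by case: a_adm => _ _ /andP[]. Qed.
Let eta := stepsize a.
Let eta0 : 0 < eta. Proof. exact: stepsize_gt0 a_adm. Qed.
Let l := lipschitz_step a pp.
Let thr : 0 <= theta a / rho a. Proof. by rewrite divr_ge0 // ltW. Qed.

Lemma path_dom k : edom (pf pb) (x k) /\ edom (pg pb) (y k).
Proof.
case: k => [//|k]; rewrite x_step y_step; split.
  exact: (proxf_dom pp_valid a_adm Hpb x0_dom).
exact: (proxg_dom pp_valid a_adm Hpb y0_dom).
Qed.

Lemma path_increment k :
  gradient_increment pp (x k - x k.-1) (y k - y k.-1) (momentum k).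
Proof.
have [xd yd] := path_dom k; have [xd' yd'] := path_dom k.-1.
exact: (grady_Lipschitz Hpb).
Qed.

Lemma path_energy_ge0 k : 0 <= path_energy k.
Proof. exact: energy_ge0 a_adm _ _ _ _ _ (path_increment k). Qed.

Let S k := Num.sqrt (eta * path_energy k).
Let S0 k : 0 <= S k. Proof. exact: sqrtr_ge0. Qed.
Let S2 k : S k ^+ 2 = eta * path_energy k.
Proof. by rewrite sqr_sqrtr // mulr_ge0 ?path_energy_ge0 // ltW. Qed.

Let free_controls k :
  [/\ enorm (yfree k - ys) <= yhat_cst a pp * S k,
      enorm (xfree k - xs) <= xhat_cst a pp * S k
    & enorm (yfree2 k - ys) <= yhat2_cst a pp * S k].
Proof.
have [xd yd] := path_dom k.
have [h1 h2 h3] := energy_controls a_adm (path_increment k) (S0 k) (S2 k).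
exact: (noise_free_controls pp_valid a_adm Hpb saddle x0_dom y0_dom).
Qed.

Let e k := enorm (dy k) + enorm (dx k).
Let e0 k : 0 <= e k. Proof. by rewrite addr_ge0 ?enorm_ge0. Qed.

Let pdy_le k : enorm (prev 0 dy k) <= prev 0 e k.
Proof. by case: k => [|k] /=; rewrite ?enorm0 // lerDl enorm_ge0. Qed.

Let pe0 k : 0 <= prev 0 e k. Proof. by case: k => [|k] /=. Qed.
Let ppe0 k : 0 <= prev 0 (prev 0 e) k. Proof. by case: k => [|k] /=. Qed.

Let noise_le k : enorm (dual_noise k) <= (1 + theta a) * (e k + prev 0 e k).
Proof.
apply: le_trans (enormB _ _) _; rewrite !enormZ mulrDr; apply: lerD.
  apply: ler_pM; rewrite ?normr_ge0 ?enorm_ge0 //.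
    by case: (k) => [|j]; rewrite /= ger0_norm ?addr_ge0 ?lerDl.
  by rewrite lerDl enorm_ge0.
rewrite ger0_norm //; apply: ler_pM; rewrite ?enorm_ge0 //.
by rewrite lerDr.
Qed.

Let path_perturbed k :
  [/\ enorm (y k.+1 - yfree k) <= sigma a * enorm (dual_noise k),
      enorm (x k.+1 - xfree k) <=
        tau a * (enorm (dx k) + Lxy pp * enorm (y k.+1 - yfree k))
    & enorm (yfree k.+1 - yfree2 k)
       <= enorm (y k.+1 - yfree k) + sigma a * (1 + theta a) *
         (Lyx pp * enorm (x k.+1 - xfree k) + Lyy pp * enorm (y k.+1 - yfree k))].
Proof.
have [xd yd] := path_dom k.
exact: (perturbed_steps pp_valid a_adm Hpb x0_dom y0_dom xd yd
  (y_step k) (x_step k)).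
Qed.

Let lip_le : [/\ sigma a * Lyx pp + sigma a * Lyy pp <= l,
  tau a * Lxy pp <= l, sigma a <= eta & tau a <= eta].
Proof.
have [_ L1 L2 L3 L4] := pp_valid; move: t0 s0 => t0' s0'.
rewrite /l /lipschitz_step /eta /stepsize -mulrDr; split; last 2 first.
- by rewrite lerDr ltW.
- by rewrite lerDl ltW.
- by apply: ler_pM; lra.
- by apply: ler_pM; lra.
Qed.

Let y_err k :
  enorm (y k.+1 - yfree k) <= eta * ((1 + theta a) * (e k + prev 0 e k)).
Proof.
have [h _ _] := path_perturbed k; have [_ _ se _] := lip_le.
by apply: le_trans h _; apply: ler_pM; rewrite ?enorm_ge0 // ltW.
Qed.

Let x_err k :
  enorm (x k.+1 - xfree k) <= eta * (xhat_err a pp * (e k + prev 0 e k)).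
Proof.
have [_ h _] := path_perturbed k; have [_ ll _ te] := lip_le.
apply: le_trans h _; rewrite mulrDr mulrA.
have t0' := ltW t0; have [_ _ _ /ltW L3 _] := pp_valid.
have h1 : tau a * enorm (dx k) <= eta * (e k + prev 0 e k).
  apply: ler_pM; rewrite ?enorm_ge0 // /e; have := pe0 k.
  by have := enorm_ge0 (dy k); lra.
have h2 : tau a * Lxy pp * enorm (y k.+1 - yfree k) <=
    l * (eta * ((1 + theta a) * (e k + prev 0 e k))).
  by apply: ler_pM; rewrite ?enorm_ge0 ?mulr_ge0 //; exact: y_err.
apply: le_trans (lerD h1 h2) _; apply: ler_eq; rewrite /xhat_err -/l; ring.
Qed.

Let y2_err k :
  enorm (yfree k.+1 - yfree2 k) <= eta * (yhat2_err a pp * (e k + prev 0 e k)).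
Proof.
have [_ _ h] := path_perturbed k; have [ll _ _ _] := lip_le.
have [_ L1 L2 L3 /ltW L4] := pp_valid; have s0' := ltW s0.
set T := e k + prev 0 e k; have T0 : 0 <= T by rewrite addr_ge0.
have [[_ _ l0 _] _ [d20 _ _ _] _] := constants_ge0 pp_valid a_adm.
have d10 : 0 <= 1 + theta a by rewrite addr_ge0.
apply: le_trans h _; apply: le_trans (lerD (y_err k) (lexx _)) _.
have -> u v : sigma a * (1 + theta a) * (Lyx pp * u + Lyy pp * v) =
  (1 + theta a) * ((sigma a * Lyx pp) * u + (sigma a * Lyy pp) * v) by ring.
set w := eta * ((1 + theta a + xhat_err a pp) * T).
have w0 : 0 <= w.
  by apply: (mulr_ge0 (ltW eta0)); apply: mulr_ge0 T0; apply: addr_ge0.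
have h1 : sigma a * Lyx pp * enorm (x k.+1 - xfree k) <= sigma a * Lyx pp * w.
  rewrite ler_wpM2l ?mulr_ge0 //; apply: le_trans (x_err k) _.
  by rewrite ler_wpM2l ?(ltW eta0) // ler_wpM2r // lerDr.
have h2 : sigma a * Lyy pp * enorm (y k.+1 - yfree k) <= sigma a * Lyy pp * w.
  rewrite ler_wpM2l ?mulr_ge0 //; apply: le_trans (y_err k) _.
  by rewrite ler_wpM2l ?(ltW eta0) // ler_wpM2r // lerDl.
have h3 : (1 + theta a) * (sigma a * Lyx pp * enorm (x k.+1 - xfree k) +
    sigma a * Lyy pp * enorm (y k.+1 - yfree k)) <= (1 + theta a) * (l * w).
  rewrite ler_wpM2l //; apply: le_trans (lerD h1 h2) _.
  by rewrite -mulrDl ler_wpM2r.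
apply: le_trans (lerD (lexx _) h3) _.
by apply: ler_eq; rewrite /w /T /yhat2_err -/l; ring.
Qed.

Let z k := prev (yfree 0) yfree2 k.

Let z_err k : enorm (yfree k - z k) <=
  eta * (yhat2_err a pp * (prev 0 e k + prev 0 (prev 0 e) k)).
Proof.
have [_ _ [_ d3 _ _] _] := constants_ge0 pp_valid a_adm.
case: k => [|k]; last exact (y2_err k).
by rewrite /z /= subrr enorm0 addr0 !mulr0.
Qed.

Let sq_le k : e k ^+ 2 <= 2 * noise_sq k.
Proof.
rewrite /e /noise_sq; move: (enorm _) (enorm _) => u v.
by have := sqr_ge0 (u - v); lra.
Qed.

Let psq_le k : prev 0 e k ^+ 2 <= 2 * prev 0 noise_sq k.
Proof. by case: k => [|k] /=; rewrite ?expr0n ?mulr0. Qed.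

Let ppsq_le k : prev 0 (prev 0 e) k ^+ 2 <= 2 * prev 0 (prev 0 noise_sq) k.
Proof. by case: k => [|k] /=; rewrite ?expr0n ?mulr0. Qed.

Let noise_sq_ge0 k : 0 <= noise_sq k.
Proof. by rewrite addr_ge0 ?sqr_ge0. Qed.

(** By Young's inequality the inner product costs at most half of the energy and
    a multiple of the stored squares. *)
Lemma noisy_energy_ge k : path_energy k <= 2 * noisy_energy k.
Proof.
have [[_ _ _ _] [c1 _ _ _] [_ d3 d4 d5] [m2 m1]] := constants_ge0 pp_valid a_adm.
have [h1 _ _] := free_controls k.
set c := theta a / rho a; have c0 : 0 <= c := thr.
have pE : 0 <= prev 0 noise_sq k by case: (k) => [|j] /=.
have ppE : 0 <= prev 0 (prev 0 noise_sq) k by case: (k) => [|[|j]] /=.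
have hd : c * dot (prev 0 dy k) (z k - ys) <=
    path_energy k / 2 + eta * (delay_err a pp *
       (prev 0 e k + prev 0 (prev 0 e) k) ^+ 2).
  set p := prev 0 e k; set p' := prev 0 (prev 0 e) k.
  have p0 : 0 <= p by exact: pe0. have p'0 : 0 <= p' by exact: ppe0.
  have hz : enorm (z k - ys) <= yhat_cst a pp * S k + eta * (yhat2_err a pp * (p + p')).
    apply: le_trans (enorm_distD (yfree k) _ _) _; rewrite addrC lerD //.
    by rewrite enorm_distC; exact: z_err.
  have h2 : dot (prev 0 dy k) (z k - ys) <=
      p * (yhat_cst a pp * S k + eta * (yhat2_err a pp * (p + p'))).
    apply: le_trans (cauchy_schwarz _ _) _.
    by apply: ler_pM => //; rewrite ?enorm_ge0 //; exact: pdy_le.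
  apply: le_trans (ler_wpM2l c0 h2) _.
  have am : c * yhat_cst a pp * p * S k <=
      path_energy k / 2 + eta * ((c * yhat_cst a pp * p) ^+ 2 / 2).
    set u := c * _ * p; have := sqr_ge0 (S k - eta * u).
    rewrite sqrrB S2 -(pmulr_rge0 _ eta0) => hh.
    have {}hh : 0 <= eta ^+ 2 * (path_energy k / 2 + eta * (u ^+ 2 / 2) - u * S k).
      by move: hh; move: (path_energy k) => v; lra.
    by move: hh; rewrite pmulr_rge0 ?exprn_gt0 // subr_ge0.
  have pp2 : p ^+ 2 <= (p + p') ^+ 2.
    by rewrite ler_pXn2r // ?nnegrE ?addr_ge0 // lerDl.
  have ppp : p * (p + p') <= (p + p') ^+ 2.
    by rewrite expr2 ler_wpM2r ?addr_ge0 // lerDl.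
  have g1 : (c * yhat_cst a pp) ^+ 2 / 2 * p ^+ 2 <=
     (c * yhat_cst a pp) ^+ 2 / 2 * (p + p') ^+ 2.
    by rewrite ler_wpM2l // divr_ge0 // sqr_ge0.
  have g2 : c * yhat2_err a pp * (p * (p + p')) <=
     c * yhat2_err a pp * (p + p') ^+ 2 by rewrite ler_wpM2l // mulr_ge0.
  have g3 := ler_wpM2l (ltW eta0) (lerD g1 g2).
  rewrite /delay_err -/c.
  move: am g3; move: (path_energy k) (S k) (yhat_cst a pp) (yhat2_err a pp).
  by clearbody c p p' eta => v s cc dd; lra.
have hE : (prev 0 e k + prev 0 (prev 0 e) k) ^+ 2 <=
    4 * (prev 0 noise_sq k + prev 0 (prev 0 noise_sq) k).
  have := psq_le k; have := ppsq_le k.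
  have := sqr_ge0 (prev 0 e k - prev 0 (prev 0 e) k).
  by move: (prev 0 e k) (prev 0 (prev 0 e) k) => u v; lra.
have d44 : 4 * delay_err a pp <= memory2 a pp.
  by rewrite lerDr divr_ge0 ?mulr_ge0 // ltW.
have d41 : memory2 a pp <= memory1 a pp.
  rewrite /memory1 ler_pdivlMr //; apply: (@le_trans _ _ (memory2 a pp)).
    by rewrite ler_piMr // ltW.
  by rewrite lerDl mulr_ge0.
have k1 : delay_err a pp * (prev 0 e k + prev 0 (prev 0 e) k) ^+ 2 <=
   memory1 a pp * prev 0 noise_sq k + memory2 a pp * prev 0 (prev 0 noise_sq) k.
  apply: le_trans (ler_wpM2l d5 hE) _.
  have := ler_wpM2r pE (le_trans d44 d41); have := ler_wpM2r ppE d44.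
  by lra.
have := ler_wpM2l (ltW eta0) k1; rewrite /noisy_energy -/(z k) -/c -/eta.
by move: hd; lra.
Qed.

Lemma noisy_energy_ge0 k : 0 <= noisy_energy k.
Proof.
have := noisy_energy_ge k; have := path_energy_ge0 k; move: (path_energy k).
by move=> *; lra.
Qed.

Let path_energy_step k : path_energy k.+1 <= rho a * path_energy k
  + dot (dual_noise k) (y k.+1 - ys) - dot (dx k) (x k.+1 - xs).
Proof.
have [xd yd] := path_dom k.
apply: (energy_step a_adm Hpb saddle x0_dom y0_dom xd yd (path_increment k)).
  by have := proxgP pp_valid a_adm Hpb y0_dom _; rewrite y_step; apply.
by have := proxfP pp_valid a_adm Hpb x0_dom _; rewrite x_step; apply.
Qed.

Let step_arith (V V' r et m1 m2 st c th d1 d2 a3 a5 d4 d6 d7 n1 n2 n3 T2 : R) :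
  V' <= r * V + (a3 + a5 - th * d2 - th * d6) - (d4 + d7) ->
  a5 - th * d6 - d7 <= et * (st * T2) ->
  et * (st * T2) <= et * (st * (6 * (n1 + n2 + n3))) ->
  et * (6 * st * n3) <= et * (r * m2 * n3) ->
  r * m1 = m2 + 6 * st -> r * c = th ->
  V' - c * d1 + et * (m1 * n1 + m2 * n2)
  <= r * (V - c * d2 + et * (m1 * n2 + m2 * n3)) + (a3 - c * d1) + - d4
     + et * (m1 + 6 * st) * n1.
Proof.
move=> h1 h2 h3 h4 h5 h6.
have e1 : et * (r * m1) * n2 = et * (m2 + 6 * st) * n2 by rewrite h5.
have e2 : r * c * d2 = th * d2 by rewrite h6.
by lra.
Qed.

(** Both noises are paired with vectors that are known before the noise is
    drawn; replacing the actual iterates by these costs the quadratic terms.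
    The momentum makes the dual noise of an iteration act a second time in the
    next one: the inner product and the squares stored in [noisy_energy]
    transfer this second action to the iteration at which the noise is drawn. *)
Lemma noisy_energy_step k : noisy_energy k.+1 <= rho a * noisy_energy k
  + dot (dy k) (dual_drift k) + dot (dx k) (primal_drift k)
  + noise_cst a pp * noise_sq k.
Proof.
have [[_ _ l0 _] _ [d2 d3 d4 _] [m2 m1]] := constants_ge0 pp_valid a_adm.
have hV := path_energy_step k.
set p := prev 0 e k; set p' := prev 0 (prev 0 e) k; set T := e k + p + p'.
have p0 : 0 <= p by exact: pe0. have p'0 : 0 <= p' by exact: ppe0.
have ek0 := e0 k.
have T0 : 0 <= T := addr_ge0 (addr_ge0 ek0 p0) p'0.
have epT : e k + p <= T by rewrite lerDl.
have ppT : p + p' <= T by rewrite /T -addrA lerDr.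
have eT : e k <= T by rewrite /T -addrA lerDl addr_ge0.
have pT : p <= T by rewrite /T; lra.
have d1 : 0 <= 1 + theta a by rewrite addr_ge0.
have eta0' := ltW eta0.
have scale c u : 0 <= c -> u <= T -> eta * (c * u) <= eta * (c * T).
  by move=> c0 uT; rewrite ler_wpM2l // ler_wpM2l.
have w1 : momentum_weight k * dot (dy k) (y k.+1 - yfree k) <=
    eta * ((1 + theta a) ^+ 2 * T ^+ 2).
  apply: (@le_trans _ _ ((1 + theta a) * (T * (eta * ((1 + theta a) * T))))).
    have mw : 0 <= momentum_weight k <= 1 + theta a.
      by case: (k) => [|j]; rewrite /= ?d1 ?lexx // ler01 lerDl.
    have h : dot (dy k) (y k.+1 - yfree k) <= T * (eta * ((1 + theta a) * T)).
      apply: le_trans (cauchy_schwarz _ _) _; apply: ler_pM; rewrite ?enorm_ge0 //.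
        by apply: le_trans eT; rewrite lerDl enorm_ge0.
      by apply: le_trans (y_err k) _; exact: scale.
    apply: le_trans (ler_wpM2l (andP mw).1 h) _; apply: ler_wpM2r.
      by rewrite mulr_ge0 // mulr_ge0 // mulr_ge0.
    exact: (andP mw).2.
  by apply: ler_eq; ring.
have w2 : - (theta a * dot (prev 0 dy k) (y k.+1 - z k)) <=
    eta * (theta a * ((1 + theta a) + yhat2_err a pp) * T ^+ 2).
  have h : - dot (prev 0 dy k) (y k.+1 - z k) <=
      T * (eta * ((1 + theta a + yhat2_err a pp) * T)).
    rewrite -dotNl; apply: le_trans (cauchy_schwarz _ _) _; rewrite enormN.
    apply: ler_pM; rewrite ?enorm_ge0 //; first exact: le_trans (pdy_le k) pT.
    apply: le_trans (enorm_distD (yfree k) _ _) _.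
    have -> : eta * ((1 + theta a + yhat2_err a pp) * T) =
      eta * ((1 + theta a) * T) + eta * (yhat2_err a pp * T) by ring.
    apply: lerD.
      by apply: le_trans (y_err k) _; exact: scale.
    by apply: le_trans (z_err k) _; exact: scale.
  rewrite -mulrN; apply: le_trans (ler_wpM2l th0 h) _.
  by apply: ler_eq; ring.
have w3 : - dot (dx k) (x k.+1 - xfree k) <= eta * (xhat_err a pp * T ^+ 2).
  rewrite -dotNl; apply: le_trans (cauchy_schwarz _ _) _; rewrite enormN.
  apply: (@le_trans _ _ (T * (eta * (xhat_err a pp * T)))); last first.
    by apply: ler_eq; ring.
  apply: ler_pM; rewrite ?enorm_ge0 //.
    by apply: le_trans eT; rewrite lerDr enorm_ge0.
  by apply: le_trans (x_err k) _; exact: scale.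
have hT : T ^+ 2 <= 6 * (noise_sq k + prev 0 noise_sq k + prev 0 (prev 0 noise_sq) k).
  have := sq_le k; have := psq_le k; have := ppsq_le k; rewrite -/p -/p' /T.
  have := sqr_ge0 (e k - p); have := sqr_ge0 (e k - p'); have := sqr_ge0 (p - p').
  by lra.
have {}hT := ler_wpM2l d4 hT; have {}hT := ler_wpM2l eta0' hT.
have e1 : dot (dual_noise k) (y k.+1 - ys) =
    momentum_weight k * dot (dy k) (yfree k - ys)
    + momentum_weight k * dot (dy k) (y k.+1 - yfree k)
    - theta a * dot (prev 0 dy k) (z k - ys)
    - theta a * dot (prev 0 dy k) (y k.+1 - z k).
  have yk u : y k.+1 - ys = (u - ys) + (y k.+1 - u).
    by rewrite [RHS]addrC subrKA.
  by rewrite /dual_noise dotDl dotNl !dotZl {1}(yk (yfree k)) (yk (z k)) !dotDr; ring.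
have e2 : dot (dx k) (x k.+1 - xs) =
    dot (dx k) (xfree k - xs) + dot (dx k) (x k.+1 - xfree k).
  by rewrite -dotDr [X in _ = dot _ X]addrC subrKA.
have e3 : rho a * memory1 a pp = memory2 a pp + 6 * step_err a pp.
  by rewrite /memory1 mulrC divfK // gt_eqF.
have e4 : 6 * step_err a pp <= rho a * memory2 a pp.
  have -> : rho a * memory2 a pp = 6 * step_err a pp + rho a * (4 * delay_err a pp).
    rewrite /memory2; move: (step_err a pp) (delay_err a pp) => u v.
    by field; rewrite gt_eqF.
  rewrite lerDl.
  have [_ _ [_ _ _ d5] _] := constants_ge0 pp_valid a_adm.
  by rewrite mulr_ge0 ?(ltW r0) // mulr_ge0.
have e5 : rho a * (theta a / rho a) = theta a by rewrite mulrC divfK // gt_eqF.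
have ppE : 0 <= prev 0 (prev 0 noise_sq) k by case: (k) => [|[|j]] /=.
have {}e4 := ler_wpM2l eta0' (ler_wpM2r ppE e4).
have eU : noisy_energy k.+1 = path_energy k.+1
    - theta a / rho a * dot (dy k) (yfree2 k - ys)
    + eta * (memory1 a pp * noise_sq k + memory2 a pp * prev 0 noise_sq k) by [].
have eV : noisy_energy k = path_energy k
    - theta a / rho a * dot (prev 0 dy k) (z k - ys)
    + eta * (memory1 a pp * prev 0 noise_sq k
             + memory2 a pp * prev 0 (prev 0 noise_sq) k) by [].
have e8 : dot (dy k) (dual_drift k) = momentum_weight k * dot (dy k) (yfree k - ys)
    - theta a / rho a * dot (dy k) (yfree2 k - ys).
  rewrite /dual_drift.
  have dotBZ (w u v : 'rV[R]_n) (c d : R) :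
      dot w (c *: u - d *: v) = c * dot w u - d * dot w v.
    by rewrite dotDr dotNr !dotZr.
  exact (dotBZ _ _ _ _ _).
have e9 : dot (dx k) (primal_drift k) = - dot (dx k) (xfree k - xs).
  by rewrite /primal_drift; move: (xfree k - xs) => u; rewrite dotNr.
rewrite e1 e2 in hV; rewrite eU eV e8 e9 /noise_cst.
refine (step_arith _ hV _ hT e4 e3 e5).
apply: le_trans (lerD (lerD w1 w2) w3) _.
have st : step_err a pp = (1 + theta a) ^+ 2
    + theta a * ((1 + theta a) + yhat2_err a pp) + xhat_err a pp by [].
rewrite st; apply: ler_eq; move: (T ^+ 2) (xhat_err a pp) (yhat2_err a pp) => u v w.
by ring.
Qed.

(** The fluctuations that the noise causes are proportional to the energy, with a
    constant of the order of the step size. *)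
Lemma drift_le k :
  enorm (dual_drift k) ^+ 2 + enorm (primal_drift k) ^+ 2
  <= variance_cst a pp * noisy_energy k.
Proof.
have [_ [c1 c2 c3 c4] _ _] := constants_ge0 pp_valid a_adm.
have [h1 h2 h3] := free_controls k.
have h4 : enorm (dual_drift k) <= drift_cst a pp * S k.
  have hB (u v : 'rV[R]_n) (c d : R) :
      enorm (c *: u - d *: v) <= `|c| * enorm u + `|d| * enorm v.
    by apply: le_trans (enormB _ _) _; rewrite !enormZ.
  apply: le_trans (hB _ _ _ _) _; rewrite (ger0_norm thr).
  have -> : drift_cst a pp * S k = (1 + theta a) * (yhat_cst a pp * S k) +
      theta a / rho a * (yhat2_cst a pp * S k) by rewrite /drift_cst; ring.
  apply: lerD.
    apply: ler_pM; rewrite ?normr_ge0 ?enorm_ge0 //.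
    by case: (k) => [|j]; rewrite /= ger0_norm ?addr_ge0 ?lerDl.
  exact: ler_wpM2l.
have sq u c : 0 <= u -> u <= c * S k -> u ^+ 2 <= c ^+ 2 * (eta * path_energy k).
  move=> u0 uc; rewrite -S2 -exprMn ler_pXn2r // nnegrE //; exact: le_trans uc.
have g1 := sq _ _ (enorm_ge0 _) h4.
have g2 : enorm (primal_drift k) ^+ 2 <= xhat_cst a pp ^+ 2 * (eta * path_energy k).
  by rewrite enormN; exact (sq _ _ (enorm_ge0 _) h2).
apply: le_trans (lerD g1 g2) _; rewrite -mulrDl /variance_cst -/eta.
have hh : eta * path_energy k <= eta * (2 * noisy_energy k).
  by rewrite ler_pM2l // noisy_energy_ge.
have cc : 0 <= drift_cst a pp ^+ 2 + xhat_cst a pp ^+ 2 by rewrite addr_ge0 ?sqr_ge0.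
by apply: le_trans (ler_wpM2l cc hh) _; apply: ler_eq; ring.
Qed.

Lemma dist_le_noisy_energy k :
  (2 * tau a)^-1 * enorm (x k - xs) ^+ 2
  + (1 - alpha a * sigma a) / (2 * sigma a) * enorm (y k - ys) ^+ 2
  <= 2 * noisy_energy k.
Proof.
apply: le_trans (energy_ge_dist a_adm _ _ (path_increment k)) _.
apply: le_trans (noisy_energy_ge k); rewrite -/(path_energy k).
by rewrite -[leRHS]mul1r ler_wpM2r ?path_energy_ge0 // ltW.
Qed.

Lemma noisy_energy0 : noisy_energy 0 <=
  (1 + tau a * mux pp + sigma a * muy pp) *
  ((2 * tau a)^-1 * enorm (x 0 - xs) ^+ 2 + (2 * sigma a)^-1 * enorm (y 0 - ys) ^+ 2).
Proof.
have [[mx my] _ _ _ _] := pp_valid.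
rewrite /noisy_energy /path_energy /energy /= /momentum /= !subrr !dot0l !enorm0.
rewrite expr0n /= !(mulr0, addr0, subr0).
move: (enorm_ge0 (x 0 - xs)) (enorm_ge0 (y 0 - ys)).
move: (enorm (x 0 - xs)) (enorm (y 0 - ys)) => X Y X0 Y0; move: t0 s0 => t0' s0'.
have h1 : 0 <= sigma a * muy pp * ((2 * tau a)^-1 * X ^+ 2).
  by rewrite !mulr_ge0 ?sqr_ge0 ?invr_ge0 ?mulr_ge0 // ltW.
have h2 : 0 <= tau a * mux pp * ((2 * sigma a)^-1 * Y ^+ 2).
  by rewrite !mulr_ge0 ?sqr_ge0 ?invr_ge0 ?mulr_ge0 // ltW.
have -> : ((tau a)^-1 + mux pp) / 2 * X ^+ 2 =
    (1 + tau a * mux pp) * ((2 * tau a)^-1 * X ^+ 2) by field; rewrite gt_eqF.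
have -> : ((sigma a)^-1 + muy pp) / 2 * Y ^+ 2 =
    (1 + sigma a * muy pp) * ((2 * sigma a)^-1 * Y ^+ 2) by field; rewrite gt_eqF.
by lra.
Qed.

End noisy_path.

(** * Weighted integrals over a sub-sigma-algebra *)

Section sub_sigma_algebra.
Context {d : measure_display} {T : measurableType d} {R : realType}.
Variables (P : probability T R) (G : set (set T)).
Hypothesis G_meas : G `<=` @measurable _ T.

Let F := <<s G >>.

Lemma sub_measurable A : F A -> measurable A.
Proof.
apply: smallest_sub => //; split; [exact: measurable0 | | exact: bigcupT_measurable].
by move=> B mB; exact: measurableD.
Qed.

Lemma measurable_wrtP (X : T -> R) : measurable_wrt F X <->
  measurable_fun [set: g_sigma_algebraType G] (X : g_sigma_algebraType G -> R).
Proof.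
split=> h; first by move=> _ B mB; rewrite setTI; exact: h.
by move=> B mB; have := h measurableT B mB; rewrite setTI.
Qed.

Lemma measurable_wrt_fun (X : T -> R) : measurable_wrt F X -> measurable_fun [set: T] X.
Proof. by move=> h _ B mB; rewrite setTI; apply: sub_measurable; exact: h. Qed.

Local Open Scope ereal_scope.
Import HBNNSimple.

Lemma integral_nnsfun_weight (h : {nnsfun g_sigma_algebraType G >-> R}) (Y : T -> R) :
  measurable_fun [set: T] Y -> (forall w, 0 <= Y w)%R ->
  \int[P]_w (h w * Y w)%:E =
  \sum_(r \in range h) (r%:E * \int[P]_(w in h @^-1` [set r]) (Y w)%:E).
Proof.
move=> mY Y0; have mh r : measurable (h @^-1` [set r] : set T).
  by apply: sub_measurable; exact: (measurable_sfunP h (measurable_set1 r)).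
have mYe : measurable_fun [set: T] (fun w => (Y w)%:E).
  exact/measurable_EFinP.
have r0 r : range h r -> (0 <= r)%R by move=> [w _ <-]; exact: fun_ge0.
transitivity (\int[P]_w (\sum_(r \in range h)
    (r * \1_(h @^-1` [set r]) w)%:E * (Y w)%:E)).
  apply: eq_integral => w _.
  rewrite -ge0_mule_fsuml => [|r]; last exact: nnfun_muleindic_ge0.
  by rewrite fsumEFin // -fimfunE EFinM.
have mi r : measurable_fun [set: T] (fun w => (r * \1_(h @^-1` [set r]) w)%:E).
  by apply/measurable_EFinP; apply: measurable_funM => //; exact: measurable_indic.
rewrite ge0_integral_fsum //; last 2 first.
  - by move=> r; exact: emeasurable_funM.
  - by move=> r w _; rewrite mule_ge0 ?lee_fin // -lee_fin EFinM nnfun_muleindic_ge0.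
apply: eq_fsbigr => r /[!inE] /r0 r_ge0.
under eq_integral do rewrite EFinM -muleA.
rewrite ge0_integralZl //.
- congr (_ * _); rewrite [RHS]integral_mkcond; apply: eq_integral => w _.
  by rewrite epatch_indic muleC.
- by apply: emeasurable_funM => //; apply/measurable_EFinP; exact: measurable_indic.
- by move=> w _; rewrite mule_ge0 // lee_fin.
Qed.

(** Inequalities between the integrals over the events of a sub-sigma-algebra
    are inequalities between conditional expectations: they persist under every
    nonnegative weight that is measurable for it. This lemma replaces the
    calculus of conditional expectations throughout. *)
Lemma le_integral_weight (Y Z W : T -> R) :
  measurable_fun [set: T] Y -> (forall w, 0 <= Y w)%R ->
  measurable_fun [set: T] Z -> (forall w, 0 <= Z w)%R ->
  (forall A, F A -> \int[P]_(w in A) (Y w)%:E <= \int[P]_(w in A) (Z w)%:E) ->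
  measurable_wrt F W -> (forall w, (0 <= W w)%R) ->
  \int[P]_w (W w * Y w)%:E <= \int[P]_w (W w * Z w)%:E.
Proof.
move=> mY Y0 mZ Z0 YZ /measurable_wrtP mW W0.
have mWe : measurable_fun [set: g_sigma_algebraType G]
    (fun w : g_sigma_algebraType G => (W w)%:E) by exact/measurable_EFinP.
pose h := nnsfun_approx measurableT mWe.
have mhn k : measurable_fun [set: T] (h k : T -> R).
  by apply: measurable_wrt_fun; apply/measurable_wrtP; exact: measurable_funPT.
have lim_weight (X : T -> R) : measurable_fun [set: T] X -> (forall w, 0 <= X w)%R ->
    \int[P]_w (h k w * X w)%:E @[k --> \oo] --> \int[P]_w (W w * X w)%:E.
  move=> mX X0.
  have -> : \int[P]_w (W w * X w)%:E =
      \int[P]_w (lim ((h k w * X w)%:E @[k --> \oo])).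
    apply: eq_integral => w _; apply/esym/cvg_lim => //.
    under eq_fun do rewrite EFinM.
    rewrite EFinM; apply: cvgeZr => //.
    apply: (@cvg_nnsfun_approx _ (g_sigma_algebraType G) R setT measurableT
      (fun w => (W w)%:E) mWe) => //.
    by move=> x _; rewrite lee_fin.
  apply: cvg_monotone_convergence => //.
  - by move=> k; apply/measurable_EFinP; exact: measurable_funM.
  - by move=> k w _; rewrite lee_fin mulr_ge0.
  - move=> w _ i j ij; rewrite lee_fin ler_wpM2r //.
    by apply/lefP; exact: (nd_nnsfun_approx measurableT mWe ij).
have hY := lim_weight _ mY Y0; have hZ := lim_weight _ mZ Z0.
rewrite -(cvg_lim _ hY) // -(cvg_lim _ hZ) //.
apply: lee_lim; [exact: cvgP hY | exact: cvgP hZ | apply: nearW => k].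
rewrite !integral_nnsfun_weight //; apply: lee_fsum; first exact: fimfunP.
move=> r [w _ <-]; apply: lee_wpmul2l; first by rewrite lee_fin fun_ge0.
by apply: YZ; exact: (measurable_sfunP (h k) (measurable_set1 _)).
Qed.

End sub_sigma_algebra.

(** * Conditional exponential moments of the noise *)

(** The linear term vanishes in the mean of a centred variable, which leaves a
    bound of second order. *)
Lemma expR_le_sq {R : realType} (x : R) : expR x <= x + expR (2 * x ^+ 2).
Proof.
have h2 := expR_ge1Dx (2 * x ^+ 2).
have [x0|x0] := leP x 0.
  have : expR x <= 1 + x + 2 * x ^+ 2; last by lra.
  have e0 : 0 < expR (- x) by exact: expR_gt0.
  have h : expR x * expR (- x) = 1 by rewrite -expRD subrr expR0.
  have := expR_ge1Dx (- x); have := expR_gt0 x.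
  move: (expR x) (expR (- x)) h e0 => a b h b0 a0 h1.
  rewrite -(ler_pM2r b0) h.
  have e1 : (1 - x) * (1 + x + 2 * x ^+ 2) - 1 = x ^+ 2 * (1 - 2 * x) by ring.
  have e2 : 0 <= x ^+ 2 * (1 - 2 * x) by rewrite mulr_ge0 ?sqr_ge0 //; lra.
  have e3 : 0 <= 1 + x + 2 * x ^+ 2 by have := sqr_ge0 (x + 1 / 4); lra.
  by nra.
have [x1|x1] := leP x 1; last first.
  have : expR x <= expR (2 * x ^+ 2) by rewrite ler_expR; nra.
  by lra.
have : expR x <= 1 + x + 2 * x ^+ 2; last by lra.
have h : expR (x / 2) * expR (- (x / 2)) = 1 by rewrite -expRD subrr expR0.
have h' : expR x = expR (x / 2) ^+ 2 by rewrite -expRM_natr; congr expR; lra.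
have := expR_ge1Dx (- (x / 2)); have := expR_gt0 (x / 2).
rewrite h'; move: (expR (x / 2)) (expR (- (x / 2))) h => a b h a0 h1 {h'}.
have h3 : (a * (1 - x / 2)) ^+ 2 <= 1.
  by rewrite exprn_ile1 //; [rewrite mulr_ge0 ?ltW //; lra | nra].
have p0 : 0 < (1 - x / 2) ^+ 2 by rewrite exprn_gt0 //; lra.
rewrite -(ler_pM2r p0) -exprMn; apply: le_trans h3 _.
have e1 : (1 + x + 2 * x ^+ 2) * (1 - x / 2) ^+ 2 - 1 =
  x ^+ 2 / 2 * ((1 - x) * (5 / 2 - x)) by field.
have e2 : 0 <= x ^+ 2 / 2 * ((1 - x) * (5 / 2 - x)).
  by rewrite mulr_ge0 ?divr_ge0 ?sqr_ge0 // mulr_ge0; lra.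
by lra.
Qed.

(** Absorbs in the exponent the factor 8 that [geometric_tail_sum] produces. *)
Lemma expR_bernoulli {R : realType} (a : R) : 0 <= a ->
  expR a + 8 * (expR a - 1) <= expR (9 * a).
Proof.
move=> a0; have u1 : 1 <= expR a by rewrite -expR0 ler_expR.
rewrite [9 * a]mulrC expRM_natr; move: (expR a) u1 => u u1.
have bern n : 1 + n%:R * (u - 1) <= u ^+ n.
  elim: n => [|n ih]; first by rewrite mul0r addr0.
  rewrite exprS -natr1; have : u * (1 + n%:R * (u - 1)) <= u * u ^+ n.
    by rewrite ler_wpM2l //; lra.
  apply: le_trans; rewrite -subr_ge0.
  have -> : u * (1 + n%:R * (u - 1)) - (1 + (n%:R + 1) * (u - 1)) =
    n%:R * (u - 1) ^+ 2 by ring.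
  by rewrite mulr_ge0 // sqr_ge0.
by have := bern 9%N; lra.
Qed.

Lemma geometric_tail_sum {R : realType} (n : nat) :
  \sum_(0 <= i < n) 2 * expR (- (1 / 4)) ^+ i.+1 <= 8 :> R.
Proof.
set z : R := expR (- (1 / 4)); have z0 : 0 < z by exact: expR_gt0.
have z1 : z <= 4 / 5.
  have := expR_ge1Dx (1 / 4 : R).
  have : z * expR (1 / 4) = 1 by rewrite -expRD addNr expR0.
  by move: (expR _) => e; nra.
have := @geometric_le_lim R n (2 * z) z.
rewrite (ger0_norm (ltW z0)) => /(_ _ z0) h.
have -> : \sum_(0 <= i < n) 2 * z ^+ i.+1 = series (geometric (2 * z) z) n.
  by apply: eq_bigr => i _; rewrite /= exprS mulrA.
apply: le_trans (h _ _) _; first by rewrite mulr_ge0 // ltW.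
  by lra.
by rewrite ler_pdivrMr; lra.
Qed.

(** At level [n + 1] the tail is [2 * expR (- (n + 1) / 2)], which beats the
    growth of the layer by a geometric factor as long as [a <= 1 / 4]. *)
Lemma layer_tail {R : realType} (a delta : R) (n : nat) : 0 < delta -> 0 <= a <= 1 / 4 ->
  (expR a - 1) * expR (a * n.+1%:R) *
    (2 * expR (- (delta * Num.sqrt n.+1%:R) ^+ 2 / (2 * delta ^+ 2)))
  <= 2 * expR (- (1 / 4)) ^+ n.+1 * (expR a - 1).
Proof.
move=> d0 /andP[a0 a1].
have -> : - (delta * Num.sqrt n.+1%:R) ^+ 2 / (2 * delta ^+ 2) = - (n.+1%:R / 2).
  by rewrite exprMn sqr_sqrtr //; field; rewrite gt_eqF.
rewrite -expRM_natr.
have -> : (expR a - 1) * expR (a * n.+1%:R) * (2 * expR (- (n.+1%:R / 2))) =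
   2 * expR (a * n.+1%:R - n.+1%:R / 2) * (expR a - 1).
  by rewrite expRD; ring.
apply: ler_wpM2r; first by rewrite subr_ge0 -expR0 ler_expR.
rewrite ler_wpM2l // ler_expR; have : 0 <= (n.+1%:R : R) by [].
by move: (n.+1%:R) => x x0; nra.
Qed.

Lemma exponent_small {R : realType} (q : R) : 0 <= q -> 9 * (2 * q) <= 19 * q.
Proof. lra. Qed.

Lemma exponent_quarter {R : realType} (q : R) : q <= 1 / 8 -> 2 * q <= 1 / 4.
Proof. lra. Qed.

Lemma exponent_large {R : realType} (q : R) : 1 / 8 < q -> q + 9 * (1 / 4) <= 19 * q.
Proof. lra. Qed.

Lemma exponent_half {R : realType} (c e : R) : 8 * c * e <= 1 -> 2 * c * e <= 1 / 4.
Proof. lra. Qed.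

Lemma expR_half {R : realType} (x y : R) :
  expR (x + y) <= 2^-1 * (expR (2 * x) + expR (2 * y)).
Proof.
rewrite expRD ![2 * _]mulrC !expRM_natr.
by have := sqr_ge0 (expR x - expR y); lra.
Qed.

Lemma expR_avg {R : realType} (q c e : R) : 0 <= q -> 0 <= c * e ->
  2^-1 * (expR (76 * q) + expR (9 * (2 * c * e))) <= expR (76 * q + 18 * c * e).
Proof.
move=> q0 ce0.
have h1 : expR (76 * q) <= expR (76 * q + 18 * c * e) by rewrite ler_expR; lra.
have h2 : expR (9 * (2 * c * e)) <= expR (76 * q + 18 * c * e) by rewrite ler_expR; lra.
by lra.
Qed.

Section conditional_mgf.
Context {d : measure_display} {T : measurableType d} {R : realType}.
Variables (P : probability T R) (G : set (set T)).
Hypothesis G_meas : G `<=` @measurable _ T.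

Let F := <<s G >>.
Let Fm (A : set T) : F A -> measurable A. Proof. exact: sub_measurable. Qed.

Lemma measurable_wrt_indic A : F A -> measurable_wrt F (\1_A : T -> R).
Proof.
by move=> FA; apply/measurable_wrtP; exact: (@measurable_indic _ (g_sigma_algebraType G)).
Qed.

Local Open Scope ereal_scope.

Lemma integral_indic_weight (A : set T) (f : T -> R) :
  \int[P]_(w in A) (f w)%:E = \int[P]_w (\1_A w * f w)%:E.
Proof.
rewrite integral_mkcond; apply: eq_integral => w _.
by rewrite epatch_indic /= muleC EFinM.
Qed.

Section centered.
Variable X : T -> R.
Hypothesis X0 : is_condexp P F X (cst 0%R).

Let iX : P.-integrable setT (EFin \o X). Proof. by case: X0. Qed.
Let mX : measurable_fun [set: T] X.
Proof. by apply/measurable_EFinP; exact: measurable_int iX. Qed.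
Let intX A : F A -> \int[P]_(w in A) (X w)%:E = 0.
Proof. by move=> FA; case: X0 => _ _ _ ->//; rewrite integral0. Qed.

Let pos w := Num.max (X w) 0%R.
Let neg w := Num.max (- X w)%R 0%R.
Let pos_ge0 w : (0 <= pos w)%R. Proof. by rewrite le_max lexx orbT. Qed.
Let neg_ge0 w : (0 <= neg w)%R. Proof. by rewrite le_max lexx orbT. Qed.
Let mpos : measurable_fun [set: T] pos.
Proof. exact: measurable_maxr. Qed.
Let mneg : measurable_fun [set: T] neg.
Proof. by apply: measurable_maxr => //; exact: measurableT_comp. Qed.

(** For the positive and the negative part of [X] the hypothesis is an equality of
    integrals over the events of [F], to which [le_integral_weight] applies in
    both directions; a bounded signed weight is a difference of nonnegative ones. *)
Lemma centered_weight (v : T -> R) (K : R) : measurable_wrt F v ->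
  (forall w, `|v w| <= K)%R ->
  P.-integrable setT (fun w => (v w * X w)%:E) /\ \int[P]_w (v w * X w)%:E = 0.
Proof.
have key u K' : measurable_wrt F u -> (forall w, 0 <= u w <= K')%R ->
    P.-integrable setT (fun w => (u w * X w)%:E) /\ \int[P]_w (u w * X w)%:E = 0.
  move=> mu uK; have u0 w : (0 <= u w)%R by have /andP[] := uK w.
  have mu' := measurable_wrt_fun G_meas mu.
  have iuX : P.-integrable setT (fun w => (u w * X w)%:E).
    have -> : (fun w => (u w * X w)%:E) = (EFin \o u) \* (EFin \o X) by [].
    apply: integrableMr => //.
    exists K'; split; first exact: num_real.
    move=> M KM w _; rewrite /= ger0_norm //; have /andP[_ uK'] := uK w.
    exact: ltW (le_lt_trans uK' KM).
  split=> //.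
  have e1 : (fun w => (u w * X w)%:E)^\+ = (fun w => (u w * pos w)%:E).
    apply/funext => w; rewrite funeposE /= -EFin_max; congr EFin.
    by rewrite /pos maxr_pMr // mulr0.
  have e2 : (fun w => (u w * X w)%:E)^\- = (fun w => (u w * neg w)%:E).
    apply/funext => w; rewrite funenegE /= -EFin_max; congr EFin.
    by rewrite /neg maxr_pMr // mulr0 mulrN.
  have i1 A : F A -> \int[P]_(w in A) (pos w)%:E = \int[P]_(w in A) (neg w)%:E.
    move=> FA; have := intX FA; rewrite integralE.
    have iA : P.-integrable A (EFin \o X).
      exact: (integrableS measurableT (Fm FA) (subsetT _) iX).
    have -> : (EFin \o X)^\+ = (fun w => (pos w)%:E).
      by apply/funext => w; rewrite funeposE /= -EFin_max.
    have -> : (EFin \o X)^\- = (fun w => (neg w)%:E).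
      by apply/funext => w; rewrite funenegE /= -EFin_max.
    have := integrable_pos_fin_num (Fm FA) iA.
    have -> : (EFin \o X)^\+ = (fun w => (pos w)%:E).
      by apply/funext => w; rewrite funeposE /= -EFin_max.
    by move=> hf /eqP; rewrite sube_eq ?add0e; [move/eqP | | rewrite fin_num_adde_defr].
  rewrite integralE e1 e2.
  have -> : \int[P]_w (u w * pos w)%:E = \int[P]_w (u w * neg w)%:E.
    apply/eqP; rewrite eq_le; apply/andP; split.
      by apply: (le_integral_weight G_meas) => // A FA; rewrite i1.
    by apply: (le_integral_weight G_meas) => // A FA; rewrite i1.
  apply: subee; rewrite -e2; exact: integrable_neg_fin_num.
move=> mv vK; have mv' := measurable_wrt_fun G_meas mv.
have K0 (w : T) : (0 <= K)%R by exact: le_trans (normr_ge0 _) (vK w).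
have [||iu u0] := key (fun w => v w + K)%R (K + K)%R.
- apply/measurable_wrtP; apply: measurable_funD => //; exact/measurable_wrtP.
- move=> w; have := vK w; rewrite ler_norml => /andP[? ?].
  by rewrite lerD2r -lerBlDr sub0r; apply/andP.
have [||ic c0] := key (cst K) K.
- by apply/measurable_wrtP; exact: measurable_cst.
- by move=> w; rewrite /= lexx (K0 w).
have e w : (v w * X w)%:E = ((v w + K) * X w)%:E - (K * X w)%:E.
  by rewrite -EFinB; congr EFin; rewrite mulrDl addrK.
split.
  by under eq_fun do rewrite e; exact: integrableB.
transitivity (\int[P]_w (((v w + K) * X w)%:E - (K * X w)%:E)).
  by apply: eq_integral => w _; rewrite e.
by rewrite integralB // u0 c0 subee.
Qed.

End centered.

Lemma cond_tail_weight (B : set T) (c : R) (W : T -> R) : (0 <= c)%R ->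
  condprob_le P F B c -> measurable_wrt F W -> (forall w, 0 <= W w)%R ->
  measurable B /\ \int[P]_w (W w * \1_B w)%:E <= \int[P]_w (W w * c)%:E.
Proof.
move=> c0 [Z [[iB iZ mZ hZ] Zc]] mW W0.
have mI : measurable_fun [set: T] (\1_B : T -> R).
  by apply/measurable_EFinP; exact: measurable_int iB.
split; first exact/(measurable_indicP R B).
apply: (le_integral_weight G_meas) => // A FA; have mA := Fm FA.
rewrite (hZ _ FA).
have mZ' := measurable_wrt_fun G_meas mZ.
apply: (@le_trans _ _ (\int[P]_(w in A) (Num.max (Z w) 0%R)%:E)).
  have iZA := integrableS measurableT mA (subsetT _) iZ.
  apply: le_integral => //.
    have := integrable_funepos mA iZA; apply: eq_integrable => // w _.
    by rewrite funeposE -EFin_max.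
  by move=> w _; rewrite lee_fin le_max lexx.
apply: ae_ge0_le_integral => //.
- by move=> w _; rewrite lee_fin le_max lexx orbT.
- apply/measurable_EFinP; apply: measurable_funS (subsetT _) _ => //.
  exact: measurable_maxr.
- by apply: filterS Zc => w Zw _; rewrite lee_fin ge_max Zw.
Qed.

(** [f] may have an infinite integral a priori, so the negative part of [L] is
    moved to the left-hand side instead of subtracting integrals. *)
Lemma le_integral_centered (f L M : T -> R) :
  measurable_fun [set: T] f -> (forall w, 0 <= f w)%R ->
  measurable_fun [set: T] M -> (forall w, 0 <= M w)%R ->
  P.-integrable setT (fun w => (L w)%:E) -> \int[P]_w (L w)%:E = 0 ->
  (forall w, f w <= L w + M w)%R ->
  \int[P]_w (f w)%:E <= \int[P]_w (M w)%:E.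
Proof.
move=> mf f0 mM M0 iL L0 fLM.
have mL : measurable_fun [set: T] L by apply/measurable_EFinP; exact: measurable_int iL.
pose p w := Num.max (L w) 0%R; pose q w := Num.max (- L w)%R 0%R.
have mp : measurable_fun [set: T] (fun w => (p w)%:E).
  by apply/measurable_EFinP; exact: measurable_maxr.
have mq : measurable_fun [set: T] (fun w => (q w)%:E).
  by apply/measurable_EFinP; apply: measurable_maxr => //; exact: measurableT_comp.
have p0 w : [set: T] w -> 0 <= (p w)%:E by move=> _; rewrite lee_fin le_max lexx orbT.
have q0 w : [set: T] w -> 0 <= (q w)%:E by move=> _; rewrite lee_fin le_max lexx orbT.
have f0' w : [set: T] w -> 0 <= (f w)%:E by move=> _; rewrite lee_fin.
have M0' w : [set: T] w -> 0 <= (M w)%:E by move=> _; rewrite lee_fin.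
have mf' : measurable_fun [set: T] (fun w => (f w)%:E) by exact/measurable_EFinP.
have mM' : measurable_fun [set: T] (fun w => (M w)%:E) by exact/measurable_EFinP.
have ep : (fun w => (L w)%:E)^\+ = (fun w => (p w)%:E).
  by apply/funext => w; rewrite funeposE /= -EFin_max.
have eq' : (fun w => (L w)%:E)^\- = (fun w => (q w)%:E).
  by apply/funext => w; rewrite funenegE /= -EFin_max.
have qf : \int[P]_w (q w)%:E \is a fin_num.
  by rewrite -eq'; exact: integrable_neg_fin_num.
have pq : \int[P]_w (p w)%:E = \int[P]_w (q w)%:E.
  by move: L0; rewrite integralE ep eq' => h; rewrite -[LHS](subeK _ qf) h add0e.
rewrite -(leeD2rE _ _ qf) -ge0_integralD //.
rewrite -[X in _ <= _ + X]pq -ge0_integralD //.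
apply: ge0_le_integral => //.
- by move=> w _; rewrite adde_ge0 // ?f0' ?q0.
- exact: emeasurable_funD.
- exact: emeasurable_funD.
- move=> w _; rewrite -!EFinD lee_fin /p /q; have := fLM w.
  case: (leP (L w) 0%R) => l0 h.
    by rewrite max_l ?oppr_ge0 // addr0 lerBlDl.
  by rewrite max_r ?oppr_le0 ?(ltW l0) // addr0 [leRHS]addrC.
Qed.

Section subgaussian.
Variables (k : nat) (xi : T -> 'rV[R]_k) (delta : R).
Hypotheses (delta0 : (0 < delta)%R) (xi_centered : condexp_eq0 P F xi).
Hypothesis xi_tail : forall t : R, (0 <= t)%R ->
  condprob_le P F [set w | (t <= enorm (xi w))%R]
    (2 * expR (- t ^+ 2 / (2 * delta ^+ 2))).

Lemma measurable_centered i : measurable_fun [set: T] (fun w => xi w 0%R i).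
Proof.
by have [iX _ _ _] := xi_centered i; apply/measurable_EFinP; exact: measurable_int iX.
Qed.

Lemma measurable_noise_dot (u : T -> 'rV[R]_k) :
  (forall i, measurable_fun [set: T] (fun w => u w 0%R i)) ->
  measurable_fun [set: T] (fun w => dot (u w) (xi w)).
Proof.
move=> mu; apply: measurable_sum => i; apply: measurable_funM; first exact: mu.
exact: measurable_centered.
Qed.

Lemma measurable_noise_sq : measurable_fun [set: T] (fun w => enorm (xi w) ^+ 2)%R.
Proof.
under eq_fun do rewrite enorm_sqr; apply: measurable_noise_dot.
exact: measurable_centered.
Qed.

Let layer (a : R) (n : nat) : R := ((expR a - 1) * expR (a * n.+1%:R))%R.
Let level n : set T := [set w | (delta * Num.sqrt n.+1%:R <= enorm (xi w))%R].

Let layer_ge0 a n : (0 <= a -> 0 <= layer a n)%R.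
Proof.
by move=> a0; rewrite mulr_ge0 ?expR_ge0 // subr_ge0 -expR0 ler_expR.
Qed.

Let layer_sum a n : (\sum_(0 <= i < n) layer a i = expR (a * n.+1%:R) - expR a)%R.
Proof.
elim: n => [|n ih]; first by rewrite big_nil mulr1 subrr.
rewrite big_nat_recr //= ih /layer.
have -> : expR (a * n.+2%:R) = (expR a * expR (a * n.+1%:R))%R.
  by rewrite -expRD [X in (_ * X)%R]mulrSr mulrDr mulr1 addrC.
by move: (expR a) (expR _) => x y; ring.
Qed.

(** Discrete layer-cake bound: a sum over the levels reached by the norm. *)
Let layer_cake (kap W : R) w : (0 <= kap)%R -> (0 <= W)%R ->
  (W * expR (kap * enorm (xi w) ^+ 2))%:E <=
  (W * expR (kap * delta ^+ 2))%:E +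
  \sum_(n <oo) (W * layer (kap * delta ^+ 2) n * \1_(level n) w)%:E.
Proof.
move=> kap0 W0; set a := (kap * delta ^+ 2)%R.
have a0 : (0 <= a)%R by rewrite mulr_ge0 // sqr_ge0.
have d2 : (0 < delta ^+ 2)%R by rewrite exprn_gt0.
set z := (enorm (xi w) ^+ 2 / delta ^+ 2)%R.
have z0 : (0 <= z)%R by rewrite divr_ge0 // sqr_ge0.
have /andP[Nz zN] := truncn_itv z0; set N := Num.truncn z in Nz zN.
have t0 n : 0 <= (W * layer a n * \1_(level n) w)%:E.
  by rewrite lee_fin mulr_ge0 // mulr_ge0 // layer_ge0.
apply: (@le_trans _ _ ((W * expR a)%:E +
    \sum_(0 <= n < N) (W * layer a n * \1_(level n) w)%:E)); last first.
  by rewrite leeD2l //; apply: nneseries_lim_ge => n _ _; exact: t0.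
have -> : \sum_(0 <= n < N) (W * layer a n * \1_(level n) w)%:E =
    (W * (expR (a * N.+1%:R) - expR a))%:E.
  rewrite -layer_sum mulr_sumr sumEFin; congr EFin; apply: eq_big_nat => n /andP[_ nN].
  rewrite indicE mem_set ?mulr1 // /level /=.
  rewrite -(@ler_pXn2r _ 2) ?nnegrE ?enorm_ge0 ?mulr_ge0 ?sqrtr_ge0 ?(ltW delta0) //.
  rewrite exprMn sqr_sqrtr // [leLHS]mulrC -ler_pdivlMr //; apply: le_trans Nz.
  by rewrite ler_nat.
rewrite -EFinD lee_fin -mulrDr addrC subrK ler_wpM2l // ler_expR.
have -> : (kap * enorm (xi w) ^+ 2 = a * z)%R.
  by rewrite /a /z [RHS]mulrACA divff ?mulr1 ?gt_eqF.
by rewrite ler_wpM2l // ltW.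
Qed.

(** The layer-cake bound is integrated level by level, with the conditional tail
    in place of the indicators. The exponent [kap] may depend on the past: the
    linear case below chooses it according to the size of [u]. *)
Lemma subgaussian_sq_mgf (kap W : T -> R) :
  measurable_wrt F kap -> (forall w, 0 <= kap w * delta ^+ 2 <= 1 / 4)%R ->
  measurable_wrt F W -> (forall w, 0 <= W w)%R ->
  \int[P]_w (W w * expR (kap w * enorm (xi w) ^+ 2))%:E <=
  \int[P]_w (W w * expR (9 * (kap w * delta ^+ 2)))%:E.
Proof.
move=> mkap kapP mW W0.
have d2 : (0 < delta ^+ 2)%R by rewrite exprn_gt0.
pose a w := (kap w * delta ^+ 2)%R.
have a0 w : (0 <= a w)%R by have /andP[] := kapP w.
have kap0 w : (0 <= kap w)%R by have := a0 w; rewrite /a pmulr_lge0.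
have mWT := measurable_wrt_fun G_meas mW.
have mkT := measurable_wrt_fun G_meas mkap.
have ma : measurable_fun [set: T] a by exact: measurable_funM.
have mea : measurable_fun [set: T] (fun w => expR (a w)) by exact: measurableT_comp.
have ea0 w : (0 <= expR (a w) - 1)%R by rewrite subr_ge0 -expR0 ler_expR.
have mwl n : measurable_wrt F (fun w => W w * layer (a w) n)%R.
  move/measurable_wrtP : mW => mW; move/measurable_wrtP : mkap => mkap.
  have mF : measurable_fun [set: g_sigma_algebraType G] a by exact: measurable_funM.
  have mFe : measurable_fun [set: g_sigma_algebraType G] (fun w => expR (a w)).
    exact: measurableT_comp.
  have mFn : measurable_fun [set: g_sigma_algebraType G] (fun w => expR (a w * n.+1%:R))%R.
    by apply: measurableT_comp => //; exact: measurable_funM.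
  apply/measurable_wrtP; apply: measurable_funM => //; apply: measurable_funM => //.
  exact: measurable_funB.
have wl0 n w : (0 <= W w * layer (a w) n)%R by rewrite mulr_ge0 // layer_ge0.
have tl n := cond_tail_weight (mulr_ge0 (ler0n R 2) (expR_ge0 _))
  (xi_tail (mulr_ge0 (ltW delta0) (sqrtr_ge0 n.+1%:R))) (mwl n) (wl0 n).
have mlev n : measurable (level n) by have [] := tl n.
pose f n w := (W w * layer (a w) n * \1_(level n) w)%:E.
have f0 n w : 0 <= f n w by rewrite lee_fin mulr_ge0.
have mf n : measurable_fun [set: T] (f n).
  apply/measurable_EFinP; apply: measurable_funM; last exact: measurable_indic.
  exact: measurable_wrt_fun (mwl n).
pose J := \int[P]_w (W w * (expR (a w) - 1))%:E.
have J0 : 0 <= J by apply: integral_ge0 => w _; rewrite lee_fin mulr_ge0.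
have hJ0 w : [set: T] w -> 0 <= (W w * (expR (a w) - 1))%:E.
  by move=> _; rewrite lee_fin mulr_ge0.
have mJ : measurable_fun [set: T] (fun w => (W w * (expR (a w) - 1))%:E).
  by apply/measurable_EFinP; apply: measurable_funM => //; exact: measurable_funB.
have hf n : \int[P]_w f n w <= (2 * expR (- (1 / 4)) ^+ n.+1)%:E * J.
  have [_ h] := tl n; apply: le_trans h _.
  have k0 : 0 <= (2 * expR (- (1 / 4)) ^+ n.+1 : R)%:E.
    by rewrite lee_fin mulr_ge0 // exprn_ge0 // expR_ge0.
  rewrite -ge0_integralZl //.
  apply: ge0_le_integral => //.
  - by move=> w _; rewrite lee_fin mulr_ge0 // mulr_ge0 // expR_ge0.
  - apply/measurable_EFinP; apply: measurable_funM => //.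
    exact: measurable_wrt_fun (mwl n).
  - by apply: measurable_funeM.
  - move=> w _; rewrite -EFinM lee_fin -mulrA [leRHS]mulrCA ler_wpM2l //.
    by apply: layer_tail => //; exact: kapP.
have hsum : \sum_(n <oo) \int[P]_w f n w <= 8%:E * J.
  apply: (@le_trans _ _ (\sum_(n <oo) ((2 * expR (- (1 / 4)) ^+ n.+1)%:E * J))).
    by apply: lee_nneseries => [n _ _|n _]; [exact: integral_ge0 | exact: hf].
  have g0 n : (0 <= 2 * expR (- (1 / 4)) ^+ n.+1 :> R)%R.
    by rewrite mulr_ge0 // exprn_ge0 // expR_ge0.
  have gs : \sum_(n <oo) (2 * expR (- (1 / 4)) ^+ n.+1 : R)%:E <= 8%:E.
    apply: lime_le; first by apply: is_cvg_nneseries => n _ _; rewrite lee_fin.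
    by apply: nearW => n; rewrite sumEFin lee_fin; exact: geometric_tail_sum.
  have [->|Jfin] := eqVneq J +oo; first by rewrite gt0_muley ?leey // lte_fin.
  have Jf : J \is a fin_num by rewrite ge0_fin_numE // ltey.
  rewrite -(fineK Jf); under eq_eseriesr do rewrite muleC.
  rewrite nneseriesZl; last by move=> n _; rewrite lee_fin.
  by rewrite [leRHS]muleC lee_wpmul2l // fineK.
have Wa0 w : [set: T] w -> 0 <= (W w * expR (a w))%:E.
  by move=> _; rewrite lee_fin mulr_ge0 // expR_ge0.
have mWa : measurable_fun [set: T] (fun w => (W w * expR (a w))%:E).
  by apply/measurable_EFinP; exact: measurable_funM.
apply: (@le_trans _ _ (\int[P]_w ((W w * expR (a w))%:E + \sum_(n <oo) f n w))).
  apply: ge0_le_integral => //.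
  - by move=> w _; rewrite lee_fin mulr_ge0 // expR_ge0.
  - apply/measurable_EFinP; apply: measurable_funM => //; apply: measurableT_comp => //.
    by apply: measurable_funM => //; exact: measurable_noise_sq.
  - apply: emeasurable_funD => //; exact: ge0_emeasurable_sum.
  - by move=> w _; exact: layer_cake.
have s0 w : [set: T] w -> 0 <= \sum_(n <oo) f n w by move=> _; exact: nneseries_ge0.
have ms : measurable_fun [set: T] (fun w => \sum_(n <oo) f n w).
  exact: ge0_emeasurable_sum.
rewrite ge0_integralD //.
rewrite integral_nneseries //; apply: le_trans (leeD (lexx _) hsum) _.
have e80 : 0 <= (8%:E : \bar R) by rewrite lee_fin.
rewrite -ge0_integralZl //.
have m8 : measurable_fun [set: T] (fun w => 8%:E * (W w * (expR (a w) - 1))%:E).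
  exact: measurable_funeM.
have g80 w : [set: T] w -> 0 <= 8%:E * (W w * (expR (a w) - 1))%:E.
  by move=> _; rewrite mule_ge0 // hJ0.
rewrite -ge0_integralD //.
apply: ge0_le_integral => //.
- move=> w _; apply: adde_ge0; first by rewrite lee_fin mulr_ge0 // expR_ge0.
  by rewrite mule_ge0 // lee_fin mulr_ge0.
- by apply: emeasurable_funD => //; exact: measurable_funeM.
- apply/measurable_EFinP; apply: measurable_funM => //; apply: measurableT_comp => //.
  exact: measurable_funM.
- move=> w _; rewrite -EFinM -EFinD lee_fin mulrCA -mulrDr ler_wpM2l //.
  exact: expR_bernoulli.
Qed.

Section linear.
Variable u : T -> 'rV[R]_k.
Hypothesis mu : forall i, measurable_wrt F (fun w => u w 0%R i).

Let q w := (enorm (u w) ^+ 2 * delta ^+ 2)%R.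

Let mu2 : measurable_wrt F (fun w => enorm (u w) ^+ 2)%R.
Proof.
apply/measurable_wrtP; under eq_fun do rewrite enorm_sqr.
apply: (@measurable_sum _ (g_sigma_algebraType G)) => i.
by apply: measurable_funM; exact/measurable_wrtP.
Qed.

Let mq : measurable_wrt F q.
Proof. by apply/measurable_wrtP; apply: measurable_funM => //; exact/measurable_wrtP. Qed.

Let mu' i : measurable_fun [set: T] (fun w => u w 0%R i).
Proof. exact: measurable_wrt_fun (mu i). Qed.

Let small : set T := [set w | (q w <= 1 / 8)%R].
Let Fsmall : F small.
Proof.
have -> : small = q @^-1` [set` `]-oo, (1 / 8 : R)%R]].
  by apply/seteqP; split => w; rewrite /small /= in_itv.
exact: mq.
Qed.

(** Where [q] is small, [expR_le_sq] applies and leaves a square with exponent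
    [2 * enorm (u w) ^+ 2]. Where it is large, Young's inequality is enough: the
    factor [expR (q w)] that it costs is then of the right order. *)
Let kap w : R := if (q w <= 1 / 8)%R then (2 * enorm (u w) ^+ 2)%R
  else ((4 * delta ^+ 2)^-1)%R.
Let psi w : R := if (q w <= 1 / 8)%R then 1%R else expR (q w).

Let msmall : measurable_fun [set: g_sigma_algebraType G]
  (fun w => (q w <= 1 / 8)%R : bool).
Proof. by apply: measurable_fun_ler => //; exact/measurable_wrtP. Qed.

Let mkap : measurable_wrt F kap.
Proof.
apply/measurable_wrtP; apply: measurable_fun_ifT => //.
by apply: measurable_funM => //; exact/measurable_wrtP.
Qed.

Let mpsi : measurable_wrt F psi.
Proof.
apply/measurable_wrtP; apply: measurable_fun_ifT => //.
by apply: measurableT_comp => //; exact/measurable_wrtP.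
Qed.

Let psi_ge0 w : (0 <= psi w)%R.
Proof. by rewrite /psi; case: ifP => _; rewrite ?expR_ge0. Qed.

Let d2 : (0 < delta ^+ 2)%R. Proof. by rewrite exprn_gt0. Qed.
Let q0 w : (0 <= q w)%R. Proof. by rewrite mulr_ge0 ?sqr_ge0. Qed.

Let kap_d w : (kap w * delta ^+ 2 = if (q w <= 1 / 8)%R then 2 * q w else 1 / 4)%R.
Proof.
rewrite /kap; case: ifP => _; first by rewrite /q mulrA.
by rewrite invfM -mulrA mulVf ?gt_eqF // mulr1 div1r.
Qed.

Let kapP w : (0 <= kap w * delta ^+ 2 <= 1 / 4)%R.
Proof.
rewrite kap_d; case: ifP => [h|_]; last by rewrite lexx andbT divr_ge0.
rewrite mulr_ge0 //=; exact: exponent_quarter.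
Qed.

Let linear_pointwise w :
  (expR (dot (u w) (xi w)) <= \1_small w * dot (u w) (xi w)
     + psi w * expR (kap w * enorm (xi w) ^+ 2))%R.
Proof.
have cs := cauchy_schwarz_norm (u w) (xi w).
rewrite /psi /kap; case: ifP => h.
  rewrite indicE mem_set // !mul1r; apply: le_trans (expR_le_sq _) _.
  rewrite lerD2l ler_expR -mulrA ler_wpM2l // -exprMn -real_normK ?num_real //.
  by rewrite ler_pXn2r // nnegrE // mulr_ge0 ?enorm_ge0.
rewrite indicE memNset ?mul0r ?add0r; last by rewrite /small /= h.
rewrite -expRD ler_expR; apply: le_trans (ler_norm _) _; apply: le_trans cs _.
rewrite /q -subr_ge0.
have -> : (enorm (u w) ^+ 2 * delta ^+ 2 + (4 * delta ^+ 2)^-1 * enorm (xi w) ^+ 2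
   - enorm (u w) * enorm (xi w) =
   (enorm (u w) * delta - enorm (xi w) / (2 * delta)) ^+ 2)%R.
  by field; rewrite gt_eqF.
exact: sqr_ge0.
Qed.

Let centered_part (A : set T) : F A ->
  P.-integrable setT (fun w => (\1_A w * (\1_small w * dot (u w) (xi w)))%:E) /\
  \int[P]_w (\1_A w * (\1_small w * dot (u w) (xi w)))%:E = 0.
Proof.
move=> FA.
pose v i w := (\1_A w * (\1_small w * u w 0%R i))%R.
have mv i : measurable_wrt F (v i).
  apply/measurable_wrtP; apply: measurable_funM.
    by apply/measurable_wrtP; exact: measurable_wrt_indic.
  apply: measurable_funM; apply/measurable_wrtP; last exact: mu.
  exact: measurable_wrt_indic.
have vK i w : (`|v i w| <= 1 + (8 * delta ^+ 2)^-1)%R.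
  have K0 : (0 <= 1 + (8 * delta ^+ 2)^-1 :> R)%R.
    by rewrite addr_ge0 // invr_ge0 mulr_ge0 // ltW.
  rewrite /v !indicE; case: (w \in A); rewrite ?mul0r ?normr0 // mul1r.
  have [|_] := boolP (w \in small); rewrite ?mul0r ?normr0 // mul1r inE /small /= => h.
  apply: le_trans (enorm_coord _ _) _.
  have h2 : (enorm (u w) ^+ 2 <= (8 * delta ^+ 2)^-1)%R.
    rewrite invfM -[8^-1%R]div1r ler_pdivlMr //.
  apply: (@le_trans _ _ (1 + enorm (u w) ^+ 2)%R); last by rewrite lerD2l.
  have [e1|e1] := leP (enorm (u w)) 1%R.
    by rewrite (le_trans e1) // lerDl sqr_ge0.
  by rewrite expr2 ler_wpDl // ler_peMr // ?enorm_ge0 // ltW.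
have hi i := centered_weight (xi_centered i) (mv i) (vK i).
have e w : (\1_A w * (\1_small w * dot (u w) (xi w)))%:E =
   \sum_(i < k) (v i w * xi w 0%R i)%:E.
  rewrite sumEFin /v /dot; congr EFin; rewrite !mulr_sumr.
  by apply: eq_bigr => i _; rewrite !mulrA.
under eq_fun do rewrite e.
split; first by apply: (integrable_sum measurableT) => i _; have [] := hi i.
rewrite (eq_integral (fun w => \sum_(i < k) (v i w * xi w 0%R i)%:E)) //.
rewrite (integral_sum measurableT) => [|i]; last by have [] := hi i.
by rewrite big1 // => i _; have [_ ->] := hi i.
Qed.

Lemma subgaussian_linear_mgf (W : T -> R) :
  measurable_wrt F W -> (forall w, 0 <= W w)%R ->
  \int[P]_w (W w * expR (dot (u w) (xi w)))%:E <=
  \int[P]_w (W w * expR (19 * q w))%:E.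
Proof.
move=> mW W0.
have mqT := measurable_wrt_fun G_meas mq.
have mX := measurable_noise_dot mu'.
have meX : measurable_fun [set: T] (fun w => expR (dot (u w) (xi w))).
  exact: measurableT_comp.
have meq : measurable_fun [set: T] (fun w => expR (19 * q w))%R.
  by apply: measurableT_comp => //; exact: measurable_funM.
have eX0 w : (0 <= expR (dot (u w) (xi w)))%R by exact: expR_ge0.
have eq0 w : (0 <= expR (19 * q w))%R by exact: expR_ge0.
apply: (@le_integral_weight _ _ _ P G G_meas (fun w => expR (dot (u w) (xi w)))
  (fun w => expR (19 * q w)) W)%R => //.
move=> A FA; rewrite 2!(integral_indic_weight A).
have mA : measurable_fun [set: T] (\1_A : T -> R).
  by apply: measurable_indic; exact: Fm.
have A0 w : (0 <= \1_A w :> R)%R by rewrite indicE; case: (w \in A).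
have mpsiT := measurable_wrt_fun G_meas mpsi.
have mkapT := measurable_wrt_fun G_meas mkap.
have mApsi : measurable_wrt F (fun w => \1_A w * psi w)%R.
  apply/measurable_wrtP; apply: measurable_funM; apply/measurable_wrtP => //.
  exact: measurable_wrt_indic.
have [iL L0] := centered_part FA.
apply: (@le_trans _ _ (\int[P]_w (\1_A w * psi w * expR (kap w * enorm (xi w) ^+ 2))%:E)).
  apply: (le_integral_centered _ _ _ _ iL L0) => //.
  - exact: measurable_funM.
  - apply: measurable_funM; first exact: measurable_funM.
    apply: measurableT_comp => //; apply: measurable_funM => //.
    exact: measurable_noise_sq.
  - by move=> w; rewrite ?mulr_ge0 ?expR_ge0 //.
  - by move=> w; rewrite -mulrA -mulrDr ler_wpM2l.
apply: le_trans (subgaussian_sq_mgf mkap kapP mApsi _) _.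
  by move=> w; rewrite ?mulr_ge0.
apply: ge0_le_integral => //.
- by move=> w _; rewrite lee_fin mulr_ge0 ?expR_ge0 // mulr_ge0.
- apply/measurable_EFinP; apply: measurable_funM; first exact: measurable_funM.
  apply: measurableT_comp => //; apply: measurable_funM => //.
  exact: measurable_funM.
- by apply/measurable_EFinP; exact: measurable_funM.
- move=> w _; rewrite lee_fin -mulrA ler_wpM2l // kap_d /psi.
  have := q0 w; case: ifP => h qw; first by rewrite mul1r ler_expR; exact: exponent_small.
  rewrite -expRD ler_expR; apply: exponent_large; by rewrite ltNge h.
Qed.

End linear.

(** The only information on the noise used afterwards. Both the centring and
    the tail enter: the linear part is second order in [u] only because the
    noise is centred. The two parts are separated by the inequality between the
    arithmetic and the geometric mean. *)
Lemma subgaussian_mgf (u : T -> 'rV[R]_k) (W : T -> R) (c : R) :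
  (forall i, measurable_wrt F (fun w => u w 0%R i)) ->
  (0 <= c)%R -> (8 * c * delta ^+ 2 <= 1)%R ->
  measurable_wrt F W -> (forall w, 0 <= W w)%R ->
  \int[P]_w (W w * expR (dot (u w) (xi w) + c * enorm (xi w) ^+ 2))%:E <=
  \int[P]_w (W w * expR (76 * (enorm (u w) ^+ 2 * delta ^+ 2)
                         + 18 * c * delta ^+ 2))%:E.
Proof.
move=> mu c0 c1 mW W0.
pose q w := (enorm (u w) ^+ 2 * delta ^+ 2)%R.
have q0 w : (0 <= q w)%R by rewrite mulr_ge0 ?sqr_ge0.
pose V w := (W w / 2)%R.
have mV : measurable_wrt F V.
  by apply/measurable_wrtP; apply: measurable_funM => //; exact/measurable_wrtP.
have V0 w : (0 <= V w)%R by rewrite divr_ge0.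
have mVT := measurable_wrt_fun G_meas mV.
have muT i := measurable_wrt_fun G_meas (mu i).
have mX := measurable_noise_dot muT.
have mN := measurable_noise_sq.
have mq : measurable_fun [set: T] q.
  apply: measurable_funM => //; under eq_fun do rewrite enorm_sqr.
  by apply: measurable_sum => i; exact: measurable_funM.
have m2 i : measurable_wrt F (fun w => (2 *: u w) 0%R i).
  apply/measurable_wrtP; under eq_fun do rewrite mxE.
  by apply: measurable_funM => //; exact/measurable_wrtP.
have h1 := subgaussian_linear_mgf m2 mV V0.
have mc2 : measurable_wrt F (cst (2 * c)%R : T -> R).
  by apply/measurable_wrtP; exact: measurable_cst.
have c2 (w : T) : (0 <= cst (2 * c) w * delta ^+ 2 <= 1 / 4)%R.
  rewrite /= mulr_ge0 ?sqr_ge0 ?mulr_ge0 //=; exact: exponent_half.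
have h2 := subgaussian_sq_mgf mc2 c2 mV V0.
have meq (f : T -> R) : measurable_fun [set: T] f ->
    measurable_fun [set: T] (fun w => (V w * expR (f w))%:E).
  move=> mf; apply/measurable_EFinP; apply: measurable_funM => //.
  exact: measurableT_comp.
have ge0 (f : T -> R) w : [set: T] w -> 0 <= (V w * expR (f w))%:E.
  by move=> _; rewrite lee_fin mulr_ge0 // expR_ge0.
have m2X : measurable_fun [set: T] (fun w => dot (2 *: u w) (xi w)).
  by under eq_fun do rewrite dotZl; exact: measurable_funM.
have m2N : measurable_fun [set: T] (fun w => cst (2 * c) w * enorm (xi w) ^+ 2)%R.
  exact: measurable_funM.
have mWT := measurable_wrt_fun G_meas mW.
have A1 := meq _ m2X; have A2 := meq _ m2N.
have B1 := ge0 (fun w => dot (2 *: u w) (xi w)).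
have B2 := ge0 (fun w => cst (2 * c) w * enorm (xi w) ^+ 2)%R.
apply: (@le_trans _ _ (\int[P]_w ((V w * expR (dot (2 *: u w) (xi w)))%:E
    + (V w * expR (cst (2 * c) w * enorm (xi w) ^+ 2))%:E))).
  apply: ge0_le_integral => //.
  - by move=> w _; rewrite lee_fin mulr_ge0 // expR_ge0.
  - apply/measurable_EFinP; apply: measurable_funM => //.
    apply: measurableT_comp => //; apply: measurable_funD => //.
    exact: measurable_funM.
  - by apply: emeasurable_funD; exact: meq.
  - move=> w _; rewrite -EFinD lee_fin -mulrDr dotZl /V -mulrA ler_wpM2l //.
    by rewrite /= -(mulrA 2%R c); exact: expR_half.
rewrite (ge0_integralD P measurableT B1 A1 B2 A2).
apply: le_trans (leeD h1 h2) _.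
have e76 w : (19 * (enorm (2 *: u w) ^+ 2 * delta ^+ 2) = 76 * q w)%R.
  rewrite enormZ exprMn real_normK ?num_real // /q.
  by move: (enorm _ ^+ 2)%R (delta ^+ 2)%R => x y; ring.
have m3 : measurable_fun [set: T] (fun w => 76 * q w)%R by exact: measurable_funM.
have m4 : measurable_fun [set: T] (fun w => 9 * (cst (2 * c) w * delta ^+ 2))%R.
  by apply: measurable_funM => //; exact: measurable_funM.
under eq_integral do rewrite e76.
have A3 := meq _ m3; have A4 := meq _ m4.
have B3 := ge0 (fun w => 76 * q w)%R.
have B4 := ge0 (fun w => 9 * (cst (2 * c) w * delta ^+ 2))%R.
rewrite -(ge0_integralD P measurableT B3 A3 B4 A4).
apply: ge0_le_integral => //.
- by move=> w _; rewrite adde_ge0 // lee_fin mulr_ge0 // expR_ge0.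
- by apply: emeasurable_funD; exact: meq.
- apply/measurable_EFinP; apply: measurable_funM => //.
  by apply: measurableT_comp => //; exact: measurable_funD.
- move=> w _; rewrite -EFinD lee_fin -mulrDr /V -(mulrA (W w)) ler_wpM2l //.
  by apply: expR_avg => //; rewrite mulr_ge0 // sqr_ge0.
Qed.

End subgaussian.
End conditional_mgf.

(** * Measurability with respect to the past *)

Section measurable_composition.
Context {d : measure_display} {T : measurableType d} {R : realType}.
Variable G : set (set T).
Let F := <<s G >>.

Definition vec_measurable {k : nat} (X : T -> 'rV[R]_k) :=
  forall i, measurable_wrt F (fun w => X w 0 i).

Let F_bigcup (A : nat -> set T) : (forall n, F (A n)) -> F (\bigcup_n A n).
Proof. exact: (@bigcupT_measurable _ (g_sigma_algebraType G)). Qed.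

(** Countably many rational boxes detect the open sets, so measurability of the
    coordinates is enough for a function that is continuous at the values
    taken. Continuity is only required there because the gradients are
    continuous only around the domains. *)
Lemma measurable_wrt_continuous {m n : nat} (X : T -> 'rV[R]_m) (Y : T -> 'rV[R]_n)
    (h : 'rV[R]_m * 'rV[R]_n -> R) :
  vec_measurable X -> vec_measurable Y ->
  (forall w, {for (X w, Y w), continuous h}) ->
  measurable_wrt F (fun w => h (X w, Y w)).
Proof.
move=> mX mY hc; apply/measurable_wrtP.
apply: (measurability _ (RGenOInfty.measurableE R)).
move=> _ [_ [a ->] <-]; rewrite setTI.
pose Ix : countType := ('rV[rat]_m * 'rV[rat]_n * nat)%type.
pose box (i : Ix) : set ('rV[R]_m * 'rV[R]_n) := [set z : 'rV[R]_m * 'rV[R]_n |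
  (forall j, `|z.1 0 j - ratr (i.1.1 0 j)| < i.2.+1%:R^-1) /\
  (forall j, `|z.2 0 j - ratr (i.1.2 0 j)| < i.2.+1%:R^-1)].
pose B k : set T := if unpickle k is Some i then
  [set w | box i (X w, Y w) /\ box i `<=` [set z | a < h z]] else set0.
have coord k (Z : T -> 'rV[R]_k) (c : 'rV[rat]_k) (e : R) : vec_measurable Z ->
    F [set w | forall j, `|Z w 0 j - ratr (c 0 j)| < e].
  move=> mZ.
  have -> : [set w | forall j, `|Z w 0 j - ratr (c 0 j)| < e] =
      \bigcap_(j in [set: 'I_k]) ((fun w => Z w 0 j) @^-1` ball (ratr (c 0 j) : R) e).
    apply/seteqP; split => w /=.
      by move=> H j _; rewrite -ball_normE /ball_ /= distrC; exact: H.
    by move=> H j; have := H j I; rewrite -ball_normE /ball_ /= distrC; apply.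
  apply: (@fin_bigcap_measurable _ (g_sigma_algebraType G)) => // j _.
  by apply: mZ; exact: measurable_ball.
have FB k : F (B k).
  rewrite /B; case: unpickle => [i|]; last exact: (@measurable0 _ (g_sigma_algebraType G)).
  have [sub|nsub] := pselect (box i `<=` [set z | a < h z]).
    have -> : [set w | box i (X w, Y w) /\ box i `<=` [set z | a < h z]] =
      [set w | forall j, `|X w 0 j - ratr (i.1.1 0 j)| < i.2.+1%:R^-1] `&`
      [set w | forall j, `|Y w 0 j - ratr (i.1.2 0 j)| < i.2.+1%:R^-1].
      by apply/seteqP; split => w /=; [move=> [] | move=> ?; split].
    by apply: (@measurableI _ (g_sigma_algebraType G)); exact: coord.
  have -> : [set w | box i (X w, Y w) /\ box i `<=` [set z | a < h z]] = set0.
    by apply/seteqP; split => w //= [].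
  exact: (@measurable0 _ (g_sigma_algebraType G)).
suff -> : (fun w => h (X w, Y w)) @^-1` `]a, +oo[%classic = \bigcup_k B k.
  exact: F_bigcup.
apply/seteqP; split => w /=; last first.
  move=> [k _]; rewrite /B; case: unpickle => [i|//] /= [bw sub].
  by rewrite in_itv /= andbT; exact: (sub _ bw).
rewrite in_itv /= andbT => aw.
have : \forall z \near (X w, Y w), a < h z by
  exact: (@cvgr_gt _ _ _ (nbhs_filter (X w, Y w)) h _ (hc w) a aw).
move=> /nbhs_ballP[e /= e0 he].
have e20 : 0 < e / 2 by rewrite divr_gt0.
have [N _ hN] := near_infty_natSinv_lt (PosNum e20).
have {hN} Ne : N.+1%:R^-1 < e / 2 := hN N (leqnn N).
have rat_close k (Z : 'rV[R]_k) : exists c : 'rV[rat]_k,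
    forall j, `|Z 0 j - ratr (c 0 j)| < N.+1%:R^-1.
  have Hj j : exists q : rat, `|Z 0 j - ratr q| < N.+1%:R^-1.
    have N0 : 0 < (N.+1%:R^-1 : R) by rewrite invr_gt0.
    have [|q] := @rat_in_itvoo R (Z 0 j - N.+1%:R^-1) (Z 0 j + N.+1%:R^-1).
      by rewrite ltrD2l gtrN.
    rewrite in_itv /= => /andP[q1 q2]; exists q.
    by rewrite ltr_norml ltrBrDl -ltrBrDr opprK q2 /= ltrBlDr -ltrBlDl.
  have [c hc'] := choice Hj; exists (\row_j c j) => j.
  by rewrite mxE.
have [c1 hc1] := rat_close _ (X w); have [c2 hc2] := rat_close _ (Y w).
exists (pickle ((c1, c2, N) : Ix)) => //; rewrite /B pickleK /=; split => //.
move=> z [hz1 hz2] /=; apply: he.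
have tri k (u v : 'rV[R]_k) (c : 'rV[rat]_k) :
    (forall j, `|u 0 j - ratr (c 0 j)| < N.+1%:R^-1) ->
    (forall j, `|v 0 j - ratr (c 0 j)| < N.+1%:R^-1) -> ball u e v.
  move=> hu hv; split=> // i j; rewrite (ord1 i) -ball_normE /ball_ /=.
  rewrite (le_lt_trans (ler_distD (ratr (c 0 j)) _ _)) //.
  by rewrite (splitr e) ltrD // ?(lt_trans (hu j)) // distrC (lt_trans (hv j)).
by split; [exact: tri hc1 hz1 | exact: tri hc2 hz2].
Qed.

Lemma vec_measurable_cst {k} (c : 'rV[R]_k) : vec_measurable (fun=> c).
Proof. by move=> i; apply/measurable_wrtP; exact: measurable_cst. Qed.

Lemma vec_measurableD {k} (X Y : T -> 'rV[R]_k) :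
  vec_measurable X -> vec_measurable Y -> vec_measurable (fun w => X w + Y w).
Proof.
move=> mX mY i; apply/measurable_wrtP; under eq_fun do rewrite mxE.
by apply: measurable_funD; exact/measurable_wrtP.
Qed.

Lemma vec_measurableZ {k} (c : R) (X : T -> 'rV[R]_k) :
  vec_measurable X -> vec_measurable (fun w => c *: X w).
Proof.
move=> mX i; apply/measurable_wrtP; under eq_fun do rewrite mxE.
by apply: measurable_funM => //; exact/measurable_wrtP.
Qed.

Lemma vec_measurableN {k} (X : T -> 'rV[R]_k) :
  vec_measurable X -> vec_measurable (fun w => - X w).
Proof. by move=> mX; under eq_fun do rewrite -scaleN1r; exact: vec_measurableZ. Qed.

Lemma vec_measurableB {k} (X Y : T -> 'rV[R]_k) :
  vec_measurable X -> vec_measurable Y -> vec_measurable (fun w => X w - Y w).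
Proof. by move=> mX mY; apply: vec_measurableD => //; exact: vec_measurableN. Qed.

Lemma measurable_wrt_dot {k} (X Y : T -> 'rV[R]_k) :
  vec_measurable X -> vec_measurable Y -> measurable_wrt F (fun w => dot (X w) (Y w)).
Proof.
move=> mX mY; apply/measurable_wrtP.
apply: (@measurable_sum _ (g_sigma_algebraType G)) => i.
by apply: measurable_funM; apply/measurable_wrtP; [exact: mX | exact: mY].
Qed.

Lemma measurable_wrt_sq {k} (X : T -> 'rV[R]_k) :
  vec_measurable X -> measurable_wrt F (fun w => enorm (X w) ^+ 2).
Proof. by move=> mX; under eq_fun do rewrite enorm_sqr; exact: measurable_wrt_dot. Qed.

Lemma measurable_wrtD (f g : T -> R) :
  measurable_wrt F f -> measurable_wrt F g -> measurable_wrt F (fun w => f w + g w).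
Proof.
by move=> mf mg; apply/measurable_wrtP; apply: measurable_funD; exact/measurable_wrtP.
Qed.

Lemma measurable_wrtM (f g : T -> R) :
  measurable_wrt F f -> measurable_wrt F g -> measurable_wrt F (fun w => f w * g w).
Proof.
by move=> mf mg; apply/measurable_wrtP; apply: measurable_funM; exact/measurable_wrtP.
Qed.

Lemma measurable_wrt_cst (c : R) : measurable_wrt F (fun=> c).
Proof. by apply/measurable_wrtP; exact: measurable_cst. Qed.

Lemma measurable_wrt_scale (c : R) (f : T -> R) :
  measurable_wrt F f -> measurable_wrt F (fun w => c * f w).
Proof. by move=> mf; apply: measurable_wrtM => //; exact: measurable_wrt_cst. Qed.

Lemma measurable_wrtN (f : T -> R) :
  measurable_wrt F f -> measurable_wrt F (fun w => - f w).
Proof.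
by move=> mf; under eq_fun do rewrite -mulN1r; exact: measurable_wrt_scale.
Qed.

Lemma measurable_wrt_expR (f : T -> R) :
  measurable_wrt F f -> measurable_wrt F (fun w => expR (f w)).
Proof.
by move=> mf; apply/measurable_wrtP; apply: measurableT_comp => //; exact/measurable_wrtP.
Qed.

End measurable_composition.

(** * Adaptedness of the iterates *)

Section sapd_process.
Context {R : realType} {m n : nat} {d d1 d2 : measure_display}.
Context {T : measurableType d} {P : probability T R}.
Context {Wx : measurableType d1} {Wy : measurableType d2}.
Variables (a : algo_params R) (pp : problem_params R) (pb : problem R m n).
Variables (o : stoch_oracle m n P Wx Wy) (x0 : 'rV[R]_m) (y0 : 'rV[R]_n).
Variables (xs : 'rV[R]_m) (ys : 'rV[R]_n) (deltax deltay : R).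
Hypotheses (pp_valid : valid_problem_params pp) (a_adm : admissible a pp).
Hypotheses (Hpb : problem_assumption pp pb) (saddle : saddle_point pb xs ys).
Hypotheses (x0_dom : edom (pf pb) x0) (y0_dom : edom (pg pb) y0).
Hypothesis noise : noise_assumption pb o a x0 y0 deltax deltay.

(** [history] is convertible to the sigma-algebra generated by this class. *)
Definition history_gen (i j : nat) : set (set T) :=
  (\bigcup_(l in `I_i) preimage_set_system setT (omy o l) measurable) `|`
  (\bigcup_(l in `I_j) preimage_set_system setT (omx o l) measurable).

Lemma history_gen_measurable i j : history_gen i j `<=` @measurable _ T.
Proof.
move=> A [[l _ [B mB <-]]|[l _ [B mB <-]]]; rewrite setTI.
  by rewrite -[X in measurable X]setTI; exact: (@measurable_funPT _ _ _ _ (omy o l)).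
by rewrite -[X in measurable X]setTI; exact: (@measurable_funPT _ _ _ _ (omx o l)).
Qed.

Lemma history_mono i j i' j' : (i <= i')%N -> (j <= j')%N ->
  history o i j `<=` history o i' j'.
Proof.
move=> ii jj; apply: sub_sigma_algebra2 => A [[l li Al]|[l lj Al]].
  by left; exists l => //; exact: leq_trans li ii.
by right; exists l => //; exact: leq_trans lj jj.
Qed.

Let X w k := sapd_x pb o a x0 y0 k w.
Let Y w k := sapd_y pb o a x0 y0 k w.
Let DY w k := noise_y pb o a x0 y0 k w.
Let DX w k := noise_x pb o a x0 y0 k w.
Let Q w k := (sapd pb o a x0 y0 k w).2.
Let GY w k := sapd_gy pb o a x0 y0 k w.

Let Q_S w k : Q w k.+1 = GY w k.+1 - GY w k.
Proof.
by rewrite /Q /GY /sapd_gy /sapd_x /sapd_y /=; case: (sapd _ _ _ _ _ k w) => [[x y] q].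
Qed.

Let Y_S w k : Y w k.+1 = proxg a pb (Y w k + sigma a *: (GY w k + theta a *: Q w k)).
Proof.
by rewrite /Y /GY /Q /sapd_gy /sapd_x /sapd_y /=; case: (sapd _ _ _ _ _ k w) => [[x y] q].
Qed.

Let X_S w k : X w k.+1 = proxf a pb (X w k - tau a *: sapd_gx pb o a x0 y0 k w).
Proof.
by rewrite /X /sapd_gx /sapd_x /sapd_y /=; case: (sapd _ _ _ _ _ k w) => [[x y] q].
Qed.

Let GY_E w k : GY w k = grady (pPhi pb) (X w k, Y w k) + DY w k.
Proof. by rewrite /DY /noise_y addrC subrK. Qed.

(** The momentum of the algorithm is a difference of noisy gradients: removing the
    noise leaves [momentum], and the noises of two iterations make [dual_noise]. *)
Let Y_step w k : Y w k.+1 = proxg a pb (Y w k + sigma a *: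
  (dual_grad pb (X w) (Y w) k + theta a *: momentum pb (X w) (Y w) k
   + dual_noise a (DY w) k)).
Proof.
rewrite Y_S; congr (proxg a pb (_ + _ *: _)); rewrite /dual_noise /momentum /dual_grad.
case: k => [|k].
  by rewrite /Q /= subrr !scaler0 !addr0 subr0 scale1r GY_E.
rewrite /= Q_S !GY_E.
move: (grady _ _) (grady _ (X w k, _)) (DY w k.+1) (DY w k) => g g' e e'.
rewrite scalerDl scale1r opprD addrACA scalerDr (scalerBr _ e) -!addrA.
by rewrite [in LHS](addrCA e).
Qed.

Let X_step w k : X w k.+1 = proxf a pb (X w k - tau a *:
  (gradx (pPhi pb) (X w k, Y w k.+1) + DX w k)).
Proof. by rewrite X_S /DX /noise_x [gradx _ _ + _]addrC subrK. Qed.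

Let X_dom w k : edom (pf pb) (X w k).
Proof. exact: (path_dom pp_valid a_adm Hpb x0_dom y0_dom (Y_step w) (X_step w) k).1. Qed.
Let Y_dom w k : edom (pg pb) (Y w k).
Proof. exact: (path_dom pp_valid a_adm Hpb x0_dom y0_dom (Y_step w) (X_step w) k).2. Qed.

Let vm i j k (Z : T -> 'rV[R]_k) := vec_measurable (history_gen i j) Z.

Let vm_mono i j i' j' k (Z : T -> 'rV[R]_k) (ii : (i <= i')%N) (jj : (j <= j')%N)
  (mZ : vm i j Z) : vm i' j' Z.
Proof. by move=> l B mB; apply: (history_mono ii jj); exact: mZ. Qed.

Let coordE k (h : 'rV[R]_m * 'rV[R]_n -> 'rV[R]_k) (i : 'I_k) p :
  {for p, continuous h} -> {for p, continuous (fun z => h z 0 i)}.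
Proof.
move=> hc; apply: (@continuous_comp _ _ _ h (fun z : 'rV[R]_k => z 0 i)) => //.
exact: coord_continuous.
Qed.

Let vm_grady i j (Z : T -> 'rV[R]_m) (Z' : T -> 'rV[R]_n) :
  (forall w, edom (pf pb) (Z w)) -> (forall w, edom (pg pb) (Z' w)) ->
  vm i j Z -> vm i j Z' -> vm i j (fun w => grady (pPhi pb) (Z w, Z' w)).
Proof.
move=> dZ dZ' mZ mZ' l; have [U [_ DU C1]] := pPhi_C1 Hpb.
apply: (measurable_wrt_continuous mZ mZ' (h := fun z => grady (pPhi pb) z 0 l)) => w.
by apply: coordE; have [] := C1 _ (DU (Z w, Z' w) (conj (dZ w) (dZ' w))).
Qed.

Let vm_gradx i j (Z : T -> 'rV[R]_m) (Z' : T -> 'rV[R]_n) :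
  (forall w, edom (pf pb) (Z w)) -> (forall w, edom (pg pb) (Z' w)) ->
  vm i j Z -> vm i j Z' -> vm i j (fun w => gradx (pPhi pb) (Z w, Z' w)).
Proof.
move=> dZ dZ' mZ mZ' l; have [U [_ DU C1]] := pPhi_C1 Hpb.
apply: (measurable_wrt_continuous mZ mZ' (h := fun z => gradx (pPhi pb) z 0 l)) => w.
by apply: coordE; have [] := C1 _ (DU (Z w, Z' w) (conj (dZ w) (dZ' w))).
Qed.

Let mux0 : 0 < mux pp. Proof. by case: pp_valid => -[]. Qed.
Let muy0 : 0 < muy pp. Proof. by case: pp_valid => -[]. Qed.
Let t0 : 0 < tau a. Proof. by case: a_adm => -[]. Qed.
Let s0 : 0 < sigma a. Proof. by case: a_adm => -[]. Qed.

Let vm_proxf i j (Z : T -> 'rV[R]_m) : vm i j Z -> vm i j (fun w => proxf a pb (Z w)).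
Proof.
move=> mZ l.
have H := @measurable_wrt_continuous _ _ _ (history_gen i j) _ _ Z (fun=> 0 : 'rV[R]_n)
  (fun z => proxf a pb z.1 0 l) mZ (@vec_measurable_cst _ _ _ _ _ _).
apply: H => w.
apply: (coordE (h := fun z => proxf a pb z.1)).
apply: (@continuous_comp _ _ _ fst (proxf a pb)); first exact: cvg_fst.
exact: (continuous_prox (pf_Nninfty Hpb) (pf_closed Hpb) mux0 (pf_sconvex Hpb) x0_dom t0).
Qed.

Let vm_proxg i j (Z : T -> 'rV[R]_n) : vm i j Z -> vm i j (fun w => proxg a pb (Z w)).
Proof.
move=> mZ l.
have H := @measurable_wrt_continuous _ _ _ (history_gen i j) _ _ (fun=> 0 : 'rV[R]_m) Z
  (fun z => proxg a pb z.2 0 l) (@vec_measurable_cst _ _ _ _ _ _) mZ.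
apply: H => w.
apply: (coordE (h := fun z => proxg a pb z.2)).
apply: (@continuous_comp _ _ _ snd (proxg a pb)); first exact: cvg_snd.
exact: (continuous_prox (pg_Nninfty Hpb) (pg_closed Hpb) muy0 (pg_sconvex Hpb) y0_dom s0).
Qed.

Let GY_m k : vm k.+1 k (fun w => GY w k).
Proof. by move=> i; have [+ _] := noise_adapted noise; apply. Qed.

Let GX_m k : vm k.+1 k.+1 (fun w => sapd_gx pb o a x0 y0 k w).
Proof. by move=> i; have [_] := noise_adapted noise; apply. Qed.

Let Q_m k : vm k.+1 k (fun w => Q w k).
Proof.
case: k => [|k]; first exact: vec_measurable_cst.
under eq_fun do rewrite Q_S; apply: vec_measurableB; first exact: GY_m.
exact: (@vm_mono _ _ _ _ _ _ (leqnSn _) (leqnSn _) (@GY_m k)).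
Qed.

Let XY_m k : vm k k (fun w => X w k) /\ vm k k (fun w => Y w k).
Proof.
elim: k => [|k [mX mY]]; first by split; exact: vec_measurable_cst.
have mY1 : vm k.+1 k (fun w => Y w k.+1).
  under eq_fun do rewrite Y_S; apply: vm_proxg; apply: vec_measurableD.
    exact: (@vm_mono _ _ _ _ _ _ (leqnSn _) (leqnn _) mY).
  apply: vec_measurableZ; apply: vec_measurableD; first exact: GY_m.
  by apply: vec_measurableZ; exact: Q_m.
split; last exact: (@vm_mono _ _ _ _ _ _ (leqnn _) (leqnSn _) mY1).
under eq_fun do rewrite X_S; apply: vm_proxf; apply: vec_measurableB.
  exact: (@vm_mono _ _ _ _ _ _ (leqnSn _) (leqnSn _) mX).
by apply: vec_measurableZ; exact: GX_m.
Qed.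

Let Y_m1 k : vm k.+1 k (fun w => Y w k.+1).
Proof.
under eq_fun do rewrite Y_S; apply: vm_proxg; apply: vec_measurableD.
  exact: (@vm_mono _ _ _ _ _ _ (leqnSn _) (leqnn _) (XY_m k).2).
apply: vec_measurableZ; apply: vec_measurableD; first exact: GY_m.
by apply: vec_measurableZ; exact: Q_m.
Qed.

Let G_m k : vm k k (fun w => dual_grad pb (X w) (Y w) k).
Proof. by apply: vm_grady => //; [exact: (XY_m k).1 | exact: (XY_m k).2]. Qed.

Let M_m k : vm k k (fun w => momentum pb (X w) (Y w) k).
Proof.
apply: vec_measurableB; first exact: G_m.
exact: (@vm_mono _ _ _ _ _ _ (leq_pred _) (leq_pred _) (@G_m k.-1)).
Qed.

Let DY_m k : vm k.+1 k (fun w => DY w k).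
Proof.
apply: vec_measurableB; first exact: GY_m.
exact: (@vm_mono _ _ _ _ _ _ (leqnSn _) (leqnn _) (@G_m k)).
Qed.

Let DX_m k : vm k.+1 k.+1 (fun w => DX w k).
Proof.
have mX := @vm_mono _ _ _ _ _ _ (leqnSn k) (leqnSn k) (XY_m k).1.
have mY := @vm_mono _ _ _ _ _ _ (leqnn _) (leqnSn _) (@Y_m1 k).
apply: vec_measurableB; first exact: GX_m.
exact: (@vm_gradx _ _ _ _ (X_dom ^~ k) (Y_dom ^~ k.+1) mX mY).
Qed.

Let pdom z := proxg_dom pp_valid a_adm Hpb y0_dom z.
Let fdom z := proxf_dom pp_valid a_adm Hpb x0_dom z.

Let vm_yhat i j (Z : T -> 'rV[R]_m) (Z' q : T -> 'rV[R]_n) :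
  (forall w, edom (pf pb) (Z w)) -> (forall w, edom (pg pb) (Z' w)) ->
  vm i j Z -> vm i j Z' -> vm i j q -> vm i j (fun w => yhat a pb (Z w) (Z' w) (q w)).
Proof.
move=> dZ dZ' mZ mZ' mq; apply: vm_proxg; apply: vec_measurableD => //.
apply: vec_measurableZ; apply: vec_measurableD; first exact: vm_grady.
exact: vec_measurableZ.
Qed.

Let vm_xhat i j (Z : T -> 'rV[R]_m) (Z' q : T -> 'rV[R]_n) :
  (forall w, edom (pf pb) (Z w)) -> (forall w, edom (pg pb) (Z' w)) ->
  vm i j Z -> vm i j Z' -> vm i j q -> vm i j (fun w => xhat a pb (Z w) (Z' w) (q w)).
Proof.
move=> dZ dZ' mZ mZ' mq; apply: vm_proxf; apply: vec_measurableB => //.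
apply: vec_measurableZ; apply: vm_gradx => //; last exact: vm_yhat.
by move=> w; exact: pdom.
Qed.

Let yfree_m k : vm k k (fun w => yfree a pb (X w) (Y w) k).
Proof. exact (@vm_yhat _ _ _ _ _ (X_dom ^~ k) (Y_dom ^~ k) (XY_m k).1 (XY_m k).2 (@M_m k)). Qed.

Let xfree_m k : vm k k (fun w => xfree a pb (X w) (Y w) k).
Proof. exact (@vm_xhat _ _ _ _ _ (X_dom ^~ k) (Y_dom ^~ k) (XY_m k).1 (XY_m k).2 (@M_m k)). Qed.

Let yfree2_m k : vm k k (fun w => yfree2 a pb (X w) (Y w) k).
Proof.
have dX w : edom (pf pb) (xfree a pb (X w) (Y w) k) by exact: fdom.
have dY w : edom (pg pb) (yfree a pb (X w) (Y w) k) by exact: pdom.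
have mg := @vm_grady _ _ _ _ dX dY (@xfree_m k) (@yfree_m k).
exact (@vm_yhat _ _ _ _ _ dX dY (@xfree_m k) (@yfree_m k) (vec_measurableB mg (@G_m k))).
Qed.

Let U w k := noisy_energy a pp pb xs ys (X w) (Y w) (DY w) (DX w) k.

Let energy_m i j (ex dx : T -> 'rV[R]_m) (ey dy q : T -> 'rV[R]_n) :
  vm i j ex -> vm i j ey -> vm i j dx -> vm i j dy -> vm i j q ->
  measurable_wrt (history o i j)
    (fun w => energy a pp (ex w) (ey w) (dx w) (dy w) (q w)).
Proof.
move=> m1 m2 m3 m4 m5.
have sq k c (Z : T -> 'rV[R]_k) : vm i j Z ->
    measurable_wrt (history o i j) (fun w => c * enorm (Z w) ^+ 2).
  by move=> mZ; apply: measurable_wrt_scale; exact: measurable_wrt_sq.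
apply: measurable_wrtD; last exact: measurable_wrt_dot.
apply: measurable_wrtD; last exact: sq.
apply: measurable_wrtD; last exact: sq.
by apply: measurable_wrtD; exact: sq.
Qed.

Let prevDY_m k : vm k k (fun w => prev 0 (DY w) k).
Proof.
case: k => [|k]; first exact: vec_measurable_cst.
exact: (@vm_mono _ _ _ _ _ _ (leqnn _) (leqnSn _) (@DY_m k)).
Qed.

Let noise_sq_m k : measurable_wrt (history o k.+1 k.+1)
  (fun w => noise_sq (DY w) (DX w) k).
Proof.
apply: measurable_wrtD; apply: measurable_wrt_sq.
  exact: (@vm_mono _ _ _ _ _ _ (leqnn _) (leqnSn _) (@DY_m k)).
exact: DX_m.
Qed.

Let prev_noise_sq_m k : measurable_wrt (history o k k)
  (fun w => prev 0 (noise_sq (DY w) (DX w)) k).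
Proof. by case: k => [|k]; [exact: measurable_wrt_cst | exact: noise_sq_m]. Qed.

Let prev2_noise_sq_m k : measurable_wrt (history o k k)
  (fun w => prev 0 (prev 0 (noise_sq (DY w) (DX w))) k).
Proof.
case: k => [|k]; first exact: measurable_wrt_cst.
by move=> B mB; apply: (history_mono (leqnSn k) (leqnSn k)); exact: prev_noise_sq_m.
Qed.

Let anchor w k := prev (yfree a pb (X w) (Y w) 0) (yfree2 a pb (X w) (Y w)) k.

Let anchor_m k : vm k k (fun w => anchor w k).
Proof.
case: k => [|k]; first exact (@yfree_m 0).
exact (@vm_mono _ _ _ _ _ _ (leqnSn k) (leqnSn k) (@yfree2_m k)).
Qed.

Let subc_m i j k (Z : T -> 'rV[R]_k) c : vm i j Z -> vm i j (fun w => Z w - c).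
Proof. by move=> mZ; apply: vec_measurableB => //; exact: vec_measurable_cst. Qed.

Let XYpred_m k : vm k k (fun w => X w k.-1) /\ vm k k (fun w => Y w k.-1).
Proof.
have [mX mY] := XY_m k.-1.
by split; [exact (@vm_mono _ _ _ _ _ _ (leq_pred k) (leq_pred k) mX)
          |exact (@vm_mono _ _ _ _ _ _ (leq_pred k) (leq_pred k) mY)].
Qed.

Lemma noisy_energy_measurable k : measurable_wrt (history o k k) (fun w => U w k).
Proof.
have [mX mY] := XY_m k; have [mX' mY'] := XYpred_m k.
apply: measurable_wrtD; first apply: measurable_wrtD.
- exact (energy_m (subc_m xs mX) (subc_m ys mY)
           (vec_measurableB mX mX') (vec_measurableB mY mY') (@M_m k)).
- apply: measurable_wrtN; apply: measurable_wrt_scale.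
  exact (measurable_wrt_dot (@prevDY_m k) (subc_m ys (@anchor_m k))).
apply: measurable_wrt_scale; apply: measurable_wrtD; apply: measurable_wrt_scale.
  exact: prev_noise_sq_m.
exact: prev2_noise_sq_m.
Qed.

Lemma dual_drift_measurable k :
  vec_measurable (history_gen k k) (fun w => dual_drift a pb ys (X w) (Y w) k).
Proof.
exact (vec_measurableB (vec_measurableZ (momentum_weight a k) (subc_m ys (@yfree_m k)))
  (vec_measurableZ (theta a / rho a) (subc_m ys (@yfree2_m k)))).
Qed.

Lemma primal_drift_measurable k :
  vec_measurable (history_gen k k) (fun w => primal_drift a pb xs (X w) (Y w) k).
Proof. exact (vec_measurableN (subc_m xs (@xfree_m k))). Qed.

Lemma noise_y_measurable k : vec_measurable (history_gen k.+1 k) (fun w => DY w k).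
Proof. exact: DY_m. Qed.

Lemma sapd_dist_measurable k (c c' : R) : measurable_fun setT
  (fun w => c * enorm (X w k - xs) ^+ 2 + c' * enorm (Y w k - ys) ^+ 2).
Proof.
have [mX mY] := XY_m k.
apply: (measurable_wrt_fun (@history_gen_measurable k k)).
by apply: measurable_wrtD; apply: measurable_wrt_scale; apply: measurable_wrt_sq;
  exact: subc_m.
Qed.

Lemma sapd_path w : (forall k, Y w k.+1 = proxg a pb (Y w k + sigma a *:
    (dual_grad pb (X w) (Y w) k + theta a *: momentum pb (X w) (Y w) k
     + dual_noise a (DY w) k))) /\
  (forall k, X w k.+1 = proxf a pb (X w k - tau a *:
    (gradx (pPhi pb) (X w k, Y w k.+1) + DX w k))).
Proof. by split; [exact: Y_step | exact: X_step]. Qed.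

End sapd_process.

(** * Exponential moments of the energy *)

Section exponential_moment_step.
Context {d : measure_display} {T : measurableType d} {R : realType}.
Context {P : probability T R}.
Variables (G1 G2 : set (set T)).
Hypotheses (G1_meas : G1 `<=` @measurable _ T) (G2_meas : G2 `<=` @measurable _ T).
Hypothesis G12 : <<s G1 >> `<=` <<s G2 >>.
Variables (m n : nat) (ey : T -> 'rV[R]_n) (ex : T -> 'rV[R]_m) (deltax deltay : R).
Hypotheses (dx0 : 0 < deltax) (dy0 : 0 < deltay).
Hypotheses (ey0 : condexp_eq0 P <<s G1 >> ey) (ex0 : condexp_eq0 P <<s G2 >> ex).
Hypothesis ey_tail : forall t, 0 <= t ->
  condprob_le P <<s G1 >> [set w | t <= enorm (ey w)]
    (2 * expR (- t ^+ 2 / (2 * deltay ^+ 2))).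
Hypothesis ex_tail : forall t, 0 <= t ->
  condprob_le P <<s G2 >> [set w | t <= enorm (ex w)]
    (2 * expR (- t ^+ 2 / (2 * deltax ^+ 2))).
Hypothesis ey_meas : vec_measurable G2 ey.
Variables (U' U : T -> R) (A : T -> 'rV[R]_n) (B : T -> 'rV[R]_m) (r K c : R).
Hypotheses (K0 : 0 <= K) (U0 : forall w, 0 <= U w).
Hypotheses (mU' : measurable_fun setT U') (mU : measurable_wrt <<s G1 >> U).
Hypotheses (mA : vec_measurable G1 A) (mB : vec_measurable G1 B).
Hypothesis step : forall w, U' w <= r * U w + dot (ey w) (A w) + dot (ex w) (B w)
  + K * (enorm (ey w) ^+ 2 + enorm (ex w) ^+ 2).
Hypothesis drift : forall w, enorm (A w) ^+ 2 + enorm (B w) ^+ 2 <= c * U w.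

Let step_arith (l u' u da db a2 b2 : R) : 0 <= l ->
  u' <= r * u + da + db + K * (a2 + b2) ->
  l * u' <= (l * r * u + l * da + l * K * a2) + (l * db + l * K * b2).
Proof. by move=> l0 h; apply: le_trans (ler_wpM2l l0 h) _; apply: ler_eq; ring. Qed.

Let drift_arith (l s u a2 b2 p q : R) : 0 <= l -> 0 <= u -> 0 <= a2 -> 0 <= b2 ->
  0 <= p -> 0 <= q -> a2 + b2 <= c * u -> 76 * l * c * (p + q) <= s ->
  (l * r * u + 76 * (l ^+ 2 * b2 * p) + 18 * (l * K) * p)
    + (76 * (l ^+ 2 * a2 * q) + 18 * (l * K) * q)
  <= l * (r + s) * u + 18 * l * K * (p + q).
Proof.
move=> l0 u0 a0 b0 p0 q0 hd hs.
have h1 : 76 * l * (p + q) * (a2 + b2) <= 76 * l * (p + q) * (c * u).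
  by apply: ler_wpM2l => //; rewrite mulr_ge0 ?addr_ge0 // mulr_ge0.
have h2 := ler_wpM2l l0 (ler_wpM2r u0 hs).
have {}h1 := ler_wpM2l l0 h1.
have h3 : 0 <= 76 * l ^+ 2 * (b2 * q + a2 * p).
  by rewrite mulr_ge0 ?addr_ge0 ?mulr_ge0 ?sqr_ge0.
by lra.
Qed.

(** The primal noise is drawn last, so it is averaged out first, with the dual
    noise kept as a weight. The drifts are dominated by the energy itself,
    which is why the exponential moment closes on [U] with a slightly larger
    contraction factor. *)
Lemma exponential_moment_step (l s : R) : 0 <= l ->
  8 * (l * K) * deltax ^+ 2 <= 1 -> 8 * (l * K) * deltay ^+ 2 <= 1 ->
  76 * l * c * (deltax ^+ 2 + deltay ^+ 2) <= s ->
  (\int[P]_w (expR (l * U' w))%:E <=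
   \int[P]_w (expR (l * (r + s) * U w
                    + 18 * l * K * (deltax ^+ 2 + deltay ^+ 2)))%:E)%E.
Proof.
move=> l0 kx ky ls; have lK0 : 0 <= l * K := mulr_ge0 l0 K0.
pose W1 w := expR (l * r * U w + 76 * (l ^+ 2 * enorm (B w) ^+ 2 * deltax ^+ 2)
                   + 18 * (l * K) * deltax ^+ 2).
pose W2 w := expR (l * r * U w + l * dot (ey w) (A w) + l * K * enorm (ey w) ^+ 2).
have up k (Z : T -> 'rV[R]_k) : vec_measurable G1 Z -> vec_measurable G2 Z.
  by move=> mZ i D mD; apply: G12; exact: mZ.
have mU2 : measurable_wrt <<s G2 >> U by move=> D mD; apply: G12; exact: mU.
have mW2 : measurable_wrt <<s G2 >> W2.
  apply: measurable_wrt_expR; apply: measurable_wrtD; first apply: measurable_wrtD.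
  - exact: measurable_wrt_scale.
  - by apply: measurable_wrt_scale; apply: measurable_wrt_dot => //; exact: up.
  by apply: measurable_wrt_scale; exact: measurable_wrt_sq.
have mW1 : measurable_wrt <<s G1 >> W1.
  apply: measurable_wrt_expR; apply: measurable_wrtD; last exact: measurable_wrt_cst.
  apply: measurable_wrtD; first exact: measurable_wrt_scale.
  apply: measurable_wrt_scale; apply: measurable_wrtM; last exact: measurable_wrt_cst.
  by apply: measurable_wrt_scale; exact: measurable_wrt_sq.
have hx := subgaussian_mgf G2_meas dx0 ex0 ex_tail
  (vec_measurableZ l (up _ _ mB)) lK0 kx mW2 (fun w => expR_ge0 _).
have hy := subgaussian_mgf G1_meas dy0 ey0 ey_tail
  (vec_measurableZ l mA) lK0 ky mW1 (fun w => expR_ge0 _).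
have mono (f g : T -> R) : measurable_fun setT f -> measurable_fun setT g ->
    (forall w, 0 <= f w <= g w) ->
    (\int[P]_w (f w)%:E <= \int[P]_w (g w)%:E)%E.
  move=> mf mg fg; apply: ge0_le_integral => //.
  - by move=> w _; rewrite lee_fin; case/andP: (fg w).
  - exact/measurable_EFinP.
  - exact/measurable_EFinP.
  - by move=> w _; rewrite lee_fin; case/andP: (fg w).
have mf2 := measurable_wrt_fun G2_meas; have mf1 := measurable_wrt_fun G1_meas.
have coord G k (Z : T -> 'rV[R]_k) : G `<=` @measurable _ T ->
    vec_measurable G Z -> forall i, measurable_fun [set: T] (fun w => Z w 0 i).
  by move=> Gm mZ i; exact: measurable_wrt_fun Gm _ (mZ i).
have mexp (f : T -> R) : measurable_fun setT f -> measurable_fun setT (fun w => expR (f w)).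
  by move=> mf; exact: (measurableT_comp (@measurable_expR R) mf).
have mEy c' : measurable_fun setT (fun w => c' * enorm (ey w) ^+ 2).
  by apply: measurable_funM => //; exact: measurable_noise_sq ey0.
have mEx c' : measurable_fun setT (fun w => c' * enorm (ex w) ^+ 2).
  by apply: measurable_funM => //; exact: measurable_noise_sq ex0.
have mDx := measurable_noise_dot ex0 (coord _ _ _ G2_meas (vec_measurableZ l (up _ _ mB))).
have mDy := measurable_noise_dot ey0 (coord _ _ _ G1_meas (vec_measurableZ l mA)).
have mA2 : measurable_fun setT
    (fun w => 76 * (enorm (l *: A w) ^+ 2 * deltay ^+ 2) + 18 * (l * K) * deltay ^+ 2).
  apply: mf1; apply: measurable_wrtD; last exact: measurable_wrt_cst.
  apply: measurable_wrt_scale; apply: measurable_wrtM; last exact: measurable_wrt_cst.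
  by apply: measurable_wrt_sq; exact: vec_measurableZ.
have mB2 : measurable_fun setT
    (fun w => 76 * (enorm (l *: B w) ^+ 2 * deltax ^+ 2) + 18 * (l * K) * deltax ^+ 2).
  apply: mf1; apply: measurable_wrtD; last exact: measurable_wrt_cst.
  apply: measurable_wrt_scale; apply: measurable_wrtM; last exact: measurable_wrt_cst.
  by apply: measurable_wrt_sq; exact: vec_measurableZ.
have norm2 k (v : 'rV[R]_k) : enorm (l *: v) ^+ 2 = l ^+ 2 * enorm v ^+ 2.
  by rewrite enormZ exprMn real_normK // num_real.
apply: le_trans (le_trans hx _).
  apply: mono.
  - by apply: mexp; exact: measurable_funM.
  - apply: measurable_funM; first exact: mf2.
    by apply: mexp; exact: measurable_funD.
  - move=> w; rewrite expR_ge0 -expRD ler_expR /= dotZl (dotC (B w)).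
    exact: step_arith (step w).
apply: le_trans (le_trans hy _).
  apply: mono.
  - by apply: measurable_funM; [exact: mf2 | exact: mexp].
  - apply: measurable_funM; first exact: mf1.
    by apply: mexp; exact: measurable_funD.
  - move=> w; rewrite mulr_ge0 ?expR_ge0 //= -!expRD ler_expR.
    by rewrite dotZl (dotC (A w)) norm2; apply: ler_eq; ring.
apply: mono.
- by apply: measurable_funM; [exact: mf1 | exact: mexp].
- apply: mexp; apply: measurable_funD => //; apply: measurable_funM => //.
  exact: mf1.
move=> w; rewrite mulr_ge0 ?expR_ge0 //= -expRD ler_expR norm2.
by apply: drift_arith; rewrite ?sqr_ge0 // U0.
Qed.

End exponential_moment_step.

Lemma markov_quantile {d : measure_display} {T : measurableType d} {R : realType}
    (P : probability T R) (Z : T -> R) (M p : R) :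
  measurable_fun setT Z -> (forall w, 0 <= Z w) -> 0 < M ->
  (\int[P]_w (Z w)%:E <= M%:E)%E -> 0 <= p < 1 ->
  (p%:E <= P [set w | (Z w <= M / (1 - p))%R])%E.
Proof.
move=> mZ Z0 M0 ZM /andP[p0 p1].
have q0 : 0 < 1 - p by rewrite subr_gt0.
set e := M / (1 - p); have e0 : 0 < e by rewrite divr_gt0.
pose A := [set w | e < Z w].
have mA : measurable A.
  rewrite -[A]setTI; have -> : A = Z @^-1` `]e, +oo[%classic.
    by apply/seteqP; split => w /=; rewrite in_itv /= andbT.
  exact: mZ.
have -> : [set w | Z w <= e] = ~` A.
  apply/seteqP; split => w /=; rewrite /A /=.
    by move=> h; apply/negP; rewrite -leNgt.
  by move/negP; rewrite -leNgt.
have hA : (e%:E * P A <= M%:E)%E.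
  apply: le_trans ZM; rewrite -(integral_cst P mA).
  apply: (@le_trans _ _ (\int[P]_(w in A) (Z w)%:E)%E).
    apply: ge0_le_integral => //.
    - by move=> w _; rewrite lee_fin ltW.
    - by apply/measurable_EFinP; exact: measurable_funS mZ.
    - by move=> w /= h; rewrite lee_fin ltW.
  apply: ge0_subset_integral => //; first exact/measurable_EFinP.
  by move=> w _; rewrite lee_fin.
rewrite probability_setC //.
have Pfin : P A \is a fin_num by exact: fin_num_measure.
rewrite -(fineK Pfin) -EFinB lee_fin lerBrDr -lerBrDl.
move: hA; rewrite -(fineK Pfin) -EFinM lee_fin.
by rewrite -ler_pdivlMl // /e invf_div divfK ?gt_eqF.
Qed.

Section exponential_moments.
Context {R : realType} {m n : nat} {d d1 d2 : measure_display}.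
Context {T : measurableType d} {P : probability T R}.
Context {Wx : measurableType d1} {Wy : measurableType d2}.
Variables (a : algo_params R) (pp : problem_params R) (pb : problem R m n).
Variables (o : stoch_oracle m n P Wx Wy) (x0 : 'rV[R]_m) (y0 : 'rV[R]_n).
Variables (xs : 'rV[R]_m) (ys : 'rV[R]_n) (deltax deltay : R).
Hypotheses (pp_valid : valid_problem_params pp) (a_adm : admissible a pp).
Hypotheses (Hpb : problem_assumption pp pb) (saddle : saddle_point pb xs ys).
Hypotheses (x0_dom : edom (pf pb) x0) (y0_dom : edom (pg pb) y0).
Hypothesis noise : noise_assumption pb o a x0 y0 deltax deltay.

Definition sapd_energy w k := noisy_energy a pp pb xs ys
  (sapd_x pb o a x0 y0 ^~ w) (sapd_y pb o a x0 y0 ^~ w)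
  (noise_y pb o a x0 y0 ^~ w) (noise_x pb o a x0 y0 ^~ w) k.
Local Notation U := sapd_energy.

Definition contraction : R := (1 + rho a) / 2.
(** The reciprocal of the largest exponent that the recursion supports, per unit
    of noise variance: 8 comes from [subgaussian_mgf], and 152 is twice the 76 of
    that lemma because half of the gap [1 - rho a] is given away. The term [4^-1]
    keeps it positive. *)
Definition moment_cst : R :=
  152 * variance_cst a pp / (1 - rho a) + 8 * noise_cst a pp + 4^-1.
(** The fixed point of the recursion on exponents: the increment 18 of one step
    divided by the remaining gap [(1 - rho a) / 2]. *)
Definition noise_level : R := 36 * noise_cst a pp / (1 - rho a).

Let D2 := deltax ^+ 2 + deltay ^+ 2.
Let dx0 := deltax_gt0 noise. Let dy0 := deltay_gt0 noise.
Let D20 : 0 < D2. Proof. by rewrite addr_gt0 ?exprn_gt0. Qed.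
Let r0 : 0 < rho a. Proof. by case: a_adm => _ _ /andP[]. Qed.
Let r1 : rho a < 1. Proof. by case: a_adm => _ _ /andP[]. Qed.

Lemma noise_variance_cst_ge0 : 0 <= noise_cst a pp /\ 0 <= variance_cst a pp.
Proof.
have [_ _ [_ _ s0 _] [_ m0]] := constants_ge0 pp_valid a_adm.
have e0 := ltW (stepsize_gt0 a_adm).
split; first by apply: (mulr_ge0 e0); apply: (addr_ge0 m0); exact: mulr_ge0.
by apply: mulr_ge0; [exact: mulr_ge0 | exact: (addr_ge0 (sqr_ge0 _) (sqr_ge0 _))].
Qed.

Let U_ge0 w k : 0 <= U w k.
Proof.
have [ystep xstep] := sapd_path a pb o x0 y0 w.
exact (noisy_energy_ge0 pp_valid a_adm Hpb saddle x0_dom y0_dom ystep xstep k).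
Qed.

Let K := noise_cst a pp.
Let c := variance_cst a pp.
Let r := contraction.

Let gen_meas i j := @history_gen_measurable _ _ _ _ _ _ _ _ _ _ o i j.
Let U_adapted k := @noisy_energy_measurable _ _ _ _ _ _ _ _ _ _ a pp pb o x0 y0 xs ys
  deltax deltay pp_valid a_adm Hpb x0_dom y0_dom noise k.

Let mU k : measurable_fun setT (fun w => U w k).
Proof. exact (measurable_wrt_fun (@gen_meas k k) (@U_adapted k)). Qed.

Let energy_moment_step k l : 0 <= l -> 8 * (l * K) * deltax ^+ 2 <= 1 ->
  8 * (l * K) * deltay ^+ 2 <= 1 -> 76 * l * c * D2 <= (1 - rho a) / 2 ->
  (\int[P]_w (expR (l * U w k.+1))%:E <=
   \int[P]_w (expR (l * r * U w k + 18 * l * K * D2))%:E)%E.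
Proof.
move=> l0 kx ky kc.
have st w : U w k.+1 <= rho a * U w k
    + dot (noise_y pb o a x0 y0 k w)
       (dual_drift a pb ys (sapd_x pb o a x0 y0 ^~ w) (sapd_y pb o a x0 y0 ^~ w) k)
    + dot (noise_x pb o a x0 y0 k w)
       (primal_drift a pb xs (sapd_x pb o a x0 y0 ^~ w) (sapd_y pb o a x0 y0 ^~ w) k)
    + K * (enorm (noise_y pb o a x0 y0 k w) ^+ 2 + enorm (noise_x pb o a x0 y0 k w) ^+ 2).
  have [ystep xstep] := sapd_path a pb o x0 y0 w.
  exact (noisy_energy_step pp_valid a_adm Hpb saddle x0_dom y0_dom ystep xstep k).
have dr w : enorm (dual_drift a pb ys (sapd_x pb o a x0 y0 ^~ w)
       (sapd_y pb o a x0 y0 ^~ w) k) ^+ 2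
     + enorm (primal_drift a pb xs (sapd_x pb o a x0 y0 ^~ w)
         (sapd_y pb o a x0 y0 ^~ w) k) ^+ 2 <= c * U w k.
  have [ystep xstep] := sapd_path a pb o x0 y0 w.
  exact (drift_le pp_valid a_adm Hpb saddle x0_dom y0_dom ystep xstep k).
have -> : r = rho a + (1 - rho a) / 2 by rewrite /r /contraction; field.
have G12 := @history_mono _ _ _ _ _ _ _ _ _ _ o _ _ _ _ (leqnSn k) (leqnn k).
exact (exponential_moment_step (@gen_meas k k)
  (@gen_meas k.+1 k) G12 dx0 dy0
  (noise_y_unbiased noise k) (noise_x_unbiased noise k)
  (noise_y_tail noise k) (noise_x_tail noise k)
  (@noise_y_measurable _ _ _ _ _ _ _ _ _ _ a pp pb o x0 y0
     deltax deltay pp_valid a_adm Hpb x0_dom y0_dom noise k)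
  noise_variance_cst_ge0.1 (U_ge0 ^~ k)
  (measurable_wrt_fun (@gen_meas k.+1 k.+1) (@U_adapted k.+1)) (@U_adapted k)
  (@dual_drift_measurable _ _ _ _ _ _ _ _ _ _ a pp pb o x0 y0 ys
     deltax deltay pp_valid a_adm Hpb x0_dom y0_dom noise k)
  (@primal_drift_measurable _ _ _ _ _ _ _ _ _ _ a pp pb o x0 y0 xs
     deltax deltay pp_valid a_adm Hpb x0_dom y0_dom noise k)
  st dr l0 kx ky kc).
Qed.

Let moment_arith (l p q : R) : 0 <= l -> 0 <= p -> 0 <= q ->
  l * moment_cst * (p + q) <= 1 ->
  [/\ 8 * (l * K) * p <= 1, 8 * (l * K) * q <= 1
    & 76 * l * c * (p + q) <= (1 - rho a) / 2].
Proof.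
have [K0 c0] := noise_variance_cst_ge0; rewrite -/K -/c in K0 c0.
have e0 : 0 < 1 - rho a by rewrite subr_gt0.
have cM : 152 * c / (1 - rho a) <= moment_cst.
  rewrite /moment_cst -/c -/K -addrA lerDl.
  by apply: addr_ge0; [exact: mulr_ge0| rewrite invr_ge0].
have KM : 8 * K <= moment_cst.
  have h := divr_ge0 (mulr_ge0 (ler0n _ 152) c0) (ltW e0).
  rewrite /moment_cst -/c -/K addrAC lerDr.
  by apply: addr_ge0; rewrite ?invr_ge0.
move=> l0 p0 q0 h.
have h1 : 8 * K * (l * (p + q)) <= moment_cst * (l * (p + q)).
  by apply: (ler_wpM2r _ KM); rewrite mulr_ge0 ?addr_ge0.
have h2 : 152 * c / (1 - rho a) * (l * (p + q)) <= moment_cst * (l * (p + q)).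
  by apply: (ler_wpM2r _ cM); rewrite mulr_ge0 ?addr_ge0.
have lK := mulr_ge0 l0 K0; have lKp := mulr_ge0 lK p0; have lKq := mulr_ge0 lK q0.
split; [lra | lra |].
have {}h2 : 152 * c * (l * (p + q)) / (1 - rho a) <= 1 by lra.
by move: h2; rewrite ler_pdivrMr // mul1r; lra.
Qed.

Let fixed_point (l q : R) (k : nat) :
  18 * l * K * D2 + l * r * (r ^+ k * q + noise_level * D2)
  = l * (r ^+ k.+1 * q + noise_level * D2).
Proof.
rewrite exprS /noise_level -/K /r /contraction; field.
by rewrite subr_eq0 eq_sym lt_eqF.
Qed.

Let r_ge0 : 0 <= r. Proof. by rewrite divr_ge0 // addr_ge0 // ltW. Qed.
Let r_le1 : r <= 1. Proof. by rewrite ler_pdivrMr // mul1r lerD2l ltW. Qed.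

Lemma moment_cst_ge : 4^-1 <= moment_cst.
Proof.
have [K0 c0] := noise_variance_cst_ge0; have e0 : 0 <= 1 - rho a by rewrite subr_ge0 ltW.
have h := divr_ge0 (mulr_ge0 (ler0n _ 152) c0) e0.
by rewrite lerDr; exact: addr_ge0 h (mulr_ge0 (ler0n _ 8) K0).
Qed.

Let moment_cst_gt0 : 0 < moment_cst.
Proof. by apply: lt_le_trans moment_cst_ge; rewrite invr_gt0. Qed.

Let noise_level_ge0 : 0 <= noise_level * D2.
Proof.
have [K0 c0] := noise_variance_cst_ge0; have e0 : 0 <= 1 - rho a by rewrite subr_ge0 ltW.
exact (mulr_ge0 (divr_ge0 (mulr_ge0 (ler0n _ 36) K0) e0) (ltW D20)).
Qed.

Let mexpU l k : measurable_fun setT (fun w => expR (l * U w k)).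
Proof.
apply: (measurableT_comp (@measurable_expR R)).
exact: measurable_funM.
Qed.

(** The one-step bound trades the exponent [l] for the smaller [l * r], so a
    single restriction on the initial exponent serves all iterations. *)
Lemma energy_moment u0 k l : 0 <= l -> l * moment_cst * D2 <= 1 -> 0 <= u0 ->
  (forall w, U w 0 <= u0) ->
  (\int[P]_w (expR (l * U w k))%:E <=
   (expR (l * (r ^+ k * u0 + noise_level * D2)))%:E)%E.
Proof.
move=> + + u00 U0; elim: k l => [|k IH] l l0 lM.
  have -> : (expR (l * (r ^+ 0 * u0 + noise_level * D2)))%:E =
     (\int[P]_w cst (expR (l * (r ^+ 0 * u0 + noise_level * D2)))%:E w)%E.
    rewrite integral_cst // -[LHS]mule1; congr (_ * _)%E.
  exact/esym/(@probability_setT _ _ _ P).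
  apply: ge0_le_integral; first exact: measurableT.
  - by move=> w _; rewrite lee_fin expR_ge0.
  - exact/measurable_EFinP.
  - exact: measurable_cst.
  - move=> w _; rewrite lee_fin ler_expR expr0 mul1r; apply: ler_wpM2l => //.
    by apply: le_trans (U0 w) _; rewrite lerDl.
have [kx ky kc] := moment_arith l0 (sqr_ge0 _) (sqr_ge0 _) lM.
apply: le_trans (energy_moment_step k l0 kx ky kc) _.
have -> : (\int[P]_w (expR (l * r * U w k + 18 * l * K * D2))%:E =
    (expR (18 * l * K * D2))%:E * \int[P]_w (expR (l * r * U w k))%:E)%E.
  rewrite -ge0_integralZl_EFin ?expR_ge0 //; last exact/measurable_EFinP.
  by apply: eq_integral => w _; rewrite -EFinM -expRD addrC.
have lr0 : 0 <= l * r by rewrite mulr_ge0.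
have lrM : l * r * moment_cst * D2 <= 1.
  apply: le_trans lM; rewrite ler_pM2r // ler_pM2r //.
  by rewrite ler_piMr.
apply: le_trans (lee_wpmul2l _ (IH _ lr0 lrM)) _; first by rewrite lee_fin expR_ge0.
by rewrite -EFinM -expRD fixed_point.
Qed.

Local Notation D k w := (sapd_D pb o a x0 y0 xs ys k w).

Let D_le k w : D k w <= 2 * U w k.
Proof.
have [ystep xstep] := sapd_path a pb o x0 y0 w.
exact (dist_le_noisy_energy pp_valid a_adm Hpb saddle x0_dom y0_dom ystep xstep k).
Qed.

Definition initial_cst : R := 1 + tau a * mux pp + sigma a * muy pp.

Let U0_le w : U w 0 <= initial_cst * sapd_D_init a x0 y0 xs ys.
Proof. exact: noisy_energy0. Qed.

Let convexity_arith (l u v : R) : expR (l / 2 * (u + v)) <= (expR (l * u) + expR (l * v)) / 2.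
Proof.
have -> : l / 2 * (u + v) = l * u / 2 + l * v / 2 by field.
have e (x : R) : expR x = expR (x / 2) ^+ 2 by rewrite -expRM_natl; congr expR; field.
rewrite expRD (e (l * u)) (e (l * v)) ler_pdivlMr //.
move: (expR (_ / _)) (expR (_ / _)) => x y.
by have := sqr_ge0 (x - y); lra.
Qed.

Let quantile_arith (l u v b t : R) : 0 < l -> 0 < t ->
  expR (l / 2 * (u + v)) <= expR (l * b) / t ->
  u + v <= 2 * b + 2 / l * ln (1 / t).
Proof.
move=> l0 t0; rewrite div1r -{1}(@lnK R t^-1) ?posrE ?invr_gt0 //.
rewrite -expRD ler_expR => h; rewrite -(ler_pM2l (x := l / 2)) ?divr_gt0 //.
apply: le_trans h _; apply: ler_eq; field; by rewrite gt_eqF.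
Qed.

(** Markov's inequality for an exponential of the average of two consecutive
    energies, which convexity reduces to the moments of each of them. *)
Lemma sapd_tail k p : 0 <= p < 1 ->
  (p%:E <= P [set w | (D k.+1 w + D k w <=
     4 * (r ^+ k * (initial_cst * sapd_D_init a x0 y0 xs ys) + noise_level * D2)
     + 4 * (moment_cst * D2) * ln (1 / (1 - p)))%R])%E.
Proof.
move=> p01; set u0 := initial_cst * _.
pose l := (moment_cst * D2)^-1; have l0 : 0 < l by rewrite invr_gt0 mulr_gt0.
have lM : l * moment_cst * D2 <= 1.
  by rewrite -mulrA mulVf // gt_eqF // mulr_gt0.
have u00 : 0 <= u0 by apply: le_trans (U_ge0 point 0) (U0_le point).
pose b := r ^+ k * u0 + noise_level * D2.
have b1 : r ^+ k.+1 * u0 + noise_level * D2 <= b.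
  rewrite lerD2r ler_wpM2r // exprS ler_piMl // exprn_ge0 //.
pose Z w := expR (l / 2 * (U w k.+1 + U w k)).
have mZ : measurable_fun setT Z.
  apply: (measurableT_comp (@measurable_expR R)).
  by apply: measurable_funM => //; exact: measurable_funD.
have EU j : (\int[P]_w (expR (l * U w j))%:E <=
    (expR (l * (r ^+ j * u0 + noise_level * D2)))%:E)%E.
  exact: energy_moment (ltW l0) lM u00 U0_le.
have EZ : (\int[P]_w (Z w)%:E <= (expR (l * b))%:E)%E.
  apply: (@le_trans _ _ (\int[P]_w ((2^-1)%:E *
      ((expR (l * U w k.+1))%:E + (expR (l * U w k))%:E)))%E).
    apply: ge0_le_integral; first exact: measurableT.
    - by move=> w _; rewrite lee_fin expR_ge0.
    - exact/measurable_EFinP.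
    - apply: emeasurable_funM; first exact: measurable_cst.
      by apply: emeasurable_funD; exact/measurable_EFinP.
    - move=> w _; rewrite -EFinD -EFinM lee_fin mulrC; exact: convexity_arith.
  have e2 : (0 <= 2^-1 :> R)%R by rewrite invr_ge0.
  rewrite ge0_integralZl_EFin //; last 2 first.
  - by move=> w _; rewrite adde_ge0 // lee_fin expR_ge0.
  - by apply: emeasurable_funD; exact/measurable_EFinP.
  rewrite ge0_integralD //; try exact/measurable_EFinP.
  have h : (expR (l * (r ^+ k.+1 * u0 + noise_level * D2)) <= expR (l * b))%R.
    by rewrite ler_expR ler_wpM2l // ltW.
  have E1 := le_trans (EU k.+1) (_ : _ <= (expR (l * b))%:E)%E.
  have {}E1 := E1 ltac:(by rewrite lee_fin).
  apply: le_trans (lee_wpmul2l _ (leeD E1 (EU k))) _; first by rewrite lee_fin.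
  by rewrite -EFinD -EFinM lee_fin -/b; apply: ler_eq; field.
have hq := markov_quantile mZ (fun w => expR_ge0 _) (expR_gt0 _) EZ p01.
apply: le_trans hq _; apply: le_measure; rewrite ?inE.
- have -> : [set w | Z w <= expR (l * b) / (1 - p)] =
      Z @^-1` `]-oo, expR (l * b) / (1 - p)]%classic.
    by apply/seteqP; split => w /=; rewrite in_itv.
  by rewrite -[X in measurable X]setTI; exact: mZ.
- set q := 4 * _ + _.
  have -> : [set w | D k.+1 w + D k w <= q] =
      (fun w => D k.+1 w + D k w) @^-1` `]-oo, q]%classic.
    by apply/seteqP; split => w /=; rewrite in_itv.
  rewrite -[X in measurable X]setTI.
  have mD j : measurable_fun setT (fun w => D j w).
    exact (@sapd_dist_measurable _ _ _ _ _ _ _ _ _ _ a pp pb o x0 y0 xs ys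
      deltax deltay pp_valid a_adm Hpb x0_dom y0_dom noise j _ _).
  by apply: (measurable_funD (mD k.+1) (mD k)) => //.
move=> w /= Zw.
have t0 : 0 < 1 - p by rewrite subr_gt0; case/andP: p01.
have := quantile_arith l0 t0 Zw; rewrite /l invrK => h.
apply: le_trans (lerD (D_le _ _) (D_le _ _)) _; rewrite -mulrDr.
by apply: le_trans (ler_wpM2l _ h) _ => //; apply: ler_eq; rewrite /b; ring.
Qed.

End exponential_moments.

(** * The regime of vanishing step sizes *)

Section chambolle_pock_regime.
Context {R : realType}.
Variable pp : problem_params R.
Hypothesis pp_valid : valid_problem_params pp.
Local Notation a th := (chambolle_pock pp th).

Let mux0 : 0 < mux pp. Proof. by case: pp_valid => -[]. Qed.
Let muy0 : 0 < muy pp. Proof. by case: pp_valid => -[]. Qed.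

Lemma near_left1 : \forall th \near (1 : R)^'-, 2^-1 <= th < 1.
Proof.
near=> th; apply/andP; split; last by near: th; exact: nbhs_left_lt.
apply/ltW; near: th; apply: nbhs_left_gt.
by rewrite invf_lt1 // ltr1n.
Unshelve. all: by end_near. Qed.

Lemma near_left1_large (mu M : R) : 0 < mu ->
  \forall th \near (1 : R)^'-, M <= th * mu / (1 - th).
Proof.
move=> mu0; pose N := Num.max M 1; have N0 : 0 < N by rewrite lt_max ltr01 orbT.
have MN : M <= N by rewrite le_max lexx.
near=> th.
have /andP[h1 h2] : 2^-1 <= th < 1 by near: th; exact: near_left1.
have h3 : 1 - mu / (2 * N) < th.
  by near: th; apply: nbhs_left_gt; rewrite gtrBl divr_gt0 // mulr_gt0.
have e0 : 0 < 1 - th by rewrite subr_gt0.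
apply: (le_trans MN); rewrite ler_pdivlMr //.
have : (1 - th) * N <= mu / 2.
  have : (1 - th) * N <= mu / (2 * N) * N by rewrite ler_pM2r //; lra.
  by move/le_trans; apply; apply: ler_eq; field; rewrite gt_eqF.
have : 2^-1 * mu <= th * mu by rewrite ler_pM2r.
lra.
Unshelve. all: by end_near. Qed.

(** In this regime the first row of the matrix vanishes and so does the second;
    the step sizes tend to zero, so the diagonal of the remaining block grows
    without bound and dominates its off-diagonal entries. *)
Lemma chambolle_pock_admissible :
  \forall th \near (1 : R)^'-, admissible (a th) pp.
Proof.
have [_ L1 L2 L3 /ltW L4] := pp_valid.
near=> th.
have /andP[h1 h2] : 2^-1 <= th < 1 by near: th; exact: near_left1.
have th0 : 0 < th by lra.
have e0 : 0 < 1 - th by rewrite subr_gt0.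
have hx : Lxx pp + Lyx pp <= th * mux pp / (1 - th).
  by near: th; exact: near_left1_large.
have hy : 2 * (Lyx pp + 2 * Lyy pp) <= th * muy pp / (1 - th).
  by near: th; exact: near_left1_large.
set s := (1 - th) / (th * muy pp); set t := (1 - th) / (th * mux pp).
have s0 : 0 < s by rewrite divr_gt0 // mulr_gt0.
have t0 : 0 < t by rewrite divr_gt0 // mulr_gt0.
have sV : s^-1 = th * muy pp / (1 - th) by rewrite invf_div.
have tV : t^-1 = th * mux pp / (1 - th) by rewrite invf_div.
have sq1 : Num.sqrt th <= 1 by rewrite -sqrtr1 ler_wsqrtr // ltW.
have sqL : 0 <= Num.sqrt th * Lyy pp <= Lyy pp.
  by rewrite mulr_ge0 ?sqrtr_ge0 // ler_piMl.
have alE : (2 * s)^-1 = s^-1 / 2 by rewrite invfM mulrC.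
have al0 : Lyx pp + Lyy pp <= (2 * s)^-1 - Num.sqrt th * Lyy pp.
  by move: sqL => /andP[_]; rewrite alE sV; lra.
suff mi : psd (MI_matrix (a th) pp).
  split; rewrite /= -/s -/t //.
  - exact: ltW.
  - by rewrite th0.
  - rewrite (le_trans _ al0) ?addr_ge0 //= ltrBlDr.
    have sV0 : 0 < s^-1 by rewrite invr_gt0.
    by rewrite alE; case/andP: sqL => sqL _; lra.
apply/psd_MI_matrixP => /= v1 v2 v3 v4 v5; rewrite /= -/s -/t divff ?gt_eqF //.
have -> : t^-1 + mux pp - (th * t)^-1 = 0.
  by rewrite /t; field; rewrite !gt_eqF.
have -> : s^-1 + muy pp - (th * s)^-1 = 0.
  by rewrite /s; field; rewrite !gt_eqF.
rewrite subrr mulr0 !mul0r !add0r mulr1.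
have ax : Lyx pp <= t^-1 - Lxx pp by rewrite tV; lra.
have ay : Lyy pp <= s^-1 - ((2 * s)^-1 - Num.sqrt th * Lyy pp).
  by rewrite alE; case/andP: sqL => sqL _; rewrite sV; lra.
have aq : Lyx pp + Lyy pp <= ((2 * s)^-1 - Num.sqrt th * Lyy pp) / th.
  rewrite ler_pdivlMr //; apply: le_trans al0; rewrite ler_piMr ?addr_ge0 ?(ltW h2) //.
have k1 := ler_wpM2r (sqr_ge0 v3) ax; have k2 := ler_wpM2r (sqr_ge0 v4) ay.
have k3 := ler_wpM2r (sqr_ge0 v5) aq.
have k4 := mulr_ge0 L4 (sqr_ge0 (v3 - v5)); have k5 := mulr_ge0 L2 (sqr_ge0 (v4 - v5)).
move: k1 k2 k3; move: (_ - Lxx pp) (_ - (_ - _)) (_ / th) => p q z.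
lra.
Unshelve. all: by end_near. Qed.

End chambolle_pock_regime.

Section bounded_constants.
Context {R : realType}.
Variable pp : problem_params R.
Hypothesis pp_valid : valid_problem_params pp.
Local Notation a th := (chambolle_pock pp th).

Definition bounded_near1 (f : R -> R) : Prop :=
  exists M, \forall th \near (1 : R)^'-, 0 <= f th <= M.

Let mux0 : 0 < mux pp. Proof. by case: pp_valid => -[]. Qed.
Let muy0 : 0 < muy pp. Proof. by case: pp_valid => -[]. Qed.

Lemma bounded_cst c : 0 <= c -> bounded_near1 (fun=> c).
Proof. by move=> c0; exists c; near=> th; rewrite c0 lexx. Unshelve. all: by end_near. Qed.

Lemma boundedD f g : bounded_near1 f -> bounded_near1 g ->
  bounded_near1 (fun th => f th + g th).
Proof.
move=> [M hM] [N hN]; exists (M + N); near=> th.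
have /andP[f0 fM] : 0 <= f th <= M by near: th.
have /andP[g0 gN] : 0 <= g th <= N by near: th.
by rewrite addr_ge0 // lerD.
Unshelve. all: by end_near. Qed.

Lemma boundedM f g : bounded_near1 f -> bounded_near1 g ->
  bounded_near1 (fun th => f th * g th).
Proof.
move=> [M hM] [N hN]; exists (M * N); near=> th.
have /andP[f0 fM] : 0 <= f th <= M by near: th.
have /andP[g0 gN] : 0 <= g th <= N by near: th.
by rewrite mulr_ge0 // ler_pM.
Unshelve. all: by end_near. Qed.

Lemma boundedX f k : bounded_near1 f -> bounded_near1 (fun th => f th ^+ k).
Proof.
move=> hf; elim: k => [|k IH]; first exact: bounded_cst.
by under eq_fun do rewrite exprS; exact: boundedM.
Qed.

Lemma bounded_near_eq f g : (\forall th \near (1 : R)^'-, f th = g th) ->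
  bounded_near1 g -> bounded_near1 f.
Proof.
move=> fg [M gM]; exists M; near=> th.
have -> : f th = g th by near: th.
by near: th.
Unshelve. all: by end_near. Qed.

Let b_theta : bounded_near1 (fun th => theta (a th)).
Proof.
exists 1; near=> th => /=.
have : 2^-1 <= th < 1 by near: th; exact: near_left1.
by move=> /andP[h1 /ltW ->]; rewrite andbT (le_trans _ h1).
Unshelve. all: by end_near. Qed.

Let b_inv_theta : bounded_near1 (fun th => th^-1).
Proof.
exists 2; near=> th => /=.
have /andP[h1 h2] : 2^-1 <= th < 1 by near: th; exact: near_left1.
have th0 : 0 < th by apply: lt_le_trans h1; rewrite invr_gt0.
by rewrite invr_ge0 (ltW th0) -[leRHS]invrK lef_pV2 ?posrE ?invr_gt0 ?h1 ?h.
Unshelve. all: by end_near. Qed.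

Let b_inv_rho : bounded_near1 (fun th => (rho (a th))^-1).
Proof. exact: b_inv_theta. Qed.

(** Both step sizes are of the order of [1 - th], and so is the gap [1 - rho a] by
    which the constants of the recursion are divided. *)
Definition stepsize_rate th := stepsize (a th) / (1 - th).

Lemma bounded_stepsize_rate : bounded_near1 stepsize_rate.
Proof.
apply: (@bounded_near_eq _ (fun th => th^-1 * ((mux pp)^-1 + (muy pp)^-1))).
  near=> th.
  have /andP[h1 h2] : 2^-1 <= th < 1 by near: th; exact: near_left1.
  have th0 : 0 < th by apply: lt_le_trans h1; rewrite invr_gt0.
  rewrite /stepsize_rate /stepsize /=; field.
  by rewrite !gt_eqF ?subr_gt0.
apply: boundedM; first exact: b_inv_theta.
by apply: bounded_cst; rewrite addr_ge0 // invr_ge0 ltW.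
Unshelve. all: by end_near. Qed.

Let b_stepsize : bounded_near1 (fun th => stepsize (a th)).
Proof.
apply: (@bounded_near_eq _ (fun th => stepsize_rate th * (1 - th))).
  near=> th; have h2 : th < 1 by near: th; exact: nbhs_left_lt.
  by rewrite /stepsize_rate divfK // subr_eq0 gt_eqF.
apply: boundedM; first exact: bounded_stepsize_rate.
exists 1; near=> th; have /andP[h1 h2] : 2^-1 <= th < 1 by near: th; exact: near_left1.
by rewrite subr_ge0 (ltW h2) lerBlDr lerDl (le_trans _ h1).
Unshelve. all: by end_near. Qed.

Lemma dual_gap_chambolle_pock :
  \forall th \near (1 : R)^'-, 2^-1 <= 1 - alpha (a th) * sigma (a th).
Proof.
have [_ L1 L2 L3 /ltW L4] := pp_valid.
near=> th => /=.
have /andP[h1 h2] : 2^-1 <= th < 1 by near: th; exact: near_left1.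
have th0 : 0 < th by apply: lt_le_trans h1; rewrite invr_gt0.
set s := (1 - th) / (th * muy pp).
have s0 : 0 < s by rewrite divr_gt0 ?subr_gt0 // mulr_gt0.
have -> : 1 - ((2 * s)^-1 - Num.sqrt th * Lyy pp) * s =
  2^-1 + Num.sqrt th * Lyy pp * s by field; rewrite gt_eqF.
by rewrite lerDl; exact (mulr_ge0 (mulr_ge0 (sqrtr_ge0 _) L2) (ltW s0)).
Unshelve. all: by end_near. Qed.

Let b_gap : bounded_near1 (fun th => dual_gap (a th)).
Proof.
exists 2; near=> th.
have h : 2^-1 <= 1 - alpha (a th) * sigma (a th).
  by near: th; exact: dual_gap_chambolle_pock.
have h0 : 0 < 1 - alpha (a th) * sigma (a th) by apply: lt_le_trans h; rewrite invr_gt0.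
by rewrite /dual_gap invr_ge0 (ltW h0) -[leRHS]invrK lef_pV2 ?posrE ?invr_gt0 ?h1 ?h.
Unshelve. all: by end_near. Qed.

Let b_lip : bounded_near1 (fun th => lipschitz_step (a th) pp).
Proof.
have [_ L1 L2 /ltW L3 /ltW L4] := pp_valid.
by apply: boundedM => //; apply: bounded_cst; rewrite !addr_ge0.
Qed.

Local Ltac bnd := repeat first
  [ exact: b_theta | exact: b_inv_rho | exact: b_gap | exact: b_lip
  | exact: b_stepsize | exact: bounded_stepsize_rate
  | assumption | (apply: bounded_cst; exact: ler01)
  | (apply: bounded_cst; exact: ler0n)
  | (apply: bounded_cst; rewrite invr_ge0; exact: ler0n)
  | apply: boundedD | apply: boundedM | apply: boundedX ].

Let b_c1 : bounded_near1 (fun th => yhat_cst (a th) pp).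
Proof. by rewrite /yhat_cst; bnd. Qed.
Let b_c2 : bounded_near1 (fun th => xhat_cst (a th) pp).
Proof. by rewrite /xhat_cst; bnd. Qed.
Let b_c3 : bounded_near1 (fun th => yhat2_cst (a th) pp).
Proof. by rewrite /yhat2_cst; bnd. Qed.
Let b_c4 : bounded_near1 (fun th => drift_cst (a th) pp).
Proof. by rewrite /drift_cst; bnd. Qed.
Let b_d2 : bounded_near1 (fun th => xhat_err (a th) pp).
Proof. by rewrite /xhat_err; bnd. Qed.
Let b_d3 : bounded_near1 (fun th => yhat2_err (a th) pp).
Proof. by rewrite /yhat2_err; bnd. Qed.
Let b_d4 : bounded_near1 (fun th => step_err (a th) pp).
Proof. by rewrite /step_err; bnd. Qed.
Let b_d5 : bounded_near1 (fun th => delay_err (a th) pp).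
Proof. by rewrite /delay_err; bnd. Qed.
Let b_m2 : bounded_near1 (fun th => memory2 (a th) pp).
Proof. by rewrite /memory2; bnd. Qed.
Let b_m1 : bounded_near1 (fun th => memory1 (a th) pp).
Proof. by rewrite /memory1; bnd. Qed.

Lemma bounded_noise_level : bounded_near1 (fun th => noise_level (a th) pp).
Proof.
apply: (@bounded_near_eq _ (fun th =>
    36 * (stepsize_rate th * (memory1 (a th) pp + 6 * step_err (a th) pp)))).
  near=> th; rewrite /noise_level /noise_cst /stepsize_rate /=.
  by move: (stepsize _) (memory1 _ _) (step_err _ _) ((1 - th)^-1) => *; ring.
by bnd.
Unshelve. all: by end_near. Qed.

Lemma bounded_moment_cst : bounded_near1 (fun th => moment_cst (a th) pp).
Proof.
apply: (@bounded_near_eq _ (fun th =>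
    152 * (2 * stepsize_rate th * (drift_cst (a th) pp ^+ 2 + xhat_cst (a th) pp ^+ 2))
    + 8 * (stepsize (a th) * (memory1 (a th) pp + 6 * step_err (a th) pp)) + 4^-1)).
  near=> th; rewrite /moment_cst /noise_cst /variance_cst /stepsize_rate /=.
  move: (stepsize _) (memory1 _ _) (step_err _ _) ((1 - th)^-1) => *.
  by move: (drift_cst _ _) (xhat_cst _ _) => *; ring.
by bnd.
Unshelve. all: by end_near. Qed.

Lemma bounded_initial_cst : bounded_near1 (fun th => initial_cst (a th) pp).
Proof.
apply: (@bounded_near_eq _ (fun th => 1 + 2 * (th^-1 * (1 - th)))).
  near=> th; rewrite /initial_cst /=.
  have /andP[h1 h2] : 2^-1 <= th < 1 by near: th; exact: near_left1.
  have th0 : 0 < th by apply: lt_le_trans h1; rewrite invr_gt0.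
  by field; rewrite !gt_eqF.
have b1 : bounded_near1 (fun th => 1 - th).
  exists 1; near=> th; have /andP[h1 h2] : 2^-1 <= th < 1 by near: th; exact: near_left1.
  by rewrite subr_ge0 (ltW h2) lerBlDr lerDl (le_trans _ h1).
by have b2 := b_inv_theta; bnd.
Unshelve. all: by end_near. Qed.

End bounded_constants.

(** * High-probability bounds *)

Lemma eqTheta_cst1 (R : realType) (f : R -> R) (c : R) : 0 < c ->
  (\forall th \near (1 : R)^'-, c <= f th) -> bounded_near1 f ->
  (f : R -> R^o) =Theta_((1 : R)^'-) (cst (1 : R^o)).
Proof.
move=> c0 fc [M fM]; rewrite eqThetaE qualifE; apply/asboolP.
exists (c, Num.max M 1) => /=; first by rewrite c0 lt_max ltr01 orbT.
near=> th; have cf : c <= f th by near: th.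
have /andP[f0 fM'] : 0 <= f th <= M by near: th.
by rewrite normr1 !mulr1 ger0_norm //; split=> //; rewrite le_max fM'.
Unshelve. all: by end_near. Qed.

Lemma limn_esup_le {R : realType} (u : (\bar R)^nat) (L : \bar R) :
  (\forall k \near \oo, (u k <= L)%E) -> (limn_esup u <= L)%E.
Proof.
move=> uL; apply: (@le_trans _ _ (ereal_sup (u @` [set k | (u k <= L)%E]))).
  by apply: ereal_inf_lbound; exists [set k | (u k <= L)%E].
by apply: ge_ereal_sup => _ [k /= kL <-].
Qed.

Section constants.
Context {R : realType}.
Implicit Types (a : algo_params R) (pp : problem_params R).

Definition distance_cst a pp : R := 4 * initial_cst a pp.
Definition variance_weight (i : 'I_3) a pp : R :=
  [:: 1; 1 + 4 * noise_level a pp; 4 * moment_cst a pp]`_i.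

End constants.

Section high_probability_bounds.
Context {R : realType} {m n : nat} {d d1 d2 : measure_display}.
Context {T : measurableType d} {P : probability T R}.
Context {Wx : measurableType d1} {Wy : measurableType d2}.
Variables (a : algo_params R) (pp : problem_params R) (pb : problem R m n).
Variables (o : stoch_oracle m n P Wx Wy) (x0 : 'rV[R]_m) (y0 : 'rV[R]_n).
Variables (xs : 'rV[R]_m) (ys : 'rV[R]_n) (deltax deltay : R).
Hypotheses (pp_valid : valid_problem_params pp) (a_adm : admissible a pp).
Hypotheses (Hpb : problem_assumption pp pb) (saddle : saddle_point pb xs ys).
Hypotheses (x0_dom : edom (pf pb) x0) (y0_dom : edom (pg pb) y0).
Hypothesis noise : noise_assumption pb o a x0 y0 deltax deltay.

Let D2 := deltax ^+ 2 + deltay ^+ 2.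
Local Notation D k w := (sapd_D pb o a x0 y0 xs ys k w).
Local Notation r := (contraction a).

Let mD k : measurable_fun setT (fun w => D k w).
Proof.
exact (@sapd_dist_measurable _ _ _ _ _ _ _ _ _ _ a pp pb o x0 y0 xs ys
  deltax deltay pp_valid a_adm Hpb x0_dom y0_dom noise k _ _).
Qed.

Let r01 : 0 <= r < 1.
Proof.
have [_ _ /andP[r0 r1] _ _] := a_adm.
by rewrite divr_ge0 ?(addr_ge0 ler01 (ltW r0)) //= ltr_pdivrMr // mul1r ltrD2l.
Qed.

Let mle (f : T -> R) (t : R) : measurable_fun setT f -> measurable [set w | f w <= t].
Proof.
move=> mf; have -> : [set w | f w <= t] = f @^-1` `]-oo, t]%classic.
  by apply/seteqP; split => w /=; rewrite in_itv.
by rewrite -[X in measurable X]setTI; exact: mf.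
Qed.

Lemma sapd_D_quantile k p : 0 <= p < 1 ->
  let Xi i := variance_weight i a pp * deltax ^+ 2
              + variance_weight i a pp * deltay ^+ 2 in
  (p%:E <= P [set w | (D k.+1 w + D k w <=
     ((1 + rho a) / 2) ^+ k * (distance_cst a pp * sapd_D_init a x0 y0 xs ys + Xi 0)
     + Xi 1 + Xi 2 * ln (1 / (1 - p)))%R])%E.
Proof.
move=> p01; cbv zeta.
have h := @sapd_tail _ _ _ _ _ _ _ _ _ _ a pp pb o x0 y0 xs ys deltax deltay
  pp_valid a_adm Hpb saddle x0_dom y0_dom noise k p p01.
apply: (le_trans h); apply: le_measure; rewrite ?inE.
- by apply: (mle _ (measurable_funD (mD k.+1) (mD k))).
- by apply: (mle _ (measurable_funD (mD k.+1) (mD k))).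
move=> w /= /le_trans; apply; rewrite /variance_weight /= /distance_cst.
have rk0 : 0 <= r ^+ k by apply: exprn_ge0; case/andP: r01.
have D20 : 0 <= D2 by rewrite addr_ge0 ?sqr_ge0.
have := mulr_ge0 rk0 D20; rewrite /contraction /D2 in D20 *.
move: (noise_level a pp) (moment_cst a pp) (ln _) (((1 + rho a) / 2) ^+ k).
move: (sapd_D_init _ _ _ _ _) (initial_cst _ _) => u v N M L c.
by move: (deltax ^+ 2) (deltay ^+ 2) D20 => p' q' *; lra.
Qed.

Let sqdistE k w : sapd_sqdist pb o a x0 y0 xs ys k w =
  enorm (sapd_x pb o a x0 y0 k w - xs) ^+ 2 + enorm (sapd_y pb o a x0 y0 k w - ys) ^+ 2.
Proof.
rewrite /sapd_sqdist opp_row_mx add_row_mx /enorm !sqr_sqrtr; last 3 first.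
- by apply: sumr_ge0 => i _; exact: sqr_ge0.
- by apply: sumr_ge0 => i _; exact: sqr_ge0.
- by apply: sumr_ge0 => i _; exact: sqr_ge0.
by rewrite big_split_ord /=; congr (_ + _); apply: eq_bigr => i _;
  rewrite ?row_mxEl ?row_mxEr.
Qed.

Let dist_arith (t s g X Y : R) : 0 < t -> 0 < s -> 2^-1 <= g -> 0 <= X -> 0 <= Y ->
  X + Y <= 4 * (t + s) * ((2 * t)^-1 * X + g / (2 * s) * Y).
Proof.
move=> t0 s0 h X0 Y0; have g0 : 0 <= g by apply: le_trans h; rewrite invr_ge0.
have -> : 4 * (t + s) * ((2 * t)^-1 * X + g / (2 * s) * Y) =
    2 * X + 2 * (s / t * X) + 2 * (g * Y) + 2 * (g * (t / s * Y)).
  by field; rewrite !gt_eqF.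
have h1 : 0 <= s / t * X := mulr_ge0 (divr_ge0 (ltW s0) (ltW t0)) X0.
have h2 : 0 <= g * (t / s * Y) :=
  mulr_ge0 g0 (mulr_ge0 (divr_ge0 (ltW t0) (ltW s0)) Y0).
have h3 : 2^-1 * Y <= g * Y := ler_wpM2r Y0 h.
by move: (s / t * X) (g * (t / s * Y)) (g * Y) h1 h2 h3 => *; lra.
Qed.

Let sqdist_le k w : 2^-1 <= 1 - alpha a * sigma a ->
  sapd_sqdist pb o a x0 y0 xs ys k w <= 4 * stepsize a * D k w.
Proof.
have [[t0 s0] _ _ _ _] := a_adm; rewrite sqdistE /sapd_D /stepsize => h.
exact (dist_arith t0 s0 h (sqr_ge0 _) (sqr_ge0 _)).
Qed.

Let D_ge0 k w : 2^-1 <= 1 - alpha a * sigma a -> 0 <= D k w.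
Proof.
have [[t0 s0] _ _ _ _] := a_adm => h.
have g0 : 0 <= 1 - alpha a * sigma a by apply: le_trans h; rewrite invr_ge0.
have two0 : 0 <= (2 : R) by [].
apply: addr_ge0; apply: mulr_ge0; rewrite ?sqr_ge0 //.
  by rewrite invr_ge0; exact: mulr_ge0 two0 (ltW t0).
exact: (divr_ge0 g0 (mulr_ge0 two0 (ltW s0))).
Qed.

Let msq k : measurable_fun setT (sapd_sqdist pb o a x0 y0 xs ys k).
Proof.
have -> : sapd_sqdist pb o a x0 y0 xs ys k = (fun w =>
    1 * enorm (sapd_x pb o a x0 y0 k w - xs) ^+ 2
    + 1 * enorm (sapd_y pb o a x0 y0 k w - ys) ^+ 2).
  by apply/funext => w; rewrite sqdistE !mul1r.
exact (@sapd_dist_measurable _ _ _ _ _ _ _ _ _ _ a pp pb o x0 y0 xs ys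
  deltax deltay pp_valid a_adm Hpb x0_dom y0_dom noise k 1 1).
Qed.

Let limit_arith (S N M nl mc rk p' q' V L s : R) : 0 <= s -> s <= S ->
  0 <= N -> nl <= N -> 0 <= M -> mc <= M -> 0 <= p' -> 0 <= q' -> 0 <= L ->
  p' <= V -> q' <= V -> rk <= V -> 0 <= rk -> 0 <= nl -> 0 <= mc ->
  4 * s * (4 * (rk + nl * (p' + q')) + 4 * (mc * (p' + q')) * L)
  <= 4 * S * (4 * (1 + 2 * N + 2 * M)) * (V * (1 + L)).
Proof.
move=> s0 sS N0 nN M0 mM p0 q0 L0 pV qV rV r0 nl0 mc0.
have V0 : 0 <= V := le_trans p0 pV.
have pq : p' + q' <= 2 * V by lra.
have pq0 : 0 <= p' + q' by rewrite addr_ge0.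
have h1 : nl * (p' + q') <= N * (2 * V) by apply: ler_pM.
have h2 : mc * (p' + q') <= M * (2 * V) by apply: ler_pM.
have {}h2 := ler_wpM2r L0 h2.
have n0 := mulr_ge0 nl0 pq0; have m0 := mulr_ge0 (mulr_ge0 mc0 pq0) L0.
have VL := mulr_ge0 V0 L0; have NVL := mulr_ge0 N0 VL; have MV := mulr_ge0 M0 V0.
have h3 : 4 * (rk + nl * (p' + q')) + 4 * (mc * (p' + q')) * L <=
    4 * (1 + 2 * N + 2 * M) * (V * (1 + L)).
  by move: h1 h2; lra.
apply: (@le_trans _ _ (4 * S * (4 * (rk + nl * (p' + q')) + 4 * (mc * (p' + q')) * L))).
  by apply: ler_wpM2r; lra.
rewrite -[leRHS]mulrA; apply: ler_wpM2l => //; lra.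
Qed.

(** The transient term decays geometrically, so from some iteration on it is
    below the noise variance itself. *)
Lemma limsup_quantile (S N M p : R) : 2^-1 <= 1 - alpha a * sigma a ->
  stepsize a <= S -> 0 <= noise_level a pp <= N -> 0 <= moment_cst a pp <= M ->
  0 <= p < 1 ->
  (limn_esup (fun k => quantile P (sapd_sqdist pb o a x0 y0 xs ys k) p)
   <= (4 * S * (4 * (1 + 2 * N + 2 * M))
        * (Num.max (deltax ^+ 2) (deltay ^+ 2) * (1 + ln (1 / (1 - p)))))%:E)%E.
Proof.
move=> gap sS /andP[nl0 nN] /andP[mc0 mM] p01; apply: limn_esup_le.
set V := Num.max _ _; set u0 := initial_cst a pp * sapd_D_init a x0 y0 xs ys.
have dx0 := deltax_gt0 noise; have dy0 := deltay_gt0 noise.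
have V0 : 0 < V by rewrite lt_max exprn_gt0.
have L0 : 0 <= ln (1 / (1 - p)).
  case/andP: p01 => p0 p1; apply: ln_ge0.
  by rewrite ler_pdivlMr ?subr_gt0 // mul1r gerBl.
have p'V : deltax ^+ 2 <= V by rewrite le_max lexx.
have q'V : deltay ^+ 2 <= V by rewrite le_max lexx orbT.
have [[t0 s0] _ _ _ _] := a_adm; have [[mx0 my0] _ _ _ _] := pp_valid.
have u00 : 0 <= u0.
  apply: mulr_ge0.
    exact (addr_ge0 (addr_ge0 ler01 (mulr_ge0 (ltW t0) (ltW mx0)))
            (mulr_ge0 (ltW s0) (ltW my0))).
  apply: addr_ge0; apply: mulr_ge0; rewrite ?sqr_ge0 // invr_ge0.
    exact: (mulr_ge0 (ler0n _ 2) (ltW t0)).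
  exact: (mulr_ge0 (ler0n _ 2) (ltW s0)).
have rlt1 : `|r| < 1 by case/andP: r01 => r0 r1; rewrite ger0_norm.
have decay : geometric u0 r @ \oo --> (0 : R) by exact: cvg_geometric.
near=> k.
have rk : r ^+ k * u0 <= V.
  rewrite mulrC -[_ * _]/(geometric u0 r k); near: k.
  exact: (cvgr_le _ decay).
have rk0 : 0 <= r ^+ k * u0.
  have rr : 0 <= r ^+ k by apply: exprn_ge0; case/andP: r01.
  exact: (mulr_ge0 rr u00).
set t := (X in X%:E); set q := 4 * (r ^+ k * u0 + noise_level a pp * D2)
  + 4 * (moment_cst a pp * D2) * ln (1 / (1 - p)).
have qt : 4 * stepsize a * q <= t.
  exact: (limit_arith (ltW (stepsize_gt0 a_adm)) sS (le_trans nl0 nN) nN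
    (le_trans mc0 mM) mM (sqr_ge0 _) (sqr_ge0 _) L0 p'V q'V rk rk0 nl0 mc0).
apply: ereal_inf_lbound; exists t => //=.
have h := @sapd_tail _ _ _ _ _ _ _ _ _ _ a pp pb o x0 y0 xs ys deltax deltay
  pp_valid a_adm Hpb saddle x0_dom y0_dom noise k p p01.
apply: (le_trans h); apply: le_measure; rewrite ?inE.
- by apply: (mle _ (measurable_funD (mD k.+1) (mD k))).
- exact: (mle _ (msq k)).
move=> w /= Dq; apply: le_trans qt; apply: le_trans (sqdist_le k w gap) _.
apply: ler_wpM2l; first exact: (mulr_ge0 (ler0n _ 4) (ltW (stepsize_gt0 a_adm))).
by apply: le_trans Dq; rewrite lerDr; exact: D_ge0.
Unshelve. all: by end_near. Qed.

End high_probability_bounds.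

Unset Implicit Arguments.

Theorem theorem4 (R : realType) :
  exists (C : algo_params R -> problem_params R -> R)
         (Xix Xiy : 'I_3 -> algo_params R -> problem_params R -> R),
  (forall (a : algo_params R) (pp : problem_params R),
     valid_problem_params pp -> admissible a pp ->
   forall (m n : nat) (pb : problem R m n), problem_assumption pp pb ->
   forall (xs : 'rV[R]_m) (ys : 'rV[R]_n), saddle_point pb xs ys ->
   forall (d dx dy : measure_display) (T : measurableType d)
     (P : probability T R) (Wx : measurableType dx) (Wy : measurableType dy)
     (o : stoch_oracle m n P Wx Wy) (x0 : 'rV[R]_m) (y0 : 'rV[R]_n),
     edom (pf pb) x0 -> edom (pg pb) y0 ->
   forall deltax deltay : R, noise_assumption pb o a x0 y0 deltax deltay ->
   let Xi i := Xix i a pp * deltax ^+ 2 + Xiy i a pp * deltay ^+ 2 in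
   forall (k : nat) (p : R), 0 <= p < 1 ->
   let q := ((1 + rho a) / 2) ^+ k
              * (C a pp * sapd_D_init a x0 y0 xs ys + Xi 0)
            + Xi 1 + Xi 2 * ln (1 / (1 - p)) in
   (p%:E <= P [set w | (sapd_D pb o a x0 y0 xs ys k.+1 w
                        + sapd_D pb o a x0 y0 xs ys k w <= q)%R])%E)
  /\
  (forall pp : problem_params R, valid_problem_params pp ->
   [/\ \forall th \near 1^'-, admissible (chambolle_pock pp th) pp,
       (fun th => C (chambolle_pock pp th) pp : R^o) =Theta_(1^'-) (cst (1 : R^o)),
       forall i, (fun th => Xix i (chambolle_pock pp th) pp : R^o)
                   =Theta_(1^'-) (cst (1 : R^o)),
       forall i, (fun th => Xiy i (chambolle_pock pp th) pp : R^o)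
                   =Theta_(1^'-) (cst (1 : R^o))
     & exists K : R, \forall th \near 1^'-,
       forall (m n : nat) (pb : problem R m n), problem_assumption pp pb ->
       forall (xs : 'rV[R]_m) (ys : 'rV[R]_n), saddle_point pb xs ys ->
       forall (d dx dy : measure_display) (T : measurableType d)
         (P : probability T R) (Wx : measurableType dx) (Wy : measurableType dy)
         (o : stoch_oracle m n P Wx Wy) (x0 : 'rV[R]_m) (y0 : 'rV[R]_n),
         edom (pf pb) x0 -> edom (pg pb) y0 ->
       forall deltax deltay : R,
         noise_assumption pb o (chambolle_pock pp th) x0 y0 deltax deltay ->
       forall p : R, 0 <= p < 1 ->
       (limn_esup (fun k => quantile P
            (sapd_sqdist pb o (chambolle_pock pp th) x0 y0 xs ys k) p)
        <= (K * ((1 - th) * Num.max (deltax ^+ 2) (deltay ^+ 2)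
                 * (1 + ln (1 / (1 - p)))))%:E)%E]).
Proof.
exists (@distance_cst R), (@variance_weight R), (@variance_weight R); split.
  move=> a pp pp_valid a_adm m n pb Hpb xs ys saddle d dx dy T P Wx Wy o x0 y0.
  move=> x0_dom y0_dom deltax deltay noise Xi k p p01.
  exact: (sapd_D_quantile pp_valid a_adm Hpb saddle x0_dom y0_dom noise k p01).
move=> pp pp_valid.
have [N hN] := bounded_noise_level pp_valid.
have [M hM] := bounded_moment_cst pp_valid.
have [B hB] := bounded_stepsize_rate pp_valid.
have lower : \forall th \near (1 : R)^'-,
    forall i, 1 <= variance_weight i (chambolle_pock pp th) pp.
  near=> th => i.
  have /andP[n0 _] : 0 <= noise_level (chambolle_pock pp th) pp <= N by near: th.
  have a_adm : admissible (chambolle_pock pp th) pp.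
    by near: th; exact: chambolle_pock_admissible.
  case: i => -[|[|[|//]]] /= ?; rewrite /variance_weight /= ?lexx //.
    by rewrite lerDl; exact: mulr_ge0.
  have := moment_cst_ge pp_valid a_adm; move: (moment_cst _ _) => M'; lra.
have upper i : bounded_near1 (fun th => variance_weight i (chambolle_pock pp th) pp).
  case: i => -[|[|[|//]]] ?; rewrite /variance_weight /=.
  - exact: bounded_cst.
  - apply: boundedD; first exact: bounded_cst.
    by apply: boundedM; [exact: bounded_cst | exact: bounded_noise_level].
  - by apply: boundedM; [exact: bounded_cst | exact: bounded_moment_cst].
have hw i : (fun th => variance_weight i (chambolle_pock pp th) pp : R^o)
    =Theta_(1^'-) (cst (1 : R^o)).
  apply: (@eqTheta_cst1 _ _ 1) => //.
  by near=> th; move: (i); near: th.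
split => //.
- exact: chambolle_pock_admissible.
- apply: (@eqTheta_cst1 _ _ 4) => //.
    near=> th.
    have [[t0 s0] _ _ _ _] : admissible (chambolle_pock pp th) pp.
      by near: th; exact: chambolle_pock_admissible.
    have [[mx0 my0] _ _ _ _] := pp_valid.
    have h1 := mulr_ge0 (ltW t0) (ltW mx0); have h2 := mulr_ge0 (ltW s0) (ltW my0).
    rewrite /distance_cst /initial_cst ler_peMr // -addrA lerDl.
    exact: addr_ge0 h1 h2.
  by apply: boundedM; [exact: bounded_cst | exact: bounded_initial_cst].
exists (4 * B * (4 * (1 + 2 * N + 2 * M))); near=> th => m n pb Hpb xs ys saddle.
have a_adm : admissible (chambolle_pock pp th) pp.
  by near: th; exact: chambolle_pock_admissible.
have nl : 0 <= noise_level (chambolle_pock pp th) pp <= N by near: th.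
have mc : 0 <= moment_cst (chambolle_pock pp th) pp <= M by near: th.
have gap : 2^-1 <= 1 - alpha (chambolle_pock pp th) * sigma (chambolle_pock pp th).
  by near: th; exact: dual_gap_chambolle_pock.
have /andP[_ sB] : 0 <= stepsize_rate pp th <= B by near: th.
have th1 : th < 1 by near: th; exact: nbhs_left_lt.
have sS : stepsize (chambolle_pock pp th) <= (1 - th) * B.
  by move: sB; rewrite /stepsize_rate ler_pdivrMr ?subr_gt0 // mulrC.
move=> d dx dy T P Wx Wy o x0 y0 x0_dom y0_dom deltax deltay noise p p01.
have := limsup_quantile pp_valid a_adm Hpb saddle x0_dom y0_dom noise
  gap sS nl mc p01.
move=> /le_trans; apply; rewrite lee_fin; apply: ler_eq.
by move: (Num.max _ _) (ln _) => V L; ring.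
Unshelve. all: by end_near. Qed.
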